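(* Let $G$ be the Barnes $G$-function. For every fixed integer $n\ge1$, as $z\to\infty$ in the half-plane $\Re(z)>0$, $$\log G(z+1)=\frac{z^2}{2}\Big(\log z-\frac32\Big)-\frac{\log z}{12}-z\,\zeta'(0)+\zeta'(-1)+\sum_{k=1}^{n}\frac{B_{2k+2}}{4k(k+1)z^{2k}}+O\Big(\frac{1}{z^{2n+2}}\Big).$$
   Context: The Barnes $G$-function is the entire function characterized by $G(z+1)=\Gamma(z)G(z)$ for $z\in\mathbb{C}$ ($\Gamma$ the Euler gamma function), $G(1)=G(2)=G(3)=1$, and $\frac{d^3}{dz^3}\log G(z)\ge0$ for $z>0$; equivalently $$G(z+1)=(2\pi)^{z/2}\exp\Big(-\frac{z+z^2(1+\gamma)}{2}\Big)\prod_{k=1}^{\infty}\Big(1+\frac{z}{k}\Big)^k\exp\Big(\frac{z^2}{2k}-z\Big),$$ where $\gamma$ is the Euler–Mascheroni constant. $B_m$ are the Bernoulli numbers ($B_4=-\frac1{30}$), $\zeta$ is the Riemann zeta function, and $\log z$, $\log G(z+1)$ are the analytic branches on $\Re(z)>0$ that are real for $z>0$. *)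

(* Defs.v *)
From Stdlib Require Import Reals Arith.
From Coquelicot Require Import Coquelicot.

Open Scope R_scope.

Definition Cexp (z : C) : C :=
  (exp (Re z) * cos (Im z), exp (Re z) * sin (Im z)).

Definition Clim_seq (u : nat -> C) : C :=
  (real (Lim_seq (fun n => Re (u n))), real (Lim_seq (fun n => Im (u n)))).

(* Product of [f 1, ..., f n]; there is no factor [f 0]. *)
Fixpoint Cprod (f : nat -> C) (n : nat) : C :=
  match n with
  | O => RtoC 1
  | S m => (Cprod f m * f (S m))%C
  end.

Definition analytic_at (f : C -> C) (z0 : C) : Prop :=
  exists (a : nat -> C) (r : R), 0 < r /\
    forall z : C, Cmod (z - z0) < r ->
      @is_pseries C_AbsRing C_NormedModule a (z - z0)%C (f z).

(* Since the right half-plane is connected and [exp] is injective on the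
   reals, at most one such [L] exists there for a given [f]. *)
Definition is_log_branch (f L : C -> C) : Prop :=
  (forall z : C, 0 < Re z -> analytic_at L z /\ Cexp (L z) = f z) /\
  (forall x : R, 0 < x -> Im (L (RtoC x)) = 0).

Definition euler_gamma : R :=
  real (Lim_seq (fun n => sum_n_m (fun k => / INR k) 1 n - ln (INR n))).

(* The Weierstrass product, which is usually written for [G (z + 1)];
   hence the shift [z := w - 1]. *)
Definition BarnesG (w : C) : C :=
  let z := (w - 1)%C in
  (Cexp (z / 2 * ln (2 * PI))
   * Cexp (- ((z + z ^ 2 * (1 + euler_gamma)%R) / 2))
   * Clim_seq (Cprod (fun k =>
       (1 + z / INR k) ^ k * Cexp (z ^ 2 / (2 * INR k)%R - z))))%C.

(* [zeta] is characterized as the analytic continuation to [C \ {1}] of the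
   Dirichlet series [sum_(n >= 1) n^(-s)]; its value at the pole is
   irrelevant. *)
Definition is_riemann_zeta (zeta : C -> C) : Prop :=
  (forall s : C, s <> RtoC 1 -> analytic_at zeta s) /\
  (forall s : C, 1 < Re s ->
     @is_series C_AbsRing C_NormedModule
       (fun n => Cexp (- s * ln (INR (S n)))%C) (zeta s)).

(* [bernoulli_table n j] is [B_j] for [j <= n], computed from [B_0 = 1] and
   [sum_(i <= n) binom(n+1, i) B_i = 0] for [n >= 1]; so [B_1 = -1/2]. *)
Fixpoint bernoulli_table (n : nat) : nat -> R :=
  match n with
  | O => fun _ => 1
  | S m => fun j =>
      if (j <=? m)%nat then bernoulli_table m j
      else - / INR (S n) *
           sum_f_R0 (fun i => Binomial.C (S n) i * bernoulli_table m i) m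
  end.

Definition bernoulli (n : nat) : R := bernoulli_table n n.

Fact bernoulli_4 : bernoulli 4 = - / 30.
Proof.
cbv [bernoulli bernoulli_table Nat.leb sum_f_R0 Binomial.C fact Nat.sub
     Nat.mul Nat.add INR].
field.
Qed.

(* Main.v *)
(* The function [L z := log G (z + 1)] satisfies
   [L (z + 1) - 2 * L z + L (z - 1) = log z].  Let [A] be its asymptotic
   expansion truncated at [n].  A Taylor expansion in [1 / w], together with an
   identity for Bernoulli numbers, shows that
   [log w - (A (w + 1) - 2 * A w + A (w - 1))] is [O (w ^ - (2 n + 4))].
   Summing by parts twice in the logarithm of the Weierstrass product gives
   [log G (z + 1) = A z + sum_(k >= 1) k * O ((z + k) ^ - (2 n + 4))], where
   the sum is [O (z ^ - (2 n + 2))], as soon as the boundary terms of the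
   summation tend to 0.  They do because of the values of three constants:
   Euler's constant, the limit of
   [sum_(k <= N) k log k - (N^2/2 + N/2 + 1/12) log N + N^2/4], which is
   [1/12 - zeta'(-1)], and [zeta'(0) = - log (2 pi) / 2].  The last two come
   from the Euler-Maclaurin continuation of [zeta], which agrees with [zeta] by
   the identity theorem along a path around the pole, and from Wallis'
   product. *)

Require Import Defs.
From Stdlib Require Import Reals Factorial Wf_nat Classical_Prop Lra Lia Psatz.
From Coquelicot Require Import Coquelicot.

Open Scope R_scope.

(** The second difference annihilates affine functions, so the terms in [zeta'(0)] and [zeta'(-1)]
    are invisible to the local computation with [u = / w]. They enter only through the boundary
    terms of the summation, which is why exact limits at infinity are needed. The branches in the
    statement are arbitrary. All computations use an explicit logarithm [clog] and an explicit
    series [logG_lim]; a continuity argument along segments starting at 1 identifies them with the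
    given branches at the end. Taylor formulas are proved along real segments by a mean value
    inequality, and Cauchy's estimate by averaging over roots of unity, so no contour integral
    occurs. The zeta function is handled through [(1 - s) * zeta s], which has no pole, on a bounded
    region containing 2, [Ci], 0 and -1. There the derivative of the limit is the limit of the
    derivatives, by Weierstrass' theorem on power series coefficients. *)

(** * Finite sums and limits of complex sequences *)

Fixpoint Csum (f : nat -> C) (n : nat) : C :=
  match n with O => RtoC 0 | S m => (Csum f m + f m)%C end.

Fixpoint Rsum (f : nat -> R) (n : nat) : R :=
  match n with O => 0 | S m => Rsum f m + f m end.

Definition Ccv (u : nat -> C) (l : C) : Prop :=
  is_lim_seq (fun n => Cmod (u n - l)) 0.

Lemma C_eq (z w : C) : Re z = Re w -> Im z = Im w -> z = w.
Proof. destruct z, w; simpl; intros; subst; reflexivity. Qed.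

Lemma Re_plus (z w : C) : Re (z + w) = Re z + Re w. Proof. reflexivity. Qed.
Lemma Im_plus (z w : C) : Im (z + w) = Im z + Im w. Proof. reflexivity. Qed.
Lemma Re_opp (z : C) : Re (- z) = - Re z. Proof. reflexivity. Qed.
Lemma Re_minus (z w : C) : Re (z - w) = Re z - Re w. Proof. reflexivity. Qed.
Lemma Im_minus (z w : C) : Im (z - w) = Im z - Im w. Proof. reflexivity. Qed.
Lemma Im_le_Cmod (z : C) : Rabs (Im z) <= Cmod z.
Proof.
  destruct z as [x y]; simpl.
  apply Rle_trans with (2 := Rmax_Cmod (x, y)); apply Rmax_r.
Qed.

(** Turns a Lipschitz bound into an epsilon-delta statement; the [+ 1] keeps the denominator
    positive when [K = 0]. *)
Lemma Rmult_lt_of_lt_div (K x eps : R) :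
  0 <= x -> x < eps / (Rabs K + 1) -> K * x < eps.
Proof.
  intros Hx H; assert (HK := Rabs_pos K).
  apply Rle_lt_trans with ((Rabs K + 1) * x).
  - apply Rmult_le_compat_r; auto; generalize (Rle_abs K); lra.
  - replace eps with ((Rabs K + 1) * (eps / (Rabs K + 1))) by (field; lra).
    apply Rmult_lt_compat_l; lra.
Qed.

Lemma Re_le_Cmod (z : C) : Re z <= Cmod z.
Proof. apply Rle_trans with (1 := Rle_abs _); apply re_le_Cmod. Qed.

Lemma Cmod_le_Re_Im (z : C) : Cmod z <= Rabs (Re z) + Rabs (Im z).
Proof.
  replace z with (RtoC (Re z) + Ci * RtoC (Im z))%C at 1.
  - apply Rle_trans with (1 := Cmod_triangle _ _).
    rewrite Cmod_mult, Cmod_Ci, !Cmod_R; lra.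
  - apply C_eq; simpl; ring.
Qed.

Lemma Cmod_sqr (z : C) : Cmod z * Cmod z = Re z * Re z + Im z * Im z.
Proof. generalize (Cmod2_alt z); simpl; rewrite !Rmult_1_r; auto. Qed.

Lemma Cmod_minus_sym (z w : C) : Cmod (z - w) = Cmod (w - z).
Proof. rewrite <- Cmod_opp; f_equal; ring. Qed.

Lemma Cmod_minus_le (z w : C) : Cmod (z - w) <= Cmod z + Cmod w.
Proof. unfold Cminus; rewrite <- (Cmod_opp w); apply Cmod_triangle. Qed.

Lemma Cmod_minus_ge (z w : C) : Cmod z - Cmod w <= Cmod (z - w).
Proof.
  replace z with ((z - w) + w)%C at 1 by ring.
  generalize (Cmod_triangle (z - w) w); lra.
Qed.

Lemma Cmod_dist_triangle (x y z : C) :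
  Cmod (x - z) <= Cmod (x - y) + Cmod (y - z).
Proof.
  replace (x - z)%C with ((x - y) + (y - z))%C by ring; apply Cmod_triangle.
Qed.

Lemma Cmod_INR (n : nat) : Cmod (INR n) = INR n.
Proof. rewrite Cmod_R; apply Rabs_pos_eq, pos_INR. Qed.

Lemma RtoC_neq_0 (x : R) : x <> 0 -> RtoC x <> RtoC 0.
Proof. intros H E; apply H; now apply RtoC_inj. Qed.

Lemma Cneq_0_Re (z : C) : 0 < Re z -> z <> RtoC 0.
Proof. intros H E; rewrite E in H; simpl in H; lra. Qed.

Lemma Rsum_ext (f g : nat -> R) n :
  (forall k, (k < n)%nat -> f k = g k) -> Rsum f n = Rsum g n.
Proof.
  induction n; intros H; simpl; auto.
  rewrite IHn, (H n) by auto with arith; auto.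
Qed.

Lemma Rsum_le (f g : nat -> R) n :
  (forall k, (k < n)%nat -> f k <= g k) -> Rsum f n <= Rsum g n.
Proof.
  induction n; intros H; simpl; [lra|].
  apply Rplus_le_compat; auto with arith.
Qed.

Lemma Rsum_plus (f g : nat -> R) n :
  Rsum (fun k => f k + g k) n = Rsum f n + Rsum g n.
Proof. induction n; simpl; [ring|rewrite IHn; ring]. Qed.

Lemma Rsum_scal (c : R) (f : nat -> R) n :
  Rsum (fun k => c * f k) n = c * Rsum f n.
Proof. induction n; simpl; [ring|rewrite IHn; ring]. Qed.

Lemma Rsum_0 (f : nat -> R) n :
  (forall k, (k < n)%nat -> f k = 0) -> Rsum f n = 0.
Proof.
  induction n; intros H; simpl; auto.
  rewrite IHn, (H n) by auto with arith; ring.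
Qed.

Lemma Rsum_shift (f : nat -> R) m n :
  Rsum f (m + n) = Rsum f m + Rsum (fun k => f (m + k)%nat) n.
Proof.
  induction n; simpl; [rewrite Nat.add_0_r; ring|].
  rewrite Nat.add_succ_r; simpl; rewrite IHn; ring.
Qed.

Lemma Rsum_S_l (f : nat -> R) n :
  Rsum f (S n) = f O + Rsum (fun k => f (S k)) n.
Proof. rewrite (Rsum_shift f 1 n : Rsum f (S n) = _); simpl; ring. Qed.

Lemma Csum_ext (f g : nat -> C) n :
  (forall k, (k < n)%nat -> f k = g k) -> Csum f n = Csum g n.
Proof.
  induction n; intros H; simpl; auto.
  rewrite IHn, (H n) by auto with arith; auto.
Qed.

Lemma Csum_plus (f g : nat -> C) n :
  Csum (fun k => f k + g k)%C n = (Csum f n + Csum g n)%C.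
Proof. induction n; simpl; [ring|rewrite IHn; ring]. Qed.

Lemma Csum_minus (f g : nat -> C) n :
  Csum (fun k => f k - g k)%C n = (Csum f n - Csum g n)%C.
Proof. induction n; simpl; [ring|rewrite IHn; ring]. Qed.

Lemma Csum_scal (c : C) (f : nat -> C) n :
  Csum (fun k => c * f k)%C n = (c * Csum f n)%C.
Proof. induction n; simpl; [ring|rewrite IHn; ring]. Qed.

Lemma Csum_0 (f : nat -> C) n :
  (forall k, (k < n)%nat -> f k = 0) -> Csum f n = 0.
Proof.
  induction n; intros H; simpl; auto.
  rewrite IHn, (H n) by auto with arith; ring.
Qed.

Lemma Csum_power_series_0 (c : nat -> C) n :
  Csum (fun j => c j * 0 ^ j)%C (S n) = c 0%nat.
Proof.
  induction n as [|n IH]; [simpl; ring|].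
  change (Csum ?f (S (S n))) with (Csum f (S n) + f (S n))%C; cbv beta.
  rewrite IH, Cpow_S; ring.
Qed.

Lemma Csum_shift (f : nat -> C) m n :
  Csum f (m + n) = (Csum f m + Csum (fun k => f (m + k)%nat) n)%C.
Proof.
  induction n; simpl; [rewrite Nat.add_0_r; ring|].
  rewrite Nat.add_succ_r; simpl; rewrite IHn; ring.
Qed.

Lemma Csum_S_l (f : nat -> C) n :
  Csum f (S n) = (f O + Csum (fun k => f (S k)) n)%C.
Proof. rewrite (Csum_shift f 1 n : Csum f (S n) = _); simpl; ring. Qed.

Lemma Csum_RtoC (f : nat -> R) n :
  Csum (fun k => RtoC (f k)) n = RtoC (Rsum f n).
Proof. induction n; simpl; auto. rewrite IHn, RtoC_plus; auto. Qed.

Lemma Csum_swap (f : nat -> nat -> C) m n :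
  Csum (fun i => Csum (f i) n) m = Csum (fun j => Csum (fun i => f i j) m) n.
Proof.
  induction m; simpl.
  - induction n; simpl; auto. rewrite <- IHn; ring.
  - rewrite IHm, <- Csum_plus; auto.
Qed.

Lemma Cmod_Csum_le (f : nat -> C) (g : nat -> R) n :
  (forall k, (k < n)%nat -> Cmod (f k) <= g k) -> Cmod (Csum f n) <= Rsum g n.
Proof.
  induction n; intros H; simpl; [rewrite Cmod_0; lra|].
  apply Rle_trans with (1 := Cmod_triangle _ _).
  apply Rplus_le_compat; auto with arith.
Qed.

Lemma Ccv_le (u : nat -> C) (l : C) (v : nat -> R) :
  (exists N, forall n, (N <= n)%nat -> Cmod (u n - l) <= v n) ->
  is_lim_seq v 0 -> Ccv u l.
Proof.
  intros [N H] Hv; unfold Ccv.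
  apply (is_lim_seq_le_le_loc (fun _ => 0) _ v 0).
  - exists N; intros n Hn; split; auto using Cmod_ge_0.
  - apply is_lim_seq_const.
  - exact Hv.
Qed.

Lemma Ccv_ext_loc (u v : nat -> C) (l : C) N :
  (forall n, (N <= n)%nat -> u n = v n) -> Ccv u l -> Ccv v l.
Proof.
  intros H Hu; apply (is_lim_seq_ext_loc (fun n => Cmod (u n - l))); auto.
  exists N; intros n Hn; rewrite H; auto.
Qed.

Lemma Ccv_ext (u v : nat -> C) (l : C) :
  (forall n, u n = v n) -> Ccv u l -> Ccv v l.
Proof. intros H; apply (Ccv_ext_loc u v l 0); auto. Qed.

Lemma Ccv_const (l : C) : Ccv (fun _ => l) l.
Proof.
  apply (is_lim_seq_ext (fun _ => 0)); [|apply is_lim_seq_const].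
  intros n; replace (l - l)%C with (RtoC 0) by ring; rewrite Cmod_0; auto.
Qed.

Lemma is_lim_seq_plus_0 (u v : nat -> R) :
  is_lim_seq u 0 -> is_lim_seq v 0 -> is_lim_seq (fun n => u n + v n) 0.
Proof.
  intros Hu Hv; replace (Finite 0) with (Finite (0 + 0)) by (f_equal; ring).
  now apply is_lim_seq_plus'.
Qed.

Lemma is_lim_seq_scal_0 (c : R) (u : nat -> R) :
  is_lim_seq u 0 -> is_lim_seq (fun n => c * u n) 0.
Proof.
  intros Hu; replace (Finite 0) with (Rbar_mult c 0)
    by (simpl; f_equal; ring).
  now apply is_lim_seq_scal_l.
Qed.

Lemma Ccv_plus (u v : nat -> C) (l m : C) :
  Ccv u l -> Ccv v m -> Ccv (fun n => u n + v n)%C (l + m)%C.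
Proof.
  intros Hu Hv.
  apply Ccv_le with (fun n => Cmod (u n - l) + Cmod (v n - m)).
  - exists O; intros n _.
    replace (u n + v n - (l + m))%C with ((u n - l) + (v n - m))%C by ring.
    apply Cmod_triangle.
  - now apply is_lim_seq_plus_0.
Qed.

Lemma Ccv_scal (c : C) (u : nat -> C) (l : C) :
  Ccv u l -> Ccv (fun n => c * u n)%C (c * l)%C.
Proof.
  intros Hu.
  apply Ccv_le with (fun n => Cmod c * Cmod (u n - l)).
  - exists O; intros n _; rewrite <- Cmod_mult; right; f_equal; ring.
  - now apply is_lim_seq_scal_0.
Qed.

Lemma Ccv_opp (u : nat -> C) (l : C) :
  Ccv u l -> Ccv (fun n => - u n)%C (- l)%C.
Proof.
  intros Hu.
  replace (- l)%C with (- (1) * l)%C by ring.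
  apply Ccv_ext with (fun n => - (1) * u n)%C; [intros; ring|].
  now apply Ccv_scal.
Qed.

Lemma Ccv_minus (u v : nat -> C) (l m : C) :
  Ccv u l -> Ccv v m -> Ccv (fun n => u n - v n)%C (l - m)%C.
Proof. intros Hu Hv; apply Ccv_plus; [|apply Ccv_opp]; auto. Qed.

Lemma Ccv_shift (u : nat -> C) (l : C) p :
  Ccv u l -> Ccv (fun n => u (p + n)%nat) l.
Proof.
  intros H; unfold Ccv.
  apply (is_lim_seq_ext (fun n => Cmod (u (n + p)%nat - l))).
  - intros; do 3 f_equal; lia.
  - apply (is_lim_seq_incr_n (fun n => Cmod (u n - l))); auto.
Qed.

Lemma Ccv_le_lim (u : nat -> C) (l : C) (M : R) N :
  Ccv u l -> (forall n, (N <= n)%nat -> Cmod (u n) <= M) -> Cmod l <= M.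
Proof.
  intros Hu H.
  assert (Rbar_le (Cmod l) (M + 0)) as H1.
  { apply (is_lim_seq_le_loc (fun _ => Cmod l) (fun n => M + Cmod (u n - l))).
    - exists N; intros n Hn.
      generalize (H n Hn) (Cmod_dist_triangle l (u n) 0).
      rewrite (Cmod_minus_sym l (u n)).
      replace (l - 0)%C with l by ring; replace (u n - 0)%C with (u n) by ring.
      lra.
    - apply is_lim_seq_const.
    - apply is_lim_seq_plus'; auto using is_lim_seq_const. }
  simpl in H1; lra.
Qed.

Lemma Ccv_unique (u : nat -> C) (l m : C) : Ccv u l -> Ccv u m -> l = m.
Proof.
  intros Hl Hm.
  apply Ceq_minus, Cmod_eq_0, Rle_antisym; [|apply Cmod_ge_0].
  apply (Ccv_le_lim (fun n => u n - u n)%C _ 0 0).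
  - now apply Ccv_minus.
  - intros n _; replace (u n - u n)%C with (RtoC 0) by ring.
    rewrite Cmod_0; lra.
Qed.

Lemma Ccv_Re (u : nat -> C) (l : C) :
  Ccv u l -> is_lim_seq (fun n => Re (u n)) (Re l).
Proof.
  intros H.
  apply (is_lim_seq_le_le (fun n => Re l - Cmod (u n - l)) _
           (fun n => Re l + Cmod (u n - l))).
  - intros n; generalize (re_le_Cmod (u n - l)); rewrite Re_minus.
    intros H1; apply Rabs_le_between in H1; lra.
  - replace (Re l) with (Re l - 0) at 1 by ring.
    apply is_lim_seq_minus'; auto using is_lim_seq_const.
  - replace (Re l) with (Re l + 0) at 1 by ring.
    apply is_lim_seq_plus'; auto using is_lim_seq_const.
Qed.

Lemma Ccv_Im (u : nat -> C) (l : C) :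
  Ccv u l -> is_lim_seq (fun n => Im (u n)) (Im l).
Proof.
  intros H.
  apply (Ccv_scal (- Ci)) in H; apply Ccv_Re in H.
  replace (Im l) with (Re (- Ci * l)) by (unfold Re, Im; simpl; ring).
  eapply is_lim_seq_ext; [|exact H]; intros n; unfold Re, Im; simpl; ring.
Qed.

Lemma is_lim_seq_abs_minus (u : nat -> R) (l : R) :
  is_lim_seq u l -> is_lim_seq (fun n => Rabs (u n - l)) 0.
Proof.
  intros H; apply (is_lim_seq_abs_0 (fun n => u n - l)).
  replace 0 with (l - l) by ring.
  apply is_lim_seq_minus'; auto using is_lim_seq_const.
Qed.

Lemma Ccv_Re_Im (u : nat -> C) (l : C) :
  is_lim_seq (fun n => Re (u n)) (Re l) ->
  is_lim_seq (fun n => Im (u n)) (Im l) -> Ccv u l.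
Proof.
  intros H1 H2.
  apply Ccv_le with
    (fun n => Rabs (Re (u n) - Re l) + Rabs (Im (u n) - Im l)).
  - exists O; intros n _; apply Cmod_le_Re_Im.
  - apply is_lim_seq_plus_0; now apply is_lim_seq_abs_minus.
Qed.

Lemma Ccv_RtoC (u : nat -> R) (l : R) :
  is_lim_seq u l -> Ccv (fun n => RtoC (u n)) l.
Proof. intros H; apply Ccv_Re_Im; simpl; auto using is_lim_seq_const. Qed.

Lemma Clim_seq_unique (u : nat -> C) (l : C) : Ccv u l -> Clim_seq u = l.
Proof.
  intros H; unfold Clim_seq.
  rewrite (is_lim_seq_unique _ _ (Ccv_Re _ _ H)).
  rewrite (is_lim_seq_unique _ _ (Ccv_Im _ _ H)).
  now destruct l.
Qed.

Lemma Re_Csum (f : nat -> C) n : Re (Csum f n) = Rsum (fun k => Re (f k)) n.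
Proof. induction n; simpl; auto. rewrite <- IHn; auto. Qed.

Lemma Im_Csum (f : nat -> C) n : Im (Csum f n) = Rsum (fun k => Im (f k)) n.
Proof. induction n; simpl; auto. rewrite <- IHn; auto. Qed.

(** Both [f + g] and [g] are nonnegative with bounded sums, so their sums converge monotonically,
    and the sums of [f] are the difference. *)
Lemma Rsum_abs_cv (f g : nat -> R) (B : R) :
  (forall k, Rabs (f k) <= g k) -> (forall n, Rsum g n <= B) ->
  exists l : R, is_lim_seq (Rsum f) l.
Proof.
  intros Hf Hg.
  assert (ex_finite_lim_seq (Rsum (fun k => f k + g k))) as [l1 H1].
  { apply (ex_finite_lim_seq_incr _ (B + B)).
    - intros n; simpl; generalize (Hf n); intros H.
      apply Rabs_le_between in H; lra.
    - intros n; rewrite Rsum_plus.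
      assert (Rsum f n <= Rsum g n).
      { apply Rsum_le; intros k _.
        apply Rle_trans with (1 := Rle_abs _); auto. }
      generalize (Hg n); lra. }
  assert (ex_finite_lim_seq (Rsum g)) as [l2 H2].
  { apply (ex_finite_lim_seq_incr _ B); auto.
    intros n; simpl; generalize (Hf n) (Rabs_pos (f n)); lra. }
  exists (l1 - l2).
  apply (is_lim_seq_ext (fun n => Rsum (fun k => f k + g k) n - Rsum g n)).
  - intros n; rewrite Rsum_plus; ring.
  - now apply is_lim_seq_minus'.
Qed.

Lemma Csum_abs_cv (f : nat -> C) (g : nat -> R) (B : R) :
  (forall k, Cmod (f k) <= g k) -> (forall n, Rsum g n <= B) ->
  exists l, Ccv (Csum f) l.
Proof.
  intros Hf Hg.
  destruct (Rsum_abs_cv (fun k => Re (f k)) g B) as [x Hx]; auto.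
  { intros k; apply Rle_trans with (1 := re_le_Cmod _); auto. }
  destruct (Rsum_abs_cv (fun k => Im (f k)) g B) as [y Hy]; auto.
  { intros k; apply Rle_trans with (1 := Im_le_Cmod _); auto. }
  exists (x, y); apply Ccv_Re_Im; simpl.
  - apply (is_lim_seq_ext (Rsum (fun k => Re (f k)))); auto.
    intros; now rewrite Re_Csum.
  - apply (is_lim_seq_ext (Rsum (fun k => Im (f k)))); auto.
    intros; now rewrite Im_Csum.
Qed.

Lemma Csum_lim_le (f : nat -> C) (l : C) (g : nat -> R) (B : R) :
  Ccv (Csum f) l -> (forall k, Cmod (f k) <= g k) ->
  (forall n, Rsum g n <= B) -> Cmod l <= B.
Proof.
  intros Hl Hf Hg; apply (Ccv_le_lim _ _ B 0 Hl).
  intros n _; apply Rle_trans with (2 := Hg n).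
  apply Cmod_Csum_le; auto.
Qed.

Lemma Csum_tail_le (f : nat -> C) (l : C) (g : nat -> R) (B : R) N :
  Ccv (Csum f) l -> (forall k, (N <= k)%nat -> Cmod (f k) <= g k) ->
  (forall n, Rsum (fun k => g (N + k)%nat) n <= B) ->
  Cmod (l - Csum f N) <= B.
Proof.
  intros Hl Hf Hg.
  apply (Csum_lim_le (fun k => f (N + k)%nat) _ (fun k => g (N + k)%nat)).
  - apply Ccv_ext with (fun n => Csum f (N + n) - Csum f N)%C.
    + intros n; rewrite Csum_shift; ring.
    + apply Ccv_minus; [now apply (Ccv_shift (Csum f))|apply Ccv_const].
  - intros; apply Hf; lia.
  - auto.
Qed.

Lemma Csum_cv_term (f : nat -> C) (l : C) : Ccv (Csum f) l -> Ccv f 0.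
Proof.
  intros H.
  apply Ccv_ext with (fun n => Csum f (1 + n) - Csum f n)%C.
  - intros n; unfold Re, Im; simpl; ring.
  - replace (RtoC 0) with (l - l)%C by ring.
    apply Ccv_minus; auto; apply (Ccv_shift (Csum f)); auto.
Qed.

Lemma Ccv_bounded (u : nat -> C) (l : C) :
  Ccv u l -> exists M, 0 < M /\ forall n, Cmod (u n) <= M.
Proof.
  intros H.
  assert (exists N, forall n, (N <= n)%nat -> Cmod (u n) <= Cmod l + 1)
    as [N HN].
  { apply is_lim_seq_spec in H; destruct (H (mkposreal 1 Rlt_0_1)) as [N HN].
    exists N; intros n Hn; generalize (HN n Hn); simpl.
    rewrite Rminus_0_r, Rabs_pos_eq by apply Cmod_ge_0.
    generalize (Cmod_minus_ge (u n) l); lra. }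
  assert (exists M, forall n, (n < N)%nat -> Cmod (u n) <= M) as [M HM].
  { clear. induction N as [|N [M HM]].
    - exists 0; intros n Hn; lia.
    - exists (Rmax M (Cmod (u N))); intros n Hn.
      destruct (Nat.eq_dec n N) as [->|]; [apply Rmax_r|].
      apply Rle_trans with (2 := Rmax_l _ _); apply HM; lia. }
  exists (Rmax M (Cmod l + 1)); split.
  - apply Rlt_le_trans with (2 := Rmax_r _ _).
    generalize (Cmod_ge_0 l); lra.
  - intros n; destruct (Nat.lt_ge_cases n N).
    + apply Rle_trans with (2 := Rmax_l _ _); auto.
    + apply Rle_trans with (2 := Rmax_r _ _); auto.
Qed.

(** * Complex-valued functions of a real variable *)

(** Derivatives are taken along real segments only, where they can be computed componentwise;
    complex analyticity enters through power series. *)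
Definition cder (f : R -> C) (t : R) (l : C) : Prop :=
  is_derive (fun t => Re (f t)) t (Re l) /\
  is_derive (fun t => Im (f t)) t (Im l).

Lemma cder_eq (f : R -> C) t (l m : C) : l = m -> cder f t l -> cder f t m.
Proof. intros ->; auto. Qed.

Lemma cder_ext (f g : R -> C) t l :
  (forall x, f x = g x) -> cder f t l -> cder g t l.
Proof.
  intros H [H1 H2]; split; eapply is_derive_ext; eauto;
    intros; simpl; now rewrite H.
Qed.

Lemma cder_ext_loc (f g : R -> C) t l :
  locally t (fun x => f x = g x) -> cder f t l -> cder g t l.
Proof.
  intros H [H1 H2]; split; eapply is_derive_ext_loc; eauto;
    apply filter_imp with (2 := H); intros; simpl; congruence.
Qed.

Lemma cder_const (c : C) t : cder (fun _ => c) t 0.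
Proof. split; simpl; apply @is_derive_const. Qed.

Lemma cder_RtoC (f : R -> R) t l :
  is_derive f t l -> cder (fun t => RtoC (f t)) t l.
Proof. intros H; split; simpl; auto; apply @is_derive_const. Qed.

Lemma cder_id t : cder (fun t => RtoC t) t 1.
Proof. apply (cder_RtoC (fun t => t)); apply @is_derive_id. Qed.

Lemma cder_plus (f g : R -> C) t l m :
  cder f t l -> cder g t m -> cder (fun t => f t + g t)%C t (l + m)%C.
Proof.
  intros [] []; split; simpl; apply @is_derive_plus; auto.
Qed.

Lemma cder_opp (f : R -> C) t l :
  cder f t l -> cder (fun t => - f t)%C t (- l)%C.
Proof. intros []; split; simpl; apply @is_derive_opp; auto. Qed.

Lemma cder_minus (f g : R -> C) t l m :
  cder f t l -> cder g t m -> cder (fun t => f t - g t)%C t (l - m)%C.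
Proof. intros; apply cder_plus; auto; apply cder_opp; auto. Qed.

Lemma is_derive_Rmult (f g : R -> R) t l m :
  is_derive f t l -> is_derive g t m ->
  is_derive (fun t => f t * g t) t (l * g t + f t * m).
Proof. intros; apply @is_derive_mult; auto; intros; apply Rmult_comm. Qed.

Lemma is_derive_eq (f : R -> R) t (l m : R) :
  l = m -> is_derive f t l -> is_derive f t m.
Proof. intros ->; auto. Qed.

Lemma cder_mult (f g : R -> C) t l m :
  cder f t l -> cder g t m ->
  cder (fun t => f t * g t)%C t (l * g t + f t * m)%C.
Proof.
  intros [A B] [D E]; split; simpl.
  - eapply is_derive_eq; [|apply (is_derive_minus (V := R_NormedModule));
      apply is_derive_Rmult; eauto].
    unfold minus, plus, opp, Re, Im; simpl; ring.
  - eapply is_derive_eq; [|apply (is_derive_plus (V := R_NormedModule));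
      apply is_derive_Rmult; eauto].
    unfold plus, Re, Im; simpl; ring.
Qed.

Lemma cder_scal (c : C) (f : R -> C) t l :
  cder f t l -> cder (fun t => c * f t)%C t (c * l)%C.
Proof.
  intros H; eapply cder_eq; [|apply cder_mult; [apply cder_const|exact H]].
  simpl; ring.
Qed.

Lemma cder_id_mult (c : C) t : cder (fun t => RtoC t * c)%C t c.
Proof.
  eapply cder_eq; [|apply cder_mult; [apply cder_id|apply cder_const]].
  simpl; ring.
Qed.

Lemma cder_Csum (f : nat -> R -> C) t (l : nat -> C) n :
  (forall k, cder (f k) t (l k)) ->
  cder (fun t => Csum (fun k => f k t) n) t (Csum l n).
Proof.
  intros H; induction n; simpl; [apply cder_const|now apply cder_plus].
Qed.

Lemma cder_pow (f : R -> C) t l n :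
  cder f t l ->
  cder (fun t => f t ^ S n)%C t (INR (S n) * f t ^ n * l)%C.
Proof.
  intros H; induction n.
  - apply cder_ext with f; [intros; simpl; ring|].
    eapply cder_eq; [|exact H]; simpl; ring.
  - apply cder_ext with (fun t => f t * f t ^ S n)%C; [intros; simpl; ring|].
    eapply cder_eq; [|apply cder_mult; eauto].
    rewrite (S_INR (S n)), RtoC_plus, !Cpow_S; ring.
Qed.

Lemma cder_Cexp (f : R -> C) t l :
  cder f t l -> cder (fun t => Cexp (f t)) t (l * Cexp (f t))%C.
Proof.
  intros [A B]; split; simpl.
  - eapply is_derive_eq; [|apply is_derive_Rmult].
    2: apply (is_derive_comp exp _ _ _ _ (is_derive_exp _) A).
    2: apply (is_derive_comp cos _ _ _ _ (is_derive_cos _) B).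
    unfold scal, Re, Im; simpl; unfold mult; simpl; ring.
  - eapply is_derive_eq; [|apply is_derive_Rmult].
    2: apply (is_derive_comp exp _ _ _ _ (is_derive_exp _) A).
    2: apply (is_derive_comp sin _ _ _ _ (is_derive_sin _) B).
    unfold scal, Re, Im; simpl; unfold mult; simpl; ring.
Qed.

Lemma cder_inv (f : R -> C) t l :
  cder f t l -> f t <> 0 ->
  cder (fun t => / f t)%C t (- l / (f t * f t))%C.
Proof.
  intros [A B] H0.
  assert (Re (f t) ^ 2 + Im (f t) ^ 2 <> 0) as Hn.
  { rewrite <- Cmod2_alt; intros E; apply H0, Cmod_eq_0; nra. }
  assert (Re (f t) * Re (f t) + Im (f t) * Im (f t) <> 0) as Hn'
    by (intros E; apply Hn; rewrite <- E; ring).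
  assert (is_derive (fun t => Re (f t) ^ 2 + Im (f t) ^ 2) t
            (2 * Re (f t) * Re l + 2 * Im (f t) * Im l)) as Hq.
  { eapply is_derive_eq; [|apply (is_derive_plus (V := R_NormedModule));
      [apply (is_derive_ext (fun t => Re (f t) * Re (f t)))
      |apply (is_derive_ext (fun t => Im (f t) * Im (f t)))]].
    2,4: intros; simpl; ring.
    2,3: apply is_derive_Rmult; eauto.
    unfold plus; simpl; ring. }
  split; simpl.
  - eapply is_derive_eq;
      [|apply (is_derive_div (fun t => Re (f t)) _ _ _ _ A Hq Hn)].
    unfold fst, snd, Re, Im in *; destruct (f t), l; simpl in *; field.
    repeat split; auto; nra.
  - eapply is_derive_eq;
      [|apply (is_derive_div (fun t => - Im (f t)) _ _ _ _
          (is_derive_opp _ _ _ B) Hq Hn)].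
    unfold fst, snd, Re, Im in *; destruct (f t), l; simpl in *.
    unfold opp; simpl; field.
    repeat split; auto; nra.
Qed.

(* Projecting on the direction of [f b - f a] reduces the claim to the
   monotonicity of a real function. *)
Lemma mean_value_ineq (f f' : R -> C) (g g' : R -> R) (a b : R) :
  a <= b ->
  (forall t, a <= t <= b -> cder f t (f' t)) ->
  (forall t, a <= t <= b -> is_derive g t (g' t)) ->
  (forall t, a <= t <= b -> Cmod (f' t) <= g' t) ->
  Cmod (f b - f a) <= g b - g a.
Proof.
  intros Hab Hf Hg Hb.
  set (d := (f b - f a)%C).
  (* When the increment vanishes there is no direction to project on, and only the monotonicity of
     [g] is left to prove. *)
  destruct (Rle_lt_dec (Cmod d) 0) as [Hd|Hd].
  { destruct (MVT_gen g a b g') as [c [Hc E]].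
    - intros x Hx; apply Hg; rewrite Rmin_left, Rmax_right in Hx; lra.
    - intros x Hx; rewrite Rmin_left, Rmax_right in Hx by lra.
      apply derivable_continuous_pt; exists (g' x).
      apply is_derive_Reals, Hg; lra.
    - rewrite Rmin_left, Rmax_right in Hc by lra.
      rewrite E; generalize (Hb c Hc) (Cmod_ge_0 (f' c)); nra. }
  set (h := fun t => Cmod d * g t
                     - (Re d * Re (f t) + Im d * Im (f t))).
  set (h' := fun t => Cmod d * g' t
                     - (Re d * Re (f' t) + Im d * Im (f' t))).
  assert (forall t, a <= t <= b -> is_derive h t (h' t)) as Hh.
  { intros t Ht; destruct (Hf t Ht) as [A B].
    apply (is_derive_minus (V := R_NormedModule)).
    - apply is_derive_scal; auto.
    - apply (is_derive_plus (V := R_NormedModule)); apply is_derive_scal;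
        auto. }
  destruct (MVT_gen h a b h') as [c [Hc E]].
  - intros x Hx; apply Hh; rewrite Rmin_left, Rmax_right in Hx; lra.
  - intros x Hx; rewrite Rmin_left, Rmax_right in Hx by lra.
    apply derivable_continuous_pt; exists (h' x).
    apply is_derive_Reals, Hh; lra.
  - rewrite Rmin_left, Rmax_right in Hc by lra.
    assert (0 <= h' c) as Hpos.
    { unfold h'.
      assert (Re d * Re (f' c) + Im d * Im (f' c) <= Cmod d * Cmod (f' c)).
      { replace (Re d * Re (f' c) + Im d * Im (f' c))
          with (Re (Cconj d * f' c)%C) by (unfold Re, Im; simpl; ring).
        apply Rle_trans with (1 := Re_le_Cmod _).
        rewrite Cmod_mult, Cmod_conj; lra. }
      generalize (Hb c Hc); nra. }
    assert (0 <= h b - h a) by (rewrite E; nra).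
    assert (Re d * Re (f b) + Im d * Im (f b)
            - (Re d * Re (f a) + Im d * Im (f a)) = Cmod d * Cmod d) as Ed.
    { rewrite Cmod_sqr; unfold d; rewrite Re_minus, Im_minus; ring. }
    unfold h in *; nra.
Qed.

(** * The complex exponential and the principal logarithm *)

Lemma Cexp_plus (z w : C) : Cexp (z + w) = (Cexp z * Cexp w)%C.
Proof.
  unfold Cexp; rewrite Re_plus, Im_plus, exp_plus, cos_plus, sin_plus.
  apply C_eq; unfold Re, Im; simpl; ring.
Qed.

Lemma Cexp_0 : Cexp 0 = 1.
Proof.
  unfold Cexp; apply C_eq; simpl; rewrite exp_0, ?cos_0, ?sin_0; ring.
Qed.

Lemma Cexp_RtoC (x : R) : Cexp x = exp x.
Proof. unfold Cexp; apply C_eq; simpl; rewrite ?cos_0, ?sin_0; ring. Qed.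

Lemma Cmod_Cexp (z : C) : Cmod (Cexp z) = exp (Re z).
Proof.
  apply Rsqr_inj; [apply Cmod_ge_0|left; apply exp_pos|].
  unfold Rsqr; rewrite Cmod_sqr; simpl.
  generalize (sin2_cos2 (Im z)); unfold Rsqr; nra.
Qed.

Lemma Cexp_neq_0 (z : C) : Cexp z <> 0.
Proof. apply Cmod_gt_0; rewrite Cmod_Cexp; apply exp_pos. Qed.

Lemma Cexp_opp (z : C) : Cexp (- z) = (/ Cexp z)%C.
Proof.
  assert (H : (Cexp (- z) * Cexp z)%C = 1).
  { rewrite <- Cexp_plus, <- Cexp_0; f_equal; ring. }
  replace (/ Cexp z)%C with (Cexp (- z) * Cexp z * / Cexp z)%C
    by (rewrite H; ring).
  field; apply Cexp_neq_0.
Qed.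

Lemma Cexp_minus (z w : C) : Cexp (z - w) = (Cexp z / Cexp w)%C.
Proof. unfold Cminus; rewrite Cexp_plus, Cexp_opp; reflexivity. Qed.

Lemma Cexp_INR_mult (n : nat) (z : C) : Cexp (INR n * z) = (Cexp z ^ n)%C.
Proof.
  induction n.
  - simpl; rewrite Cmult_0_l; apply Cexp_0.
  - rewrite S_INR, RtoC_plus, Cpow_S, <- IHn, <- Cexp_plus; f_equal; ring.
Qed.

Lemma Cexp_cv (u : nat -> C) (l : C) :
  Ccv u l -> Ccv (fun n => Cexp (u n)) (Cexp l).
Proof.
  intros H.
  assert (HR := Ccv_Re _ _ H); assert (HI := Ccv_Im _ _ H).
  apply Ccv_Re_Im; simpl; apply is_lim_seq_mult';
    [apply (is_lim_seq_continuous exp)|apply (is_lim_seq_continuous cos)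
    |apply (is_lim_seq_continuous exp)|apply (is_lim_seq_continuous sin)];
    auto; apply derivable_continuous_pt; first [apply derivable_pt_exp
      |apply derivable_pt_cos|apply derivable_pt_sin].
Qed.

Lemma cos_eq_1 (y : R) : Rabs y < 2 * PI -> cos y = 1 -> y = 0.
Proof.
  assert (forall y, 0 < y < 2 * PI -> cos y <> 1) as H.
  { intros x Hx Hc.
    assert (0 < sin (x / 2)) by (apply sin_gt_0; lra).
    replace x with (2 * (x / 2)) in Hc by field.
    rewrite cos_2a_sin in Hc; nra. }
  intros Hy Hc; apply Rabs_def2 in Hy.
  destruct (Rtotal_order y 0) as [H1|[H1|H1]]; auto.
  - exfalso; apply (H (- y)); [lra|now rewrite cos_neg].
  - exfalso; apply (H y); [lra|auto].
Qed.

(** If [Cexp (z - w) = 1], the modulus forces the real part of [z - w] to be 0, and then its cosine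
    is 1 within less than one period. *)
Lemma Cexp_inj (z w : C) :
  Rabs (Im z - Im w) < 2 * PI -> Cexp z = Cexp w -> z = w.
Proof.
  intros H E.
  assert (E1 : Cexp (z - w) = 1).
  { rewrite Cexp_minus, E; field; apply Cexp_neq_0. }
  assert (E2 : Re (z - w) = 0).
  { apply exp_inv; rewrite <- Cmod_Cexp, E1, Cmod_1, exp_0; auto. }
  assert (E3 : Im (z - w) = 0).
  { apply cos_eq_1; auto.
    apply (f_equal Re) in E1; simpl in E1; unfold Re, Im in *; simpl in *.
    rewrite E2, exp_0 in E1; lra. }
  apply Ceq_minus, C_eq; auto.
Qed.

(** The argument is taken as [atan (y / x)], which is correct on the right half-plane; there this is
    the principal logarithm. *)
Definition clog (z : C) : C :=
  (ln (Re z * Re z + Im z * Im z) / 2, atan (Im z / Re z)).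

Lemma Re_clog (z : C) : z <> 0 -> Re (clog z) = ln (Cmod z).
Proof.
  intros Hz; apply Cmod_gt_0 in Hz; simpl.
  rewrite <- Cmod_sqr, ln_mult by auto; field.
Qed.

Lemma Im_clog_bound (z : C) : - PI / 2 < Im (clog z) < PI / 2.
Proof. apply atan_bound. Qed.

Lemma Cexp_clog (z : C) : 0 < Re z -> Cexp (clog z) = z.
Proof.
  intros Hz.
  assert (Hz0 := Cneq_0_Re z Hz).
  assert (Hm := Hz0); apply Cmod_gt_0 in Hm.
  unfold Cexp; rewrite (Re_clog z Hz0), exp_ln by auto.
  unfold clog; simpl Im; rewrite cos_atan, sin_atan.
  assert (E : sqrt (1 + Rsqr (Im z / Re z)) = Cmod z / Re z).
  { apply Rsqr_inj; [apply sqrt_pos| |].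
    - apply Rlt_le, Rdiv_lt_0_compat; auto.
    - rewrite Rsqr_sqrt by (generalize (Rle_0_sqr (Im z / Re z)); lra).
      unfold Rsqr, Rdiv.
      replace (Cmod z * / Re z * (Cmod z * / Re z))
        with (Cmod z * Cmod z * / Re z * / Re z) by ring.
      rewrite Cmod_sqr; field; lra. }
  rewrite E; apply C_eq; simpl; field; lra.
Qed.

Lemma clog_RtoC (x : R) : 0 < x -> clog x = ln x.
Proof.
  intros Hx; unfold clog; apply C_eq; simpl.
  - rewrite Rmult_0_l, Rplus_0_r, ln_mult by auto; field.
  - unfold Rdiv; rewrite Rmult_0_l; apply atan_0.
Qed.

Lemma clog_1 : clog 1 = 0.
Proof. rewrite clog_RtoC, ln_1 by lra; auto. Qed.

(** Both sides are logarithms of [z * w], and their imaginary parts differ by less than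
    [3 * PI / 2], hence by less than a period. *)
Lemma clog_mult (z w : C) :
  0 < Re z -> 0 < Re w -> 0 < Re (z * w) ->
  clog (z * w) = (clog z + clog w)%C.
Proof.
  intros Hz Hw Hzw.
  apply Cexp_inj.
  - generalize (Im_clog_bound z) (Im_clog_bound w) (Im_clog_bound (z * w)).
    generalize PI_RGT_0; rewrite Im_plus; intros; apply Rabs_def1; lra.
  - rewrite Cexp_plus, !Cexp_clog; auto.
Qed.

Lemma cder_clog (f : R -> C) t l :
  cder f t l -> 0 < Re (f t) -> cder (fun t => clog (f t)) t (l / f t)%C.
Proof.
  intros [A B] H.
  assert (Re (f t) * Re (f t) + Im (f t) * Im (f t) > 0) by nra.
  split; simpl.
  - eapply is_derive_eq.
    2: { apply (is_derive_ext (fun t => / 2 *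
            ln (Re (f t) * Re (f t) + Im (f t) * Im (f t)))).
         { intros; simpl; field. }
         apply is_derive_scal, (is_derive_comp ln).
         - apply is_derive_ln; auto.
         - apply (is_derive_plus (V := R_NormedModule));
             apply is_derive_Rmult; eauto. }
    unfold scal, plus; simpl; unfold mult; simpl.
    unfold Re, Im in *; destruct (f t), l; simpl in *; field; nra.
  - eapply is_derive_eq.
    2: { apply (is_derive_comp atan).
         - apply is_derive_atan.
         - apply is_derive_div; eauto; lra. }
    unfold scal, plus; simpl; unfold mult; simpl.
    unfold Re, Im, Rsqr in *; destruct (f t), l; simpl in *; field.
    repeat split; nra.
Qed.

(** * Taylor expansions at the origin *)

(** A Taylor expansion with explicit remainder on one fixed disc. Truncated expansions are closed
    under the operations below without any question of convergence, and real coefficients suffice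
    for the functions at hand. *)
Definition expands (f : C -> C) (c : nat -> R) (J : nat) : Prop :=
  exists K, 0 <= K /\ forall u, Cmod u <= / 2 ->
    Cmod (f u - Csum (fun j => c j * u ^ j)%C J) <= K * Cmod u ^ J.

Lemma expands_ext (f g : C -> C) (c d : nat -> R) J :
  (forall u, Cmod u <= / 2 -> f u = g u) ->
  (forall j, (j < J)%nat -> c j = d j) ->
  expands f c J -> expands g d J.
Proof.
  intros Hf Hc [K [HK H]]; exists K; split; auto; intros u Hu.
  rewrite <- Hf, (Csum_ext _ (fun j => c j * u ^ j)%C); auto.
  intros j Hj; rewrite Hc; auto.
Qed.

Lemma expands_plus (f g : C -> C) (c d : nat -> R) J :
  expands f c J -> expands g d J ->
  expands (fun u => f u + g u)%C (fun j => c j + d j) J.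
Proof.
  intros [K [HK H]] [L [HL H']]; exists (K + L); split; [lra|].
  intros u Hu.
  rewrite (Csum_ext _ (fun j => c j * u ^ j + d j * u ^ j)%C)
    by (intros; rewrite RtoC_plus; ring).
  rewrite Csum_plus.
  replace (f u + g u - (_ + _))%C
    with ((f u - Csum (fun j => c j * u ^ j)%C J)
          + (g u - Csum (fun j => d j * u ^ j)%C J))%C by ring.
  apply Rle_trans with (1 := Cmod_triangle _ _).
  generalize (H u Hu) (H' u Hu); lra.
Qed.

Lemma expands_scal (a : R) (f : C -> C) (c : nat -> R) J :
  expands f c J -> expands (fun u => a * f u)%C (fun j => a * c j) J.
Proof.
  intros [K [HK H]]; exists (Rabs a * K); split.
  { apply Rmult_le_pos; auto using Rabs_pos. }
  intros u Hu.
  rewrite (Csum_ext _ (fun j => a * (c j * u ^ j))%C)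
    by (intros; rewrite RtoC_mult; ring).
  rewrite Csum_scal.
  replace (a * f u - a * Csum (fun k => c k * u ^ k) J)%C
    with (a * (f u - Csum (fun k => c k * u ^ k) J))%C by ring.
  rewrite Cmod_mult, Cmod_R, Rmult_assoc.
  apply Rmult_le_compat_l; auto using Rabs_pos.
Qed.

Lemma expands_opp_arg (f : C -> C) (c : nat -> R) J :
  expands f c J -> expands (fun u => f (- u)%C) (fun j => (-1) ^ j * c j) J.
Proof.
  intros [K [HK H]]; exists K; split; auto.
  intros u Hu.
  rewrite <- (Cmod_opp u) in Hu |- *.
  rewrite (Csum_ext _ (fun j => c j * (- u) ^ j)%C); auto.
  intros j _; rewrite RtoC_mult, RtoC_pow.
  replace (- u)%C with (RtoC (-1) * u)%C.
  - rewrite Cpow_mult_l; ring.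
  - apply C_eq; unfold Re, Im; simpl; ring.
Qed.

Definition coef_shift (c : nat -> R) (j : nat) : R :=
  match j with O => 0 | S i => c i end.

Lemma expands_mult_arg (f : C -> C) (c : nat -> R) J :
  expands f c J -> expands (fun u => u * f u)%C (coef_shift c) (S J).
Proof.
  intros [K [HK H]]; exists K; split; auto.
  intros u Hu.
  rewrite Csum_S_l; simpl coef_shift.
  rewrite (Csum_ext _ (fun j => u * (c j * u ^ j))%C)
    by (intros; rewrite Cpow_S; ring).
  rewrite Csum_scal.
  replace (u * f u - _)%C
    with (u * (f u - Csum (fun k => c k * u ^ k) J))%C by ring.
  rewrite Cmod_mult; simpl pow.
  generalize (H u Hu) (Cmod_ge_0 u); nra.
Qed.

Lemma expands_pow_arg (f : C -> C) (c : nat -> R) J m :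
  expands f c J ->
  expands (fun u => u ^ m * f u)%C
    (fun j => if (j <? m)%nat then 0 else c (j - m)%nat) (m + J).
Proof.
  intros H; induction m.
  - eapply expands_ext; [| |exact H].
    + intros; simpl; ring.
    + intros; simpl; f_equal; lia.
  - eapply expands_ext; [| |exact (expands_mult_arg _ _ _ IHm)].
    + intros; rewrite Cpow_S; ring.
    + intros [|j] Hj; auto.
Qed.

Lemma expands_lower (f : C -> C) (c : nat -> R) J :
  expands f c (S J) -> expands f c J.
Proof.
  intros [K [HK H]]; exists (K + Rabs (c J)).
  split; [generalize (Rabs_pos (c J)); lra|].
  intros u Hu; specialize (H u Hu); simpl in H.
  replace (f u - Csum (fun j => c j * u ^ j) J)%C
    with ((f u - (Csum (fun j => c j * u ^ j) J + c J * u ^ J))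
          + c J * u ^ J)%C by ring.
  apply Rle_trans with (1 := Cmod_triangle _ _).
  rewrite Cmod_mult, Cmod_R, Cmod_pow.
  assert (0 <= Cmod u ^ J) by (apply pow_le, Cmod_ge_0).
  generalize (Cmod_ge_0 u); intros.
  assert (K * (Cmod u * Cmod u ^ J) <= K * Cmod u ^ J).
  { apply Rmult_le_compat_l; auto; nra. }
  lra.
Qed.

Lemma expands_lower_le (f : C -> C) (c : nat -> R) J J' :
  (J <= J')%nat -> expands f c J' -> expands f c J.
Proof. induction 1; auto using expands_lower. Qed.

Lemma expands_const (a : R) J :
  expands (fun _ => a) (fun j => if (j =? 0)%nat then a else 0) J.
Proof.
  apply (expands_lower_le _ _ J (S J)); auto.
  exists 0; split; [lra|]; intros u Hu.
  rewrite Csum_S_l; simpl.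
  rewrite Csum_0 by (intros; ring).
  replace (a - _)%C with (RtoC 0) by ring.
  rewrite Cmod_0; lra.
Qed.

Lemma expands_Csum (f : nat -> C -> C) (c : nat -> nat -> R) J n :
  (forall k, (k < n)%nat -> expands (f k) (c k) J) ->
  expands (fun u => Csum (fun k => f k u) n)
          (fun j => Rsum (fun k => c k j) n) J.
Proof.
  induction n; intros H; simpl.
  - eapply expands_ext; [| |apply (expands_const 0)]; simpl; auto.
    intros [|j] _; auto.
  - apply expands_plus; auto.
Qed.

Lemma Re_1_plus (u : C) : Cmod u <= / 2 -> / 2 <= Re (1 + u).
Proof.
  intros Hu; rewrite Re_plus; simpl.
  generalize (re_le_Cmod u); intros H; apply Rabs_le_between in H; lra.
Qed.

Lemma Cmod_inv_1_plus (u : C) : Cmod u <= / 2 -> Cmod (/ (1 + u)) <= 2.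
Proof.
  intros Hu; assert (H := Re_1_plus u Hu).
  rewrite Cmod_inv by (apply Cneq_0_Re; lra).
  replace 2 with (/ / 2) by field.
  apply Rinv_le_contravar; [lra|].
  apply Rle_trans with (1 := H), Re_le_Cmod.
Qed.

Lemma Cmod_Rmult_le (t : R) (u : C) :
  0 <= t <= 1 -> Cmod (t * u) <= Cmod u.
Proof.
  intros Ht; rewrite Cmod_mult, Cmod_R, Rabs_pos_eq by lra.
  generalize (Cmod_ge_0 u); nra.
Qed.

Lemma Csum_geom (x : C) n :
  ((1 - x) * Csum (fun k => x ^ k) n = 1 - x ^ n)%C.
Proof.
  induction n; simpl; [ring|].
  rewrite Cmult_plus_distr_l, IHn; ring.
Qed.

Lemma is_derive_scal_id (K t : R) : is_derive (fun t => K * t) t K.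
Proof.
  eapply is_derive_eq; [|apply is_derive_scal, @is_derive_id].
  apply Rmult_1_r.
Qed.

(* [log_coef 0 = 0] because [/ 0 = 0]. *)
Definition log_coef (j : nat) : R := - (-1) ^ j * / INR j.

Lemma log_coef_0 : log_coef 0 = 0.
Proof. unfold log_coef; simpl; rewrite Rinv_0; ring. Qed.

(** On the segment [t * u] the derivatives of the Taylor terms form a geometric sum, so the
    derivative of the remainder is exactly [u * (- (t * u)) ^ J / (1 + t * u)]. The constant 2
    bounds [/ (1 + t * u)] on the disc. *)
Lemma expands_clog (J : nat) :
  expands (fun u => clog (1 + u)) log_coef (S J).
Proof.
  exists 2; split; [lra|]; intros u Hu.
  set (f := fun t : R =>
    (clog (1 + t * u) - Csum (fun j => log_coef j * (t * u) ^ j) (S J))%C).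
  replace (clog (1 + u) - _)%C with (f 1 - f 0)%C.
  2: { unfold f; rewrite !Cmult_0_l, !Cmult_1_l.
       rewrite (Csum_power_series_0 (fun j => RtoC (log_coef j))).
       rewrite Cplus_0_r, clog_1, log_coef_0; ring. }
  set (B := 2 * Cmod u ^ S J).
  replace B with (B * 1 - B * 0) by ring.
  apply mean_value_ineq with (g := fun t => B * t)
    (f' := fun t : R => (u * ((- (t * u)) ^ J / (1 + t * u)))%C)
    (g' := fun _ => B); [lra| | |].
  - intros t Ht.
    assert (Htu : Cmod (t * u) <= / 2)
      by (apply Rle_trans with (2 := Hu), Cmod_Rmult_le; auto).
    assert (H1 := Re_1_plus _ Htu).
    assert (H2 : (1 + t * u)%C <> 0) by (apply Cneq_0_Re; lra).
    assert (Hd := cder_id_mult u t).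
    unfold f.
    apply cder_ext with (fun t : R => clog (1 + t * u)
      - (log_coef 0%nat
         + Csum (fun j => log_coef (S j) * (t * u) ^ (S j)) J))%C.
    { intros; rewrite Csum_S_l; simpl; do 3 f_equal; ring. }
    eapply cder_eq; [|apply cder_minus].
    2: { apply cder_clog; [|lra].
         apply cder_plus; [apply cder_const|exact Hd]. }
    2: { apply cder_plus; [apply cder_const|].
         apply (cder_Csum (fun j t => log_coef (S j) * (t * u) ^ (S j))%C).
         intros k; apply cder_scal, cder_pow, Hd. }
    rewrite (Csum_ext _ (fun j => u * (- (t * u)) ^ j)%C).
    2: { intros k _; unfold log_coef.
         replace (- (t * u))%C with (RtoC (-1) * (t * u))%C
           by (apply C_eq; unfold Re, Im; simpl; ring).
         rewrite (Cpow_mult_l (-1) (t * u)).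
         replace (- (-1) ^ S k * / INR (S k)) with ((-1) ^ k / INR (S k))
           by (simpl; field; apply (not_0_INR (S k)); lia).
         rewrite RtoC_div, RtoC_pow by (apply (not_0_INR (S k)); lia).
         field; apply RtoC_neq_0, (not_0_INR (S k)); lia. }
    rewrite Csum_scal.
    assert (G := Csum_geom (- (t * u)) J).
    replace (1 - - (t * u))%C with (1 + t * u)%C in G by ring.
    replace ((- (t * u)) ^ J)%C
      with (1 - (1 + t * u) * Csum (fun k => (- (t * u)) ^ k) J)%C
      by (rewrite G; ring).
    change (Csum (Cpow (- (t * u))) J)
      with (Csum (fun k => (- (t * u)) ^ k)%C J).
    field; auto.
  - intros; apply is_derive_scal_id.
  - intros t Ht.
    assert (Htu : Cmod (t * u) <= / 2)
      by (apply Rle_trans with (2 := Hu), Cmod_Rmult_le; auto).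
    unfold Cdiv; rewrite !Cmod_mult, Cmod_pow, Cmod_opp.
    assert (H1 := Cmod_inv_1_plus _ Htu).
    assert (H2 : Cmod (t * u) ^ J <= Cmod u ^ J).
    { apply pow_incr; split; [apply Cmod_ge_0|].
      apply Cmod_Rmult_le; auto. }
    assert (H3 : 0 <= Cmod (t * u) ^ J) by (apply pow_le, Cmod_ge_0).
    unfold B; simpl pow.
    replace (2 * (Cmod u * Cmod u ^ J))
      with (Cmod u * (Cmod u ^ J * 2)) by ring.
    apply Rmult_le_compat_l; [apply Cmod_ge_0|].
    apply Rmult_le_compat; auto; apply Cmod_ge_0.
Qed.

(** The Taylor coefficient [(-1) ^ j * binom(p + j, j)] of [(1 + u) ^ (- (p + 1))]. *)
Definition inv_pow_coef (p j : nat) : R :=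
  (-1) ^ j * INR (fact (p + j)) / (INR (fact p) * INR (fact j)).

Lemma inv_pow_coef_0 p : inv_pow_coef p 0 = 1.
Proof.
  unfold inv_pow_coef; rewrite Nat.add_0_r; simpl; field.
  apply INR_fact_neq_0.
Qed.

(** The coefficient form of the rule that the derivative of [(1 + u) ^ (- (p + 1))] is [- (p + 1)]
    times the next inverse power. *)
Lemma inv_pow_coef_S p j :
  INR (S j) * inv_pow_coef p (S j) = - INR (S p) * inv_pow_coef (S p) j.
Proof.
  unfold inv_pow_coef.
  replace (p + S j)%nat with (S p + j)%nat by lia.
  rewrite !fact_simpl, !mult_INR; simpl pow.
  generalize (INR_fact_neq_0 p) (INR_fact_neq_0 j)
    (not_0_INR (S p) (Nat.neq_succ_0 _)) (not_0_INR (S j) (Nat.neq_succ_0 _)).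
  intros; field; auto.
Qed.

(** Induction on [J] for all [p] at once: differentiating the remainder along a segment raises the
    exponent [p] and lowers the order [J] by one. *)
Lemma expands_inv_pow (p J : nat) :
  expands (fun u => (/ (1 + u)) ^ S p)%C (inv_pow_coef p) J.
Proof.
  revert p; induction J; intros p.
  - exists (2 ^ S p); split; [apply pow_le; lra|]; intros u Hu.
    simpl Csum; replace (_ - 0)%C with ((/ (1 + u)) ^ S p)%C by ring.
    rewrite Cmod_pow; simpl (_ ^ 0); rewrite Rmult_1_r.
    apply pow_incr; split; [apply Cmod_ge_0|now apply Cmod_inv_1_plus].
  - destruct (IHJ (S p)) as [K [HK H]].
    exists (INR (S p) * K); split.
    { apply Rmult_le_pos; auto using pos_INR. }
    intros u Hu.
    set (f := fun t : R => ((/ (1 + t * u)) ^ S p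
      - Csum (fun j => inv_pow_coef p j * (t * u) ^ j) (S J))%C).
    replace (_ - _)%C with (f 1 - f 0)%C.
    2: { unfold f; rewrite !Cmult_0_l, !Cmult_1_l.
         rewrite (Csum_power_series_0 (fun j => RtoC (inv_pow_coef p j))).
         rewrite inv_pow_coef_0.
         replace (/ (1 + 0))%C with (RtoC 1) by (field; apply C1_nz).
         rewrite Cpow_1_l; ring. }
    set (B := INR (S p) * K * Cmod u ^ S J).
    replace B with (B * 1 - B * 0) by ring.
    apply mean_value_ineq with (g := fun t => B * t)
      (f' := fun t : R => (- INR (S p) * u * ((/ (1 + t * u)) ^ S (S p) -
         Csum (fun j => inv_pow_coef (S p) j * (t * u) ^ j) J))%C)
      (g' := fun _ => B); [lra| | |].
    + intros t Ht.
      assert (Htu : Cmod (t * u) <= / 2)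
        by (apply Rle_trans with (2 := Hu), Cmod_Rmult_le; auto).
      assert (H1 := Re_1_plus _ Htu).
      assert (H2 : (1 + t * u)%C <> 0) by (apply Cneq_0_Re; lra).
      assert (Hd := cder_id_mult u t).
      unfold f.
      apply cder_ext with (fun t : R => (/ (1 + t * u)) ^ S p
        - (inv_pow_coef p 0%nat
           + Csum (fun j => inv_pow_coef p (S j) * (t * u) ^ (S j)) J))%C.
      { intros; rewrite (Csum_S_l _ J); simpl; do 3 f_equal; ring. }
      eapply cder_eq; [|apply cder_minus].
      2: { apply cder_pow, cder_inv; [|exact H2].
           apply cder_plus; [apply cder_const|exact Hd]. }
      2: { apply cder_plus; [apply cder_const|].
           apply (cder_Csum (fun j t =>
             inv_pow_coef p (S j) * (t * u) ^ (S j))%C).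
           intros k; apply cder_scal, cder_pow, Hd. }
      rewrite (Csum_ext _ (fun j => (- INR (S p) * u)
                 * (inv_pow_coef (S p) j * (t * u) ^ j))%C).
      2: { intros k _.
           transitivity (RtoC (INR (S k) * inv_pow_coef p (S k))
                         * (t * u) ^ k * u)%C.
           - rewrite RtoC_mult; ring.
           - rewrite inv_pow_coef_S, RtoC_mult, RtoC_opp; ring. }
      rewrite Csum_scal, !Cpow_S; field; auto.
    + intros; apply is_derive_scal_id.
    + intros t Ht.
      assert (Htu : Cmod (t * u) <= / 2)
        by (apply Rle_trans with (2 := Hu), Cmod_Rmult_le; auto).
      rewrite !Cmod_mult, Cmod_opp, Cmod_INR.
      specialize (H _ Htu).
      assert (H2 : Cmod (t * u) ^ J <= Cmod u ^ J).
      { apply pow_incr; split; [apply Cmod_ge_0|].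
        apply Cmod_Rmult_le; auto. }
      unfold B; simpl pow.
      replace (INR (S p) * K * (Cmod u * Cmod u ^ J))
        with (INR (S p) * Cmod u * (K * Cmod u ^ J)) by ring.
      apply Rmult_le_compat_l.
      * apply Rmult_le_pos; auto using pos_INR, Cmod_ge_0.
      * nra.
Qed.

(** * Generating functions and identities for Bernoulli numbers *)

(** The product of formal power series. Identities between generating functions are proved as
    identities for [conv], with [dirac0] as the unit. *)
Definition conv (a b : nat -> R) (n : nat) : R :=
  Rsum (fun i => a i * b (n - i)%nat) (S n).

Lemma Rsum_rev (f : nat -> R) n :
  Rsum f (S n) = Rsum (fun i => f (n - i)%nat) (S n).
Proof.
  induction n; [simpl; ring|].
  rewrite (Rsum_S_l (fun i => f (S n - i)%nat)).
  simpl (S n - 0)%nat.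
  rewrite (Rsum_ext (fun k => f (S n - S k)%nat) (fun i => f (n - i)%nat))
    by (intros; f_equal; lia).
  rewrite <- IHn; simpl; ring.
Qed.

Lemma conv_comm (a b : nat -> R) n : conv a b n = conv b a n.
Proof.
  unfold conv; rewrite Rsum_rev; apply Rsum_ext; intros k Hk.
  replace (n - (n - k))%nat with k by lia; ring.
Qed.

Lemma Rsum_triangle (F : nat -> nat -> R) n :
  Rsum (fun i => Rsum (fun j => F i j) (S i)) (S n) =
  Rsum (fun j => Rsum (fun k => F (j + k)%nat j) (S (n - j))) (S n).
Proof.
  induction n; [simpl; ring|].
  change (Rsum (fun i => Rsum (fun j => F i j) (S i)) (S (S n)))
    with (Rsum (fun i => Rsum (fun j => F i j) (S i)) (S n)
          + Rsum (fun j => F (S n) j) (S (S n))).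
  rewrite IHn.
  rewrite (Rsum_ext _ (fun j => Rsum (fun k => F (j + k)%nat j) (S (S n - j))
                                - F (S n) j)).
  2: { intros k Hk.
       replace (S (S n - k)) with (S (S (n - k))) by lia.
       simpl; replace (k + S (n - k))%nat with (S n) by lia; ring. }
  simpl; rewrite Nat.sub_diag; simpl; rewrite Nat.add_0_r.
  set (G := fun j => F (S n) j).
  rewrite (Rsum_ext (fun j => _ - F (S n) j)
     (fun j => Rsum (fun k : nat => F (j + k)%nat j)
        match j with O => S n | S l => n - l end
        + F (j + match j with O => S n | S l => n - l end)%nat j
        + (- 1) * G j)) by (intros; unfold G; ring).
  rewrite Rsum_plus, Rsum_scal; unfold G; ring.
Qed.

Lemma Rsum_scal_r (c : R) (f : nat -> R) n :
  Rsum f n * c = Rsum (fun k => f k * c) n.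
Proof. induction n; simpl; [ring|rewrite <- IHn; ring]. Qed.

Lemma conv_assoc (a b c : nat -> R) n :
  conv (conv a b) c n = conv a (conv b c) n.
Proof.
  unfold conv.
  rewrite (Rsum_ext _ (fun i =>
    Rsum (fun j => a j * b (i - j)%nat * c (n - i)%nat) (S i)))
    by (intros; apply Rsum_scal_r).
  rewrite (Rsum_triangle (fun i j => a j * b (i - j)%nat * c (n - i)%nat)).
  apply Rsum_ext; intros j Hj.
  rewrite <- Rsum_scal; apply Rsum_ext; intros k Hk.
  replace (j + k - j)%nat with k by lia.
  replace (n - (j + k))%nat with (n - j - k)%nat by lia; ring.
Qed.

Lemma conv_ext (a a' b b' : nat -> R) n :
  (forall k, a k = a' k) -> (forall k, b k = b' k) ->
  conv a b n = conv a' b' n.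
Proof. intros Ha Hb; apply Rsum_ext; intros; rewrite Ha, Hb; auto. Qed.

Definition dirac0 (n : nat) : R := if (n =? 0)%nat then 1 else 0.

Lemma conv_dirac0_r (a : nat -> R) n : conv a dirac0 n = a n.
Proof.
  unfold conv; simpl; rewrite Nat.sub_diag.
  rewrite Rsum_0.
  - unfold dirac0; simpl; ring.
  - intros k Hk; unfold dirac0.
    destruct (Nat.eqb_spec (n - k) 0); [lia|ring].
Qed.

Lemma conv_dirac0_l (a : nat -> R) n : conv dirac0 a n = a n.
Proof. rewrite conv_comm; apply conv_dirac0_r. Qed.

Definition bern (n : nat) : R := bernoulli n / INR (fact n).

Lemma bernoulli_table_eq n j :
  (j <= n)%nat -> bernoulli_table n j = bernoulli j.
Proof.
  induction 1; [reflexivity|].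
  simpl; destruct (Nat.leb_spec j m); [auto|lia].
Qed.

Lemma bernoulli_S m :
  bernoulli (S m) =
  - / INR (S (S m)) *
    sum_f_R0 (fun i => Binomial.C (S (S m)) i * bernoulli i) m.
Proof.
  unfold bernoulli at 1; simpl bernoulli_table.
  destruct m as [|m]; [reflexivity|].
  destruct (Nat.leb_spec (S m) m); [lia|].
  f_equal; apply sum_eq; intros i Hi.
  rewrite <- (bernoulli_table_eq (S m) i) by auto; reflexivity.
Qed.

Lemma sum_f_R0_Rsum f n : sum_f_R0 f n = Rsum f (S n).
Proof. induction n; simpl; [ring|rewrite IHn; simpl; ring]. Qed.

(* The generating functions are [t / (exp t - 1)] and [(exp t - 1) / t]. *)
Lemma conv_bern n :
  conv bern (fun k => / INR (fact (S k))) n = dirac0 n.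
Proof.
  destruct n as [|m].
  - unfold conv, bern, bernoulli, dirac0; simpl; field.
  - unfold conv, dirac0; simpl Nat.eqb; cbv iota.
    rewrite (Rsum_ext _ (fun i => / INR (fact (S (S m))) *
                (Binomial.C (S (S m)) i * bernoulli i))).
    + rewrite Rsum_scal.
      change (Rsum ?f (S (S m))) with (Rsum f (S m) + f (S m)); cbv beta.
      rewrite (bernoulli_S m), <- sum_f_R0_Rsum.
      unfold Binomial.C at 2.
      replace (S (S m) - S m)%nat with 1%nat by lia.
      rewrite (fact_simpl (S m)), mult_INR.
      change (INR (fact 1)) with 1.
      generalize (INR_fact_neq_0 (S m))
        (not_0_INR (S (S m)) (Nat.neq_succ_0 _)).
      intros; field; auto.
    + intros k Hk; unfold bern, Binomial.C.
      replace (S (S m - k)) with (S (S m) - k)%nat by lia.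
      field; repeat split; apply INR_fact_neq_0.
Qed.

Lemma conv_alternate (a b : nat -> R) n :
  conv (fun k => (-1) ^ k * a k) (fun k => (-1) ^ k * b k) n
  = (-1) ^ n * conv a b n.
Proof.
  unfold conv; rewrite <- Rsum_scal; apply Rsum_ext; intros k Hk.
  replace ((-1) ^ n) with ((-1) ^ k * (-1) ^ (n - k)).
  - ring.
  - rewrite <- pow_add; f_equal; lia.
Qed.

(* In terms of generating functions,
   [(exp t - 1) / t = exp t * (1 - exp (-t)) / t]. *)
Lemma conv_exp_alternate n :
  conv (fun k => (-1) ^ k * / INR (fact (S k))) (fun k => / INR (fact k)) n
  = / INR (fact (S n)).
Proof.
  assert (H : sum_f_R0 (fun i => Binomial.C (S n) i * (-1) ^ i * 1 ^ (S n - i))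
                (S n) = 0).
  { rewrite <- binomial; replace (-1 + 1) with 0 by ring; simpl; ring. }
  rewrite sum_f_R0_Rsum, Rsum_S_l in H.
  unfold conv.
  rewrite (Rsum_ext _ (fun k => - / INR (fact (S n)) *
    (Binomial.C (S n) (S k) * (-1) ^ S k * 1 ^ (S n - S k)))).
  - rewrite Rsum_scal.
    replace (Rsum _ (S n)) with (-1).
    + ring.
    + unfold Binomial.C in H at 1.
      rewrite Nat.sub_0_r in H.
      change (INR (fact 0)) with 1 in H.
      rewrite pow1 in H.
      replace (INR (fact (S n)) / (1 * INR (fact (S n))) * (-1) ^ 0 * 1)
        with 1 in H by (simpl pow; field; apply INR_fact_neq_0).
      lra.
  - intros k Hk; unfold Binomial.C; rewrite pow1.
    replace (S n - S k)%nat with (n - k)%nat by lia.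
    simpl pow; field; repeat split; apply INR_fact_neq_0.
Qed.

(** This is [b(-t) = exp t * b(t)] for [b(t) = t / (exp t - 1)]. Instead of dividing series, the
    proof inserts the unit [conv bern e] on the left-hand side and reassociates until the unit
    [conv b' e'] appears. *)
Lemma bern_alternate n :
  (-1) ^ n * bern n = conv bern (fun k => / INR (fact k)) n.
Proof.
  set (e := fun k => / INR (fact (S k))).
  set (e' := fun k => (-1) ^ k * e k).
  set (b' := fun k => (-1) ^ k * bern k).
  set (X := fun k => / INR (fact k)).
  change (b' n = conv bern X n).
  rewrite <- (conv_dirac0_r b').
  rewrite (conv_ext b' b' dirac0 (conv bern e))
    by (auto; intros; symmetry; apply conv_bern).
  rewrite <- conv_assoc.
  rewrite (conv_ext (conv b' bern) (conv bern b') e (conv e' X)).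
  2: intros; apply conv_comm.
  2: intros; symmetry; apply conv_exp_alternate.
  rewrite conv_assoc; apply conv_ext; auto; intros k.
  rewrite <- conv_assoc.
  rewrite (conv_ext _ dirac0 X X); auto.
  - apply conv_dirac0_l.
  - intros i; unfold b', e'; rewrite conv_alternate.
    unfold e; rewrite conv_bern.
    destruct i; unfold dirac0; simpl; ring.
Qed.

(** The last term of the convolution in [bern_alternate] is [bern n] itself, and the other terms
    form the recurrence [conv_bern] at [n - 1], which vanishes. So [(-1) ^ n * bern n = bern n]. *)
Lemma bern_odd n : (3 <= n)%nat -> Nat.odd n = true -> bern n = 0.
Proof.
  intros Hn Ho.
  assert (H := bern_alternate n).
  destruct n as [|m]; [lia|].
  assert (E : conv bern (fun k => / INR (fact k)) (S m)
              = bern (S m) + conv bern (fun k => / INR (fact (S k))) m).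
  { unfold conv.
    change (Rsum ?f (S (S m))) with (Rsum f (S m) + f (S m)); cbv beta.
    rewrite Nat.sub_diag; change (INR (fact 0)) with 1.
    rewrite (Rsum_ext _ (fun i => bern i * / INR (fact (S (m - i))))).
    - field.
    - intros k Hk; do 4 f_equal; lia. }
  rewrite E, conv_bern in H.
  unfold dirac0 in H; destruct m; [lia|]; simpl Nat.eqb in H; cbv iota in H.
  assert ((-1) ^ S (S m) = -1).
  { apply Nat.odd_spec in Ho; destruct Ho as [q ->].
    rewrite pow_add, pow_mult; replace ((-1) ^ 2) with 1 by ring.
    rewrite pow1; ring. }
  rewrite H0 in H; lra.
Qed.

Lemma Rsum_even (f : nat -> R) m :
  (forall q, (q < m)%nat -> f (2 * q + 1)%nat = 0) ->
  Rsum f (2 * m) = Rsum (fun q => f (2 * q)%nat) m.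
Proof.
  induction m; intros H; [reflexivity|].
  replace (2 * S m)%nat with (S (S (2 * m))) by lia.
  change (Rsum f (2 * m) + f (2 * m)%nat + f (S (2 * m))
          = Rsum (fun q => f (2 * q)%nat) m + f (2 * m)%nat).
  rewrite IHm by (intros; apply H; lia).
  replace (S (2 * m)) with (2 * m + 1)%nat by lia.
  rewrite H by lia; ring.
Qed.

Lemma Rsum_pred (f : nat -> R) n :
  (1 <= n)%nat -> Rsum f n = Rsum f (n - 1) + f (n - 1)%nat.
Proof. destruct n; [lia|intros _; simpl; now rewrite Nat.sub_0_r]. Qed.

(** Write [p - 1 = (M - 1) - (M - p)] with [M = 2 * i + 2]. Each part is an instance of the
    Bernoulli recurrence, the second one after [M - p] is cancelled against the factorial and the
    term [bern (M - 1)], of odd index, is dropped. *)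
Lemma bern_weighted_sum i : (1 <= i)%nat ->
  Rsum (fun p => (INR p - 1) * bern p / INR (fact (2 * i + 2 - p)))
       (2 * i + 2) = 0.
Proof.
  intros Hi.
  set (M := (2 * i + 2)%nat).
  assert (H1 : Rsum (fun p => bern p / INR (fact (M - p))) M = 0).
  { generalize (conv_bern (M - 1)); unfold conv, dirac0.
    destruct (Nat.eqb_spec (M - 1) 0); [lia|].
    replace (S (M - 1)) with M by lia; intros <-.
    apply Rsum_ext; intros k Hk.
    replace (S (M - 1 - k)) with (M - k)%nat by lia; reflexivity. }
  assert (H2 : Rsum (fun p => bern p / INR (fact (M - 1 - p))) M = 0).
  { rewrite Rsum_pred by lia.
    rewrite (bern_odd (M - 1)).
    2: lia.
    2: { replace (M - 1)%nat with (S (2 * i)) by lia.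
         rewrite Nat.odd_succ; apply Nat.even_spec; exists i; auto. }
    generalize (conv_bern (M - 2)); unfold conv, dirac0.
    destruct (Nat.eqb_spec (M - 2) 0); [lia|].
    replace (S (M - 2)) with (M - 1)%nat by lia; intros E.
    rewrite (Rsum_ext _ (fun p => bern p * / INR (fact (S (M - 2 - p))))).
    - rewrite E; unfold Rdiv; ring.
    - intros k Hk; replace (S (M - 2 - k)) with (M - 1 - k)%nat by lia.
      reflexivity. }
  rewrite (Rsum_ext _ (fun p => (INR M - 1) * (bern p / INR (fact (M - p)))
    + (-1) * (bern p / INR (fact (M - 1 - p))))).
  - rewrite Rsum_plus, !Rsum_scal, H1, H2; ring.
  - intros p Hp.
    replace (M - p)%nat with (S (M - 1 - p)) by lia.
    rewrite fact_simpl, mult_INR.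
    replace (INR (S (M - 1 - p))) with (INR M - INR p)
      by (rewrite <- minus_INR by lia; f_equal; lia).
    assert (INR p < INR M) by (apply lt_INR; lia).
    field; split; [apply INR_fact_neq_0|lra].
Qed.

Definition barnes_coef (k : nat) : R :=
  bernoulli (2 * k + 2) / (4 * INR k * (INR k + 1)).

Lemma bernoulli_2 : bernoulli 2 = / 6.
Proof.
  cbv [bernoulli bernoulli_table Nat.leb sum_f_R0 Binomial.C fact Nat.sub
     Nat.mul Nat.add INR]; field.
Qed.

(** The summand is [fact (2 * i - 1)] times the term [p = 2 * k + 4] of [bern_weighted_sum]. There
    the term [p = 1] vanishes by its factor [p - 1] and the later odd ones by [bern_odd], so the
    right-hand side is what the terms [p = 0] and [p = 2] contribute. *)
Lemma barnes_coef_identity i : (1 <= i)%nat ->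
  Rsum (fun k => barnes_coef (S k) *
                 inv_pow_coef (2 * k + 1) (2 * i - 2 * k - 2)) (i - 1)
  = / (4 * INR i * (INR i + 1) * (2 * INR i + 1)) - / (24 * INR i).
Proof.
  intros Hi.
  assert (H := bern_weighted_sum i Hi).
  set (g := fun p => (INR p - 1) * bern p / INR (fact (2 * i + 2 - p))) in H.
  replace (2 * i + 2)%nat with (2 * (S (S (i - 1))))%nat in H at 1 by lia.
  rewrite Rsum_even in H.
  2: { intros q Hq; unfold g; destruct q as [|q].
       - simpl (2 * 0 + 1)%nat; rewrite INR_1; unfold Rdiv; ring.
       - rewrite (bern_odd (2 * S q + 1)); [unfold Rdiv; ring|lia|].
         apply Nat.odd_spec; exists (S q); auto. }
  rewrite !Rsum_S_l in H.
  rewrite (Rsum_ext _ (fun k => INR (fact (2 * i - 1)) * g (2 * S (S k))%nat)).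
  - rewrite Rsum_scal.
    replace (Rsum _ (i - 1)) with (- g 0%nat - g 2%nat)
      by (change (g 0%nat) with (g (2 * 0)%nat);
          change (g 2%nat) with (g (2 * 1)%nat); lra).
    unfold g, bern.
    rewrite bernoulli_2, Nat.sub_0_r.
    change (bernoulli 0) with 1.
    change (INR (fact 0)) with 1; change (INR (fact 2)) with 2.
    replace (2 * i + 2 - 2)%nat with (S (2 * i - 1)) by lia.
    replace (2 * i + 2)%nat with (S (S (S (2 * i - 1)))) by lia.
    rewrite !fact_simpl, !mult_INR.
    replace (INR (S (2 * i - 1))) with (2 * INR i).
    2: { replace (S (2 * i - 1)) with (2 * i)%nat by lia.
         rewrite mult_INR; auto. }
    replace (INR (S (S (2 * i - 1)))) with (2 * INR i + 1).
    2: { replace (S (S (2 * i - 1))) with (2 * i + 1)%nat by lia.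
         rewrite plus_INR, mult_INR; auto. }
    replace (INR (S (S (S (2 * i - 1))))) with (2 * INR i + 2).
    2: { replace (S (S (S (2 * i - 1)))) with (2 * i + 2)%nat by lia.
         rewrite plus_INR, mult_INR; auto. }
    change (INR 0) with 0; change (INR 2) with 2.
    assert (1 <= INR i) by (apply (le_INR 1); auto).
    field; repeat split; try lra; apply INR_fact_neq_0.
  - intros k Hk; unfold barnes_coef, inv_pow_coef, g, bern.
    replace (2 * S k + 2)%nat with (2 * S (S k))%nat by lia.
    replace (2 * i + 2 - 2 * S (S k))%nat with (2 * i - 2 * k - 2)%nat by lia.
    replace (2 * k + 1 + (2 * i - 2 * k - 2))%nat with (2 * i - 1)%nat by lia.
    replace ((-1) ^ (2 * i - 2 * k - 2)) with 1.
    2: { replace (2 * i - 2 * k - 2)%nat with (2 * (i - k - 1))%nat by lia.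
         rewrite pow_mult; replace ((-1) ^ 2) with 1 by ring.
         now rewrite pow1. }
    replace (fact (2 * S (S k))) with (fact (S (S (S (2 * k + 1)))))
      by (f_equal; lia).
    replace (INR (2 * S (S k))) with (INR (S (S (S (2 * k + 1)))))
      by (f_equal; lia).
    rewrite !fact_simpl, !mult_INR, !S_INR, plus_INR, mult_INR.
    change (INR 2) with 2; change (INR 1) with 1.
    generalize (pos_INR k); intros.
    field; repeat split; try lra; apply INR_fact_neq_0.
Qed.

(** * The second difference of the asymptotic expansion *)

(** The expansion without its affine part. The exponent [2 * (k + 1)] is written [S (2 * k + 1)] to
    fit [expands_inv_pow]. *)
Definition barnes_main (n : nat) (w : C) : C :=
  (w ^ 2 / 2 * (clog w - (3 / 2)%R) - clog w / 12
   + Csum (fun k => barnes_coef (S k) * (/ w) ^ S (2 * k + 1)) n)%C.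

Definition barnes_defect (n : nat) (w : C) : C :=
  (clog w - (barnes_main n (w + 1) - 2 * barnes_main n w
             + barnes_main n (w - 1)))%C.

(** The shape follows [half_diff] through the closure rules of [expands], conditionals included, so
    that [half_diff_expands] is an application of these rules. *)
Definition half_diff_coef (n j : nat) : R :=
  / 2 * log_coef j + (if (j <? 1)%nat then 0 else log_coef (j - 1))
  + (5 / 12 * (if (j <? 2)%nat then 0 else log_coef (j - 2))
     + - (3 / 4) * (if (j <? 2)%nat then 0
                    else if (j - 2 =? 0)%nat then 1 else 0))
  + Rsum (fun k => barnes_coef (S k) *
       (if (j <? 2 * k + 4)%nat then 0 else
          inv_pow_coef (2 * k + 1) (j - (2 * k + 4))
          + (if (j - (2 * k + 4) =? 0)%nat then -1 else 0))) n.

(* With [u = / w], the second difference of [barnes_main n] at [w] minus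
   [clog w] is [half_diff n u + half_diff n (- u)] up to the factor [u ^ 2]. *)
Definition half_diff (n : nat) (u : C) : C :=
  ((/ 2)%R * clog (1 + u) + u ^ 1 * clog (1 + u)
   + ((5 / 12)%R * (u ^ 2 * clog (1 + u)) + (- (3 / 4))%R * (u ^ 2 * 1%R))
   + Csum (fun k => barnes_coef (S k) *
        (u ^ (2 * k + 4) * ((/ (1 + u)) ^ S (2 * k + 1) + (-1)%R))) n)%C.

Lemma half_diff_expands n J :
  expands (half_diff n) (half_diff_coef n) (S J).
Proof.
  assert (HL := expands_clog J).
  assert (HP : forall m f c, expands f c (S J) -> expands
    (fun u => u ^ m * f u)%C
    (fun j => if (j <? m)%nat then 0 else c (j - m)%nat) (S J)).
  { intros m f c H; apply expands_lower_le with (m + S J)%nat; [lia|].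
    now apply expands_pow_arg. }
  unfold half_diff, half_diff_coef.
  apply expands_plus; [apply expands_plus; apply expands_plus|].
  - apply expands_scal, HL.
  - apply (HP 1%nat (fun u => clog (1 + u))), HL.
  - apply expands_scal, (HP 2%nat (fun u => clog (1 + u))), HL.
  - apply expands_scal, (HP 2%nat (fun _ => RtoC 1)
      (fun j => if (j =? 0)%nat then 1 else 0)), expands_const.
  - apply expands_Csum with
      (f := fun k u => (barnes_coef (S k) * (u ^ (2 * k + 4) * _))%C)
      (c := fun k j => barnes_coef (S k)
                       * if (j <? 2 * k + 4)%nat then 0 else _).
    intros k _.
    apply expands_scal, (HP (2 * k + 4)%nat
             (fun u => (/ (1 + u)) ^ S (2 * k + 1) + (-1)%R)%C
             (fun j => inv_pow_coef (2 * k + 1) j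
                       + (if (j =? 0)%nat then -1 else 0))).
    apply expands_plus; [apply expands_inv_pow|apply expands_const].
Qed.

Lemma Rsum_extend (f : nat -> R) m n :
  (m <= n)%nat -> (forall k, (m <= k)%nat -> f k = 0) -> Rsum f n = Rsum f m.
Proof.
  induction 1 as [|n Hn IH]; intros H; auto.
  simpl; rewrite IH, (H n); auto; ring.
Qed.

Lemma pow_m1_even q : (-1) ^ (2 * q) = 1.
Proof.
  rewrite pow_mult; replace ((-1) ^ 2) with 1 by ring; apply pow1.
Qed.

Lemma log_coef_even q : log_coef (2 * q) = - / (2 * INR q).
Proof.
  unfold log_coef; rewrite pow_m1_even, mult_INR.
  change (INR 2) with 2; ring.
Qed.

Lemma log_coef_odd q : log_coef (2 * q + 1) = / (2 * INR q + 1).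
Proof.
  unfold log_coef; rewrite pow_add, pow_m1_even, plus_INR, mult_INR.
  change (INR 2) with 2; change (INR 1) with 1; ring.
Qed.

(** For [q = 1] the contributions are [- 1/4 + 1 - 3/4]. From [q = 2] on this is
    [barnes_coef_identity (q - 1)]; the bound on [q] ensures that the sum up to [n] contains every
    term of that identity. *)
Lemma half_diff_coef_even n q :
  (q <= n + 2)%nat -> half_diff_coef n (2 * q) = 0.
Proof.
  intros Hq; unfold half_diff_coef.
  destruct q as [|[|i]].
  - simpl (2 * 0)%nat; rewrite log_coef_0.
    change (0 <? 1)%nat with true; change (0 <? 2)%nat with true; cbv iota.
    rewrite Rsum_0.
    + ring.
    + intros k _; destruct (Nat.ltb_spec 0 (2 * k + 4)); [ring|lia].
  - rewrite (log_coef_even 1); simpl (2 * 1)%nat.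
    change (2 <? 1)%nat with false; change (2 <? 2)%nat with false.
    change (2 - 2)%nat with 0%nat; change (2 - 1)%nat with (2 * 0 + 1)%nat.
    change (0 =? 0)%nat with true; cbv iota.
    rewrite log_coef_0, (log_coef_odd 0).
    rewrite Rsum_0.
    + simpl INR; field.
    + intros k _; destruct (Nat.ltb_spec 2 (2 * k + 4)); [ring|lia].
  - rewrite log_coef_even.
    replace (2 * S (S i) <? 1)%nat with false
      by (symmetry; apply Nat.ltb_ge; lia).
    replace (2 * S (S i) <? 2)%nat with false
      by (symmetry; apply Nat.ltb_ge; lia).
    replace (2 * S (S i) - 2 =? 0)%nat with false
      by (symmetry; apply Nat.eqb_neq; lia).
    replace (2 * S (S i) - 1)%nat with (2 * S i + 1)%nat by lia.
    replace (2 * S (S i) - 2)%nat with (2 * S i)%nat by lia.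
    rewrite log_coef_odd, log_coef_even.
    (* Terms with [k > i] start beyond the power [2 * i + 4], and for [k = i] the constant term 1 of
       the inverse power is cancelled by the [-1]. *)
    rewrite (Rsum_extend _ i n); [|lia|].
    2: { intros k Hk.
         destruct (Nat.ltb_spec (2 * S (S i)) (2 * k + 4)); [ring|].
         replace (2 * S (S i) - (2 * k + 4))%nat with 0%nat by lia.
         rewrite inv_pow_coef_0; simpl; ring. }
    rewrite (Rsum_ext _ (fun k => barnes_coef (S k) *
       inv_pow_coef (2 * k + 1) (2 * S i - 2 * k - 2))).
    + assert (H := barnes_coef_identity (S i) ltac:(lia)).
      replace (S i - 1)%nat with i in H by lia; rewrite H.
      rewrite !S_INR; generalize (pos_INR i); intros.
      field; repeat split; lra.
    + intros k Hk.
      destruct (Nat.ltb_spec (2 * S (S i)) (2 * k + 4)); [lia|].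
      destruct (Nat.eqb_spec (2 * S (S i) - (2 * k + 4)) 0); [lia|].
      rewrite Rplus_0_r; do 2 f_equal; lia.
Qed.

(** Adding the value at [- u] cancels the odd coefficients, and the even ones vanish up to index
    [2 * n + 4]. Nothing of order below [2 * n + 6] remains. *)
Lemma half_diff_bound n : exists K, 0 <= K /\ forall u, Cmod u <= / 2 ->
  Cmod (half_diff n u + half_diff n (- u)) <= K * Cmod u ^ (2 * n + 6).
Proof.
  assert (H := half_diff_expands n (2 * n + 5)).
  assert (H' := expands_plus _ _ _ _ _ H (expands_opp_arg _ _ _ H)).
  replace (S (2 * n + 5)) with (2 * n + 6)%nat in H' by lia.
  destruct H' as [K [HK B]]; exists K; split; auto.
  intros u Hu; specialize (B u Hu).
  rewrite Csum_0 in B.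
  - replace (_ - 0)%C with (half_diff n u + half_diff n (- u))%C in B by ring.
    exact B.
  - intros j Hj.
    replace (half_diff_coef n j + (-1) ^ j * half_diff_coef n j) with 0.
    + ring.
    + destruct (Nat.Even_or_Odd j) as [[q ->]|[q ->]].
      * rewrite half_diff_coef_even by lia; ring.
      * rewrite pow_add, pow_m1_even; ring.
Qed.

Lemma clog_shift (w : C) (s : R) :
  0 < Re w -> 0 < Re (w + s) -> 0 < Re (1 + s * / w) ->
  clog (w + s) = (clog w + clog (1 + s * / w))%C.
Proof.
  intros H1 H2 H3; rewrite <- clog_mult; auto.
  - f_equal; field; now apply Cneq_0_Re.
  - replace (w * (1 + s * / w))%C with (w + s)%C; auto.
    field; now apply Cneq_0_Re.
Qed.

Lemma Cmod_inv_le_half (w : C) : 2 <= Cmod w -> Cmod (/ w) <= / 2.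
Proof.
  intros H; assert (w <> 0) by (apply Cmod_gt_0; lra).
  rewrite Cmod_inv by auto; apply Rinv_le_contravar; lra.
Qed.

Lemma barnes_main_shift n (w : C) (s : R) :
  0 < Re w -> 0 < Re (w + s) -> 0 < Re (1 + s * / w) ->
  barnes_main n (w + s) =
  ((w + s) ^ 2 / 2 * (clog w + clog (1 + s * / w) - (3 / 2)%R)
   - (clog w + clog (1 + s * / w)) / 12
   + Csum (fun k => barnes_coef (S k) *
       ((/ w) ^ S (2 * k + 1) * (/ (1 + s * / w)) ^ S (2 * k + 1))) n)%C.
Proof.
  intros H1 H2 H3; unfold barnes_main; rewrite clog_shift by auto.
  f_equal; apply Csum_ext; intros k _.
  rewrite <- Cpow_mult_l; do 2 f_equal; field.
  split; now apply Cneq_0_Re.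
Qed.

(** Factoring [w] out of [w + 1] and [w - 1] leaves [clog w] with total coefficient exactly 1, which
    the defect removes. The factor of [clog (1 + u)] is [(w + 1) ^ 2 / 2 - 1/12 = w ^ 2 / 2 + w +
    5/12], and the constant [- 3/2] is shared evenly between the two signs; these are the numbers in
    [half_diff]. *)
Lemma barnes_defect_eq n (w : C) :
  1 < Re w -> 2 <= Cmod w ->
  barnes_defect n w =
  (- w ^ 2 * (half_diff n (/ w) + half_diff n (- / w)))%C.
Proof.
  intros H1 H2.
  assert (Hu := Cmod_inv_le_half w H2).
  assert (Hw : w <> 0) by (apply Cneq_0_Re; lra).
  unfold barnes_defect.
  replace (w - 1)%C with (w + (-1)%R)%C
    by (apply C_eq; unfold Re, Im; simpl; ring).
  replace (RtoC 1) with (RtoC 1%R) by auto.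
  rewrite !barnes_main_shift; try (rewrite ?Re_plus; simpl; lra).
  2, 3: apply Rlt_le_trans with (/ 2); [lra|apply Re_1_plus].
  2: { replace (RtoC (-1) * / w)%C with (- / w)%C
         by (apply C_eq; unfold Re, Im; simpl; ring).
       now rewrite Cmod_opp. }
  2: { replace (1 * / w)%C with (/ w)%C by ring; exact Hu. }
  replace (RtoC (-1) * / w)%C with (- / w)%C
    by (apply C_eq; unfold Re, Im; simpl; ring).
  replace (1 * / w)%C with (/ w)%C by ring.
  unfold barnes_main, half_diff.
  set (u := (/ w)%C) in *.
  set (S1 := (Csum (fun k => barnes_coef (S k) *
       (u ^ S (2 * k + 1) * (/ (1 + u)) ^ S (2 * k + 1))) n)%C).
  set (S2 := (Csum (fun k => barnes_coef (S k) *
       (u ^ S (2 * k + 1) * (/ (1 + - u)) ^ S (2 * k + 1))) n)%C).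
  set (S0 := (Csum (fun k => barnes_coef (S k) * u ^ S (2 * k + 1)) n)%C).
  (* The exponent [2 * k + 4] is even, so both signs give the same power of [u], and [u ^ 2] factors
     out. *)
  assert (E : forall v : C, v = u \/ v = (- u)%C ->
    Csum (fun k => barnes_coef (S k) *
      (v ^ (2 * k + 4) * ((/ (1 + v)) ^ S (2 * k + 1) + (-1)%R)))%C n
    = (u ^ 2 * (Csum (fun k => barnes_coef (S k) *
       (u ^ S (2 * k + 1) * (/ (1 + v)) ^ S (2 * k + 1))) n - S0))%C).
  { intros v Hv; unfold S0; rewrite <- Csum_minus, <- Csum_scal.
    apply Csum_ext; intros k _.
    assert (Ev : (v ^ (2 * k + 4) = u ^ 2 * u ^ S (2 * k + 1))%C).
    { rewrite <- Cpow_add_r; replace (2 + S (2 * k + 1))%nat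
        with (2 * (k + 2))%nat by lia.
      replace (2 * k + 4)%nat with (2 * (k + 2))%nat by lia.
      rewrite !Cpow_mult_r.
      replace (v ^ 2)%C with (u ^ 2)%C; auto.
      destruct Hv; subst v; ring. }
    rewrite Ev; replace (RtoC (-1)) with (- (1))%C
      by (apply C_eq; simpl; ring).
    ring. }
  rewrite !E by auto; fold S1 S2.
  replace (RtoC (-1)) with (- (1))%C by (apply C_eq; simpl; ring).
  assert (Ew : (w * u)%C = 1) by (unfold u; field; auto).
  assert (Ew2 : (w ^ 2 * u ^ 2)%C = 1).
  { rewrite <- Cpow_mult_l, Ew; apply Cpow_1_l. }
  rewrite !RtoC_opp, !RtoC_div, RtoC_inv by lra.
  set (X := clog (1 + u)); set (Y := clog (1 + - u)); set (L := clog w).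
  replace (- w ^ 2 * _)%C with
    (- (w ^ 2 / 2 * (X + Y) + (w * u) * w * (X - Y)
       + (w ^ 2 * u ^ 2) * (5 / 12 * (X + Y) - 3 / 2)
       + (w ^ 2 * u ^ 2) * (S1 - S0 + (S2 - S0))))%C by field.
  rewrite Ew, Ew2; field.
Qed.

Lemma barnes_defect_bound n : exists K, 0 <= K /\ forall w,
  1 < Re w -> 2 <= Cmod w ->
  Cmod (barnes_defect n w) <= K / Cmod w ^ (2 * n + 4).
Proof.
  destruct (half_diff_bound n) as [K [HK B]]; exists K; split; auto.
  intros w H1 H2; rewrite barnes_defect_eq by auto.
  assert (Hw : w <> 0) by (apply Cmod_gt_0; lra).
  specialize (B (/ w)%C (Cmod_inv_le_half w H2)).
  rewrite Cmod_inv, pow_inv in B by auto.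
  rewrite Cmod_mult, Cmod_opp, Cmod_pow.
  assert (Hp : 0 < Cmod w ^ (2 * n + 4)) by (apply pow_lt; lra).
  replace (K / Cmod w ^ (2 * n + 4))
    with (Cmod w ^ 2 * (K * / Cmod w ^ (2 * n + 6))).
  - apply Rmult_le_compat_l; auto; apply pow_le, Cmod_ge_0.
  - replace (2 * n + 6)%nat with (2 + (2 * n + 4))%nat by lia.
    rewrite (pow_add _ 2); field; split; lra.
Qed.

(** * Products of limits and summation by parts *)

Lemma is_lim_seq_mult_0 (u v : nat -> R) :
  is_lim_seq u 0 -> is_lim_seq v 0 -> is_lim_seq (fun n => u n * v n) 0.
Proof.
  intros Hu Hv; replace (Finite 0) with (Finite (0 * 0)) by (f_equal; ring).
  now apply is_lim_seq_mult'.
Qed.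

Lemma Ccv_mult (u v : nat -> C) (l m : C) :
  Ccv u l -> Ccv v m -> Ccv (fun n => u n * v n)%C (l * m)%C.
Proof.
  intros Hu Hv.
  apply Ccv_le with (fun n => Cmod (u n - l) * Cmod (v n - m)
    + (Cmod m * Cmod (u n - l) + Cmod l * Cmod (v n - m))).
  - exists O; intros n _.
    replace (u n * v n - l * m)%C with
      ((u n - l) * (v n - m) + (m * (u n - l) + l * (v n - m)))%C by ring.
    rewrite <- !Cmod_mult.
    apply Rle_trans with (1 := Cmod_triangle _ _).
    apply Rplus_le_compat_l, Cmod_triangle.
  - apply is_lim_seq_plus_0; [now apply is_lim_seq_mult_0|].
    apply is_lim_seq_plus_0; now apply is_lim_seq_scal_0.
Qed.

Lemma Ccv_pow (u : nat -> C) (l : C) m :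
  Ccv u l -> Ccv (fun n => u n ^ m)%C (l ^ m)%C.
Proof.
  intros H; induction m; simpl; [apply Ccv_const|now apply Ccv_mult].
Qed.

Lemma Ccv_Csum (u : nat -> nat -> C) (l : nat -> C) m :
  (forall k, Ccv (u k) (l k)) ->
  Ccv (fun n => Csum (fun k => u k n) m) (Csum l m).
Proof.
  intros H; induction m; simpl; [apply Ccv_const|now apply Ccv_plus].
Qed.

Lemma Ccv_eq (u : nat -> C) (l m : C) : l = m -> Ccv u l -> Ccv u m.
Proof. intros ->; auto. Qed.

(** Follows the arithmetic of the sequence and closes the leaves by known limits. The limit is built
    as a metavariable, and [Ccv_eq] leaves its comparison with the expected value to [ring] or
    [field]. *)
Ltac ccv :=
  match goal with
  | |- Ccv (fun _ => ?c) _ => exact (Ccv_const c)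
  | |- Ccv (fun n => (@?f n + @?g n)%C) _ => eapply (Ccv_plus f g); ccv
  | |- Ccv (fun n => (@?f n - @?g n)%C) _ => eapply (Ccv_minus f g); ccv
  | |- Ccv (fun n => (@?f n * @?g n)%C) _ => eapply (Ccv_mult f g); ccv
  | |- Ccv (fun n => (- @?f n)%C) _ => eapply (Ccv_opp f); ccv
  | |- Ccv (fun n => (@?f n ^ ?m)%C) _ => eapply (Ccv_pow f); ccv
  | _ => eassumption
  end.

Lemma is_lim_seq_inv_INR : is_lim_seq (fun n => / INR n) 0.
Proof.
  apply (is_lim_seq_inv INR p_infty); [apply is_lim_seq_INR|discriminate].
Qed.

Lemma Ccv_0_le_inv_INR (u : nat -> C) K N :
  (forall n, (N <= n)%nat -> Cmod (u n) <= K * / INR n) -> Ccv u 0.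
Proof.
  intros H; apply Ccv_le with (fun n => K * / INR n).
  - exists N; intros n Hn; replace (u n - 0)%C with (u n) by ring; auto.
  - apply is_lim_seq_scal_0, is_lim_seq_inv_INR.
Qed.

Lemma INR_large (x : R) : exists N, forall n, (N <= n)%nat -> x <= INR n.
Proof.
  destruct (INR_unbounded x) as [N HN]; exists N; intros n Hn.
  apply le_INR in Hn; lra.
Qed.

(** The weights are linear, so their own second difference is zero and only boundary terms survive;
    [a 0] will be the expansion at [z] itself. *)
Lemma Csum_second_diff (a : nat -> C) N :
  Csum (fun k => INR (S k) * (a (S (S k)) - 2 * a (S k) + a k))%C N
  = (INR N * a (S N) - (INR N + 1) * a N + a 0%nat)%C.
Proof.
  induction N as [|N IH]; [simpl; ring|].
  change (Csum ?f (S N)) with (Csum f N + f N)%C; cbv beta.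
  rewrite IH, S_INR, RtoC_plus; ring.
Qed.

(** * Limit of the telescoped sum *)

Lemma clog_expansion_2 : exists K, 0 <= K /\ forall u, Cmod u <= / 2 ->
  Cmod (clog (1 + u) - (u - u ^ 2 / 2)) <= K * Cmod u ^ 3.
Proof.
  destruct (expands_clog 2) as [K [HK H]]; exists K; split; auto.
  intros u Hu; apply Rle_trans with (2 := H u Hu); right; do 2 f_equal.
  simpl Csum; rewrite log_coef_0.
  replace (log_coef 1) with 1 by (unfold log_coef; simpl; field).
  replace (log_coef 2) with (- / 2) by (unfold log_coef; simpl; field).
  rewrite RtoC_opp, RtoC_inv by lra; field.
Qed.

Lemma clog_expansion_3 : exists K, 0 <= K /\ forall u, Cmod u <= / 2 ->
  Cmod (clog (1 + u) - (u - u ^ 2 / 2 + u ^ 3 / 3)) <= K * Cmod u ^ 4.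
Proof.
  destruct (expands_clog 3) as [K [HK H]]; exists K; split; auto.
  intros u Hu; apply Rle_trans with (2 := H u Hu); right; do 2 f_equal.
  simpl Csum; rewrite log_coef_0.
  replace (log_coef 1) with 1 by (unfold log_coef; simpl; field).
  replace (log_coef 2) with (- / 2) by (unfold log_coef; simpl; field).
  replace (log_coef 3) with (/ 3) by (unfold log_coef; simpl; field).
  rewrite RtoC_opp, !RtoC_inv by lra; field.
Qed.

Definition asymp (c d : C) (n : nat) (w : C) : C :=
  (barnes_main n w + c * w + d)%C.

Definition sum_k_ln (N : nat) : R :=
  Rsum (fun k => INR (S k) * ln (INR (S k))) N.

Definition harmonic (N : nat) : R := Rsum (fun k => / INR (S k)) N.

(** What is left of [logG_seq z N] after removing [asymp] at [z] and the weighted defects, as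
    [logG_seq_decomp] shows: the boundary terms at [N], the convergence factors of the product and
    its prefactor. *)
Definition telescope_rest (c d : C) (n : nat) (z : C) (N : nat) : C :=
  (INR N * asymp c d n (z + INR (S N)) - (INR N + 1) * asymp c d n (z + INR N)
   - sum_k_ln N + z ^ 2 / 2 * harmonic N - INR N * z
   + z * c - (z + z ^ 2 * (1 + euler_gamma)%R) / 2)%C.

Lemma Cmod_plus_INR_ge (z : C) (N : nat) :
  0 < Re z -> INR N <= Cmod (z + INR N).
Proof.
  intros Hz; apply Rle_trans with (2 := Re_le_Cmod _).
  rewrite Re_plus, re_RtoC; lra.
Qed.

(** The coefficient [c] cancels identically. The boundary terms contribute [- d], which the limit of
    [sum_k_ln] compensates, and [euler_gamma] absorbs the growth of [harmonic]. The remaining terms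
    cancel after expanding the logarithms in [/ N] and [/ (z + N)]. *)
Lemma telescope_rest_cv (c d : C) (n : nat) (z : C) :
  0 < Re z ->
  is_lim_seq (fun N => harmonic N - ln (INR N)) euler_gamma ->
  Ccv (fun N => RtoC (sum_k_ln N
         - (INR N ^ 2 / 2 + INR N / 2 + / 12) * ln (INR N) + INR N ^ 2 / 4))
      (/ 12 - d) ->
  Ccv (telescope_rest c d n z) 0.
Proof.
  intros Hz Hgamma Hglaisher.
  destruct clog_expansion_2 as [K1 [HK1 B1]].
  destruct clog_expansion_3 as [K2 [HK2 B2]].
  set (x := fun N : nat => (/ INR N)%C).
  set (w := fun N : nat => (z + INR N)%C).
  set (u := fun N => (/ w N)%C).
  set (u' := fun N => (/ (w N + 1))%C).
  set (l := fun N => clog (1 + z * x N)).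
  set (m := fun N => clog (1 + u N)).
  (* The factor of [l] in the rest is of order [N ^ 2] and that of [m] of order [N ^ 3]. The Taylor
     remainders are scaled accordingly, and the orders of expansion are chosen so that they still
     tend to 0. *)
  set (r1 := fun N => (INR N ^ 2 *
                       (l N - (z * x N - (z * x N) ^ 2 / 2)))%C).
  set (r2 := fun N => (INR N ^ 3 *
                       (m N - (u N - u N ^ 2 / 2 + u N ^ 3 / 3)))%C).
  set (s := fun (f : nat -> C) N => Csum (fun k => barnes_coef (S k) *
              (INR N * f N * f N ^ (2 * k + 1)))%C n).
  set (s1 := fun N => Csum (fun k => barnes_coef (S k) *
              u N ^ S (2 * k + 1))%C n).
  set (g := fun N => (harmonic N - ln (INR N) - euler_gamma)%C).
  set (h := fun N => (RtoC (sum_k_ln N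
         - (INR N ^ 2 / 2 + INR N / 2 + / 12) * ln (INR N) + INR N ^ 2 / 4)
         - (/ 12 - d))%C).
  assert (HN : forall N, (1 <= N)%nat -> 1 <= INR N)
    by (intros N HN; apply (le_INR 1); auto).
  assert (HN0 : forall N, (1 <= N)%nat -> RtoC (INR N) <> 0)
    by (intros N HN1; apply RtoC_neq_0; specialize (HN N HN1); lra).
  assert (Hw : forall N, INR N <= Cmod (w N))
    by (intros; now apply Cmod_plus_INR_ge).
  assert (HwR : forall N, 0 < Re (w N)).
  { intros N; unfold w; rewrite Re_plus, re_RtoC.
    generalize (pos_INR N); lra. }
  assert (Hw0 : forall N, w N <> 0) by (intros; now apply Cneq_0_Re).
  assert (Hw1 : forall N, (w N + 1)%C <> 0).
  { intros N; apply Cneq_0_Re; rewrite Re_plus, re_RtoC.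
    generalize (HwR N); lra. }
  assert (Hx : forall N, (1 <= N)%nat -> Cmod (x N) = / INR N).
  { intros N HN1; unfold x; rewrite Cmod_inv, Cmod_INR; auto. }
  assert (Hu : forall N, (1 <= N)%nat -> Cmod (u N) <= / INR N).
  { intros N HN1; unfold u; rewrite Cmod_inv by auto.
    apply Rinv_le_contravar; [specialize (HN N HN1); lra|auto]. }
  assert (Cx : Ccv x 0).
  { apply Ccv_0_le_inv_INR with 1 1%nat; intros N HN1.
    rewrite Hx by auto; lra. }
  assert (Cu : Ccv u 0).
  { apply Ccv_0_le_inv_INR with 1 1%nat; intros N HN1.
    specialize (Hu N HN1); lra. }
  assert (Cu' : Ccv u' 0).
  { apply Ccv_ext with (fun N => u (1 + N)%nat).
    - intros N; unfold u, u', w; rewrite plus_INR, RtoC_plus.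
      f_equal; simpl; ring.
    - now apply (Ccv_shift u). }
  assert (CNu : Ccv (fun N => INR N * u N)%C 1).
  { apply Ccv_ext with (fun N => 1 - z * u N)%C.
    - intros N; unfold u; replace (RtoC (INR N)) with (w N - z)%C
        by (unfold w; ring); field; auto.
    - eapply Ccv_eq; [|apply Ccv_minus; [apply Ccv_const|apply Ccv_scal, Cu]].
      ring. }
  assert (CNu' : Ccv (fun N => INR N * u' N)%C 1).
  { apply Ccv_ext with (fun N => 1 - (z + 1) * u' N)%C.
    - intros N; unfold u'; replace (RtoC (INR N)) with (w N - z)%C
        by (unfold w; ring); field; auto.
    - eapply Ccv_eq; [|apply Ccv_minus; [apply Ccv_const|apply Ccv_scal, Cu']].
      ring. }
  destruct (INR_large (2 * Cmod z + 2)) as [N0 HN0'].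
  assert (Hzx : forall N, (N0 <= N)%nat -> (1 <= N)%nat /\
            Cmod (z * x N) <= / 2 /\ Cmod (u N) <= / 2).
  { intros N HN1; specialize (HN0' N HN1).
    generalize (Cmod_ge_0 z); intros Hz0.
    assert (1 <= N)%nat by (apply (INR_le 1); simpl; lra).
    split; auto; split.
    - rewrite Cmod_mult, Hx by auto.
      apply Rmult_le_reg_r with (INR N); [lra|].
      rewrite Rmult_assoc, Rinv_l by lra; lra.
    - apply Rle_trans with (1 := Hu N H), Rinv_le_contravar; lra. }
  assert (Cr1 : Ccv r1 0).
  { apply Ccv_0_le_inv_INR with (K1 * Cmod z ^ 3) N0; intros N HN1.
    destruct (Hzx N HN1) as [HN2 [H1 H2]].
    unfold r1, l; rewrite Cmod_mult, Cmod_pow, Cmod_INR.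
    specialize (B1 _ H1); rewrite Cmod_mult, Hx in B1 by auto.
    specialize (HN N HN2).
    apply Rle_trans with (INR N ^ 2 * (K1 * (Cmod z * / INR N) ^ 3)).
    - apply Rmult_le_compat_l; [apply pow_le; lra|auto].
    - right; field; lra. }
  assert (Cr2 : Ccv r2 0).
  { apply Ccv_0_le_inv_INR with K2 N0; intros N HN1.
    destruct (Hzx N HN1) as [HN2 [H1 H2]].
    unfold r2, m; rewrite Cmod_mult, Cmod_pow, Cmod_INR.
    specialize (B2 _ H2); specialize (HN N HN2).
    apply Rle_trans with (INR N ^ 3 * (K2 * (/ INR N) ^ 4)).
    - apply Rmult_le_compat_l; [apply pow_le; lra|].
      apply Rle_trans with (1 := B2), Rmult_le_compat_l; auto.
      apply pow_incr; split; [apply Cmod_ge_0|auto].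
    - right; field; lra. }
  assert (Cl : Ccv l 0).
  { apply Ccv_ext_loc with (fun N => x N ^ 2 * r1 N
                         + (z * x N - (z * x N) ^ 2 / 2))%C N0.
    - intros N HN1; destruct (Hzx N HN1) as [HN2 _].
      unfold r1, x; field; auto.
    - eapply Ccv_eq; [|apply Ccv_plus;
        [apply Ccv_mult; [apply Ccv_pow, Cx|apply Cr1]
        |apply Ccv_minus; [apply Ccv_scal, Cx|]]].
      2: { apply Ccv_mult; [apply Ccv_pow, Ccv_scal, Cx|apply Ccv_const]. }
      field. }
  assert (Cs : forall f, Ccv f 0 -> Ccv (fun N => INR N * f N)%C 1 ->
            Ccv (s f) 0).
  { intros f H1 H2; eapply Ccv_eq; [|apply Ccv_Csum; intros k;
      apply Ccv_scal, Ccv_mult; [exact H2|apply Ccv_pow, H1]].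
    rewrite Csum_0; auto.
    intros k _; rewrite Nat.add_1_r, Cpow_S; ring. }
  assert (Cs1 : Ccv s1 0).
  { eapply Ccv_eq; [|apply Ccv_Csum; intros k;
      apply Ccv_scal, Ccv_pow, Cu].
    rewrite Csum_0; auto.
    intros k _; rewrite Cpow_S; ring. }
  assert (Cg : Ccv g 0).
  { eapply Ccv_eq; [|apply Ccv_minus; [|apply Ccv_const]].
    2: { apply Ccv_ext with (fun N => RtoC (harmonic N - ln (INR N))).
         - intros; now rewrite RtoC_minus.
         - apply Ccv_RtoC, Hgamma. }
    ring. }
  assert (Ch : Ccv h 0).
  { eapply Ccv_eq; [|apply Ccv_minus; [exact Hglaisher|apply Ccv_const]].
    ring. }
  assert (Csu' := Cs u' Cu' CNu'); assert (Csu := Cs u Cu CNu).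
  set (p := fun N => (INR N * u N)%C) in *.
  set (su := s u) in *; set (su' := s u') in *.
  (* The rest as a combination of sequences with known limits: everything tends to 0 except [p],
     which tends to 1 and always comes with a power of [u]. *)
  apply Ccv_ext_loc with (fun N =>
    - h N + z ^ 2 / 2 * g N
    + (- (z ^ 3 / 2) * x N + - (z ^ 2 / 4) * x N + z ^ 4 / 4 * x N ^ 2
       + - (z / 12) * u N + / 8 * (p N * u N)
       + 5 / 36 * (p N * u N ^ 2))
    + (/ 2 * ((1 + x N + - z ^ 2 * x N ^ 2) * r1 N)
       + / 2 * ((1 + (z + 1) * x N) ^ 2 * r2 N)
       + - (/ 12) * (x N ^ 2 * r2 N) + / 12 * l N)
    + (su' N - su N - s1 N))%C N0.
  - intros N HN1; destruct (Hzx N HN1) as [HN2 [H1 H2]].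
    assert (HNp := HN N HN2).
    assert (El : clog (w N) = (ln (INR N) + l N)%C).
    { unfold l; rewrite <- clog_RtoC by lra.
      rewrite <- clog_mult.
      - f_equal; unfold w, x; field; auto.
      - rewrite re_RtoC; lra.
      - generalize (Re_1_plus _ H1); lra.
      - replace (INR N * (1 + z * x N))%C with (w N); [apply HwR|].
        unfold w, x; field; auto. }
    assert (Em : clog (w N + 1) = (ln (INR N) + l N + m N)%C).
    { rewrite <- El; unfold m, u.
      replace (/ w N)%C with (1%R * / w N)%C by ring.
      apply (clog_shift (w N) 1); auto.
      - rewrite Re_plus, re_RtoC; generalize (HwR N); lra.
      - replace (1%R * / w N)%C with (u N) by (unfold u; ring).
        generalize (Re_1_plus _ H2); lra. }
    unfold telescope_rest, asymp, barnes_main.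
    replace (z + INR (S N))%C with (w N + 1)%C
      by (unfold w; rewrite S_INR, RtoC_plus; ring).
    fold (w N); rewrite El, Em.
    fold (u N) (u' N).
    replace (su' N) with (INR N * Csum (fun k => barnes_coef (S k) *
              u' N ^ S (2 * k + 1))%C n)%C.
    2: { unfold su', s; rewrite <- Csum_scal; apply Csum_ext; intros.
         rewrite Cpow_S; ring. }
    replace (su N) with (INR N * s1 N)%C.
    2: { unfold su, s, s1; rewrite <- Csum_scal; apply Csum_ext; intros.
         rewrite Cpow_S; ring. }
    fold (s1 N).
    set (S' := Csum _ n); set (S1 := s1 N).
    replace (m N) with (r2 N / INR N ^ 3
       + (u N - u N ^ 2 / 2 + u N ^ 3 / 3))%C
      by (unfold r2; field; auto).
    replace (l N) with (r1 N / INR N ^ 2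
       + (z * x N - (z * x N) ^ 2 / 2))%C
      by (unfold r1; field; auto).
    set (e1 := r1 N); set (e2 := r2 N).
    unfold h, g.
    rewrite RtoC_plus, RtoC_minus, RtoC_mult, !RtoC_plus, !RtoC_div,
      !RtoC_pow, RtoC_inv by lra.
    set (L := RtoC (ln (INR N))).
    unfold p, x, u, w; field.
    split; auto; apply (Hw0 N).
  - clearbody p su su' g h l s1 r1 r2 u x.
    eapply Ccv_eq; [|ccv]; field.
Qed.

(** * Uniqueness of continuous logarithms on the right half-plane *)

Definition ccont (f : C -> C) (z : C) : Prop :=
  forall eps : R, 0 < eps -> exists delta, 0 < delta /\
    forall w, Cmod (w - z) < delta -> Cmod (f w - f z) < eps.

Lemma ccont_lipschitz (f : C -> C) (z : C) (K r : R) :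
  0 < r -> (forall w, Cmod (w - z) < r ->
              Cmod (f w - f z) <= K * Cmod (w - z)) -> ccont f z.
Proof.
  intros Hr H eps He.
  exists (Rmin r (eps / (Rabs K + 1))).
  assert (HK := Rabs_pos K).
  split; [apply Rmin_pos; auto; apply Rdiv_lt_0_compat; lra|].
  intros w Hw.
  apply Rmin_Rgt_l in Hw; destruct Hw as [H1 H2].
  apply Rle_lt_trans with (1 := H w H1).
  apply Rmult_lt_of_lt_div; auto using Cmod_ge_0.
Qed.

Lemma ccont_plus (f g : C -> C) z :
  ccont f z -> ccont g z -> ccont (fun z => f z + g z)%C z.
Proof.
  intros Hf Hg eps He.
  destruct (Hf (eps / 2)) as [d [Hd H]]; [lra|].
  destruct (Hg (eps / 2)) as [d' [Hd' H']]; [lra|].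
  exists (Rmin d d'); split; [now apply Rmin_pos|]; intros w Hw.
  replace (f w + g w - (f z + g z))%C
    with ((f w - f z) + (g w - g z))%C by ring.
  apply Rle_lt_trans with (1 := Cmod_triangle _ _).
  apply Rmin_Rgt_l in Hw; destruct Hw as [Hw1 Hw2].
  generalize (H w Hw1) (H' w Hw2); lra.
Qed.

Lemma ccont_const (c z : C) : ccont (fun _ => c) z.
Proof.
  apply (ccont_lipschitz _ _ 0 1); [lra|]; intros w _.
  replace (c - c)%C with (RtoC 0) by ring; rewrite Cmod_0; lra.
Qed.

Lemma ccont_scal (c : C) (f : C -> C) z :
  ccont f z -> ccont (fun z => c * f z)%C z.
Proof.
  intros Hf eps He.
  assert (Hc := Rabs_pos (Cmod c)).
  destruct (Hf (eps / (Rabs (Cmod c) + 1))) as [d [Hd H]].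
  { apply Rdiv_lt_0_compat; lra. }
  exists d; split; auto; intros w Hw; specialize (H w Hw).
  replace (c * f w - c * f z)%C with (c * (f w - f z))%C by ring.
  rewrite Cmod_mult; apply Rmult_lt_of_lt_div; auto using Cmod_ge_0.
Qed.

Lemma ccont_Csum (f : nat -> C -> C) z n :
  (forall k, ccont (f k) z) -> ccont (fun z => Csum (fun k => f k z) n) z.
Proof.
  intros H; induction n; simpl; [apply ccont_const|now apply ccont_plus].
Qed.

Lemma ccont_ext (f g : C -> C) z :
  (forall w, f w = g w) -> ccont f z -> ccont g z.
Proof.
  intros E H eps He; destruct (H eps He) as [d [Hd H']].
  exists d; split; auto; intros w Hw; rewrite <- !E; auto.
Qed.

Lemma ccont_id z : ccont (fun z => z) z.
Proof. apply (ccont_lipschitz _ _ 1 1); [lra|]; intros; lra. Qed.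

Lemma ccont_sqr z : ccont (fun z => z ^ 2)%C z.
Proof.
  apply (ccont_lipschitz _ _ (2 * Cmod z + 1) 1); [lra|]; intros w Hw.
  replace (w ^ 2 - z ^ 2)%C with ((w - z + 2 * z) * (w - z))%C by ring.
  rewrite Cmod_mult; apply Rmult_le_compat_r; [apply Cmod_ge_0|].
  apply Rle_trans with (1 := Cmod_triangle _ _).
  rewrite Cmod_mult, Cmod_R, Rabs_pos_eq by lra; lra.
Qed.

Lemma Re_near (z w : C) r : Cmod (w - z) < r -> Re z - r < Re w.
Proof.
  intros H; generalize (re_le_Cmod (w - z)); rewrite Re_minus.
  intros H1; apply Rabs_le_between in H1; lra.
Qed.

(** With [w = z * (1 + u)], the first-order case of [expands_clog] is a Lipschitz bound. The radius
    [Re z / 2] keeps [w] in the half-plane and [u] in the disc of radius [/ 2]. *)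
Lemma ccont_clog (z : C) : 0 < Re z -> ccont clog z.
Proof.
  intros Hz; assert (Hz0 := Cneq_0_Re z Hz).
  assert (Hm : 0 < Cmod z) by now apply Cmod_gt_0.
  destruct (expands_clog 0) as [K [HK B]].
  apply (ccont_lipschitz _ _ (K / Cmod z) (Re z / 2)); [lra|].
  intros w Hw.
  assert (Hw0 := Re_near _ _ _ Hw).
  set (u := ((w - z) / z)%C).
  assert (Hu : Cmod u <= / 2).
  { unfold u; rewrite Cmod_div by auto.
    apply Rmult_le_reg_r with (Cmod z); auto.
    unfold Rdiv; rewrite Rmult_assoc, Rinv_l by lra.
    generalize (Re_le_Cmod z); lra. }
  assert (E : w = (z * (1 + u))%C) by (unfold u; field; auto).
  specialize (B u Hu).
  rewrite E at 1; rewrite clog_mult.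
  - replace (clog z + clog (1 + u) - clog z)%C
      with (clog (1 + u) - Csum (fun j => log_coef j * u ^ j)%C 1)%C
      by (simpl Csum; rewrite log_coef_0; ring).
    apply Rle_trans with (1 := B); unfold u.
    rewrite Cmod_div by auto; right; field; lra.
  - auto.
  - generalize (Re_1_plus u Hu); lra.
  - rewrite <- E; lra.
Qed.

(** Extends the parameter of a segment to the whole line, because [IVT_gen] asks for a function that
    is continuous everywhere. *)
Definition clamp (t : R) : R := Rmax 0 (Rmin 1 t).

Lemma clamp_bound t : 0 <= clamp t <= 1.
Proof. unfold clamp, Rmax, Rmin; destruct (Rle_dec 1 t);
  destruct (Rle_dec _ _); lra. Qed.

Lemma clamp_dist t s : Rabs (clamp t - clamp s) <= Rabs (t - s).
Proof.
  unfold clamp, Rmax, Rmin; destruct (Rle_dec 1 t), (Rle_dec 1 s);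
    repeat destruct (Rle_dec _ _); unfold Rabs;
    repeat destruct (Rcase_abs _); lra.
Qed.

Lemma clamp_0 : clamp 0 = 0.
Proof. unfold clamp, Rmax, Rmin; repeat destruct (Rle_dec _ _); lra. Qed.

Lemma clamp_1 : clamp 1 = 1.
Proof. unfold clamp, Rmax, Rmin; repeat destruct (Rle_dec _ _); lra. Qed.

(** Along the segment from 1 to [z] the difference of the imaginary parts is continuous and starts
    at 0. Were it positive at the end, it would take the value [Rmin (h 1) PI], which is positive
    and below the period, contradicting [Cexp_inj]. *)
Lemma log_unique_le (f g : C -> C) :
  (forall z, 0 < Re z -> ccont f z /\ ccont g z /\ Cexp (f z) = Cexp (g z)) ->
  Im (f 1) = Im (g 1) ->
  forall z, 0 < Re z -> Im (f z) <= Im (g z).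
Proof.
  intros H H1 z Hz.
  apply Rnot_lt_le; intros Hlt.
  set (p := fun t => (1 + clamp t * (z - 1))%C).
  assert (Hp : forall t, 0 < Re (p t)).
  { intros t; unfold p; rewrite Re_plus, re_scal_l, Re_minus, !re_RtoC.
    generalize (clamp_bound t); nra. }
  set (h := fun t => Im (f (p t)) - Im (g (p t))).
  assert (Hc : forall F, (forall z, 0 < Re z -> ccont F z) ->
            continuity (fun t => Im (F (p t)))).
  { intros F HF t; apply continuity_pt_locally; intros eps.
    destruct (HF (p t) (Hp t) eps (cond_pos eps)) as [d [Hd Hd']].
    assert (Hm := Cmod_ge_0 (z - 1)).
    assert (Hpos : 0 < d / (Cmod (z - 1) + 1))
      by (apply Rdiv_lt_0_compat; lra).
    exists (mkposreal _ Hpos); intros s Hs.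
    change (Rabs (s - t) < d / (Cmod (z - 1) + 1)) in Hs.
    apply Rle_lt_trans with (Cmod (F (p s) - F (p t))).
    { apply (Im_le_Cmod (F (p s) - F (p t))). }
    apply Hd'.
    unfold p; replace (_ - _)%C with (RtoC (clamp s - clamp t) * (z - 1))%C
      by (rewrite RtoC_minus; ring).
    rewrite Cmod_mult, Cmod_R.
    apply Rle_lt_trans with (Rabs (s - t) * (Cmod (z - 1) + 1)).
    - apply Rmult_le_compat; auto using Rabs_pos, clamp_dist; lra.
    - replace d with (d / (Cmod (z - 1) + 1) * (Cmod (z - 1) + 1))
        by (field; lra).
      apply Rmult_lt_compat_r; lra. }
  assert (Ch : continuity h).
  { apply continuity_minus; apply Hc; intros; apply H; auto. }
  assert (h0 : h 0 = 0).
  { unfold h, p; rewrite clamp_0.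
    replace (1 + 0 * (z - 1))%C with (RtoC 1) by ring; lra. }
  assert (h1 : h 1 > 0).
  { unfold h, p; rewrite clamp_1.
    replace (1 + 1 * (z - 1))%C with z by ring; lra. }
  assert (HPI := PI_RGT_0).
  destruct (IVT_gen h 0 1 (Rmin (h 1) PI) Ch) as [t [_ Ht]].
  { rewrite h0, Rmin_left, Rmax_right by lra; split.
    - apply Rmin_glb; lra.
    - apply Rmin_l. }
  assert (0 < h t) by (rewrite Ht; apply Rmin_pos; lra).
  assert (h t <= PI) by (rewrite Ht; apply Rmin_r).
  destruct (H (p t) (Hp t)) as [_ [_ E]].
  apply Cexp_inj in E.
  - assert (h t = 0) by (unfold h; rewrite E; ring); lra.
  - fold (h t); rewrite Rabs_pos_eq; lra.
Qed.

Lemma log_unique (f g : C -> C) :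
  (forall z, 0 < Re z -> ccont f z /\ ccont g z /\ Cexp (f z) = Cexp (g z)) ->
  Im (f 1) = Im (g 1) ->
  forall z, 0 < Re z -> f z = g z.
Proof.
  intros H H1 z Hz; apply Cexp_inj; [|apply H; auto].
  replace (Im (f z)) with (Im (g z)).
  - replace (_ - _) with 0 by ring; rewrite Rabs_R0.
    generalize PI_RGT_0; lra.
  - apply Rle_antisym; apply log_unique_le; auto.
    intros w Hw; destruct (H w Hw) as [? []]; auto.
Qed.

(** * The logarithm of the Weierstrass product *)

(** A logarithm of the Weierstrass factor with index [k + 1]. It is written with
    [clog (z + (k + 1))] instead of [clog (1 + z / (k + 1))] so that second differences in [z] can
    be summed. *)
Definition logG_term (z : C) (k : nat) : C :=
  (INR (S k) * (clog (z + INR (S k)) - ln (INR (S k)))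
   + z ^ 2 / (2 * INR (S k))%R - z)%C.

Definition logG_seq (z : C) (N : nat) : C :=
  (z / 2 * ln (2 * PI) - (z + z ^ 2 * (1 + euler_gamma)%R) / 2
   + Csum (logG_term z) N)%C.

Definition logG_lim (z : C) : C := Clim_seq (logG_seq z).

Lemma INR_S_pos k : 0 < INR (S k).
Proof. apply lt_0_INR; lia. Qed.

Lemma RtoC_INR_S_neq_0 k : RtoC (INR (S k)) <> 0.
Proof. apply RtoC_neq_0; generalize (INR_S_pos k); lra. Qed.

Lemma Re_1_plus_div_INR (z : C) k :
  0 < Re z -> 0 < Re (1 + z / INR (S k)).
Proof.
  intros Hz; assert (Hk := INR_S_pos k).
  rewrite Re_plus, re_RtoC; unfold Cdiv; rewrite <- RtoC_inv, re_scal_r by lra.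
  assert (0 < / INR (S k)) by now apply Rinv_0_lt_compat.
  nra.
Qed.

Lemma clog_plus_INR (z : C) k :
  0 < Re z ->
  clog (z + INR (S k)) = (ln (INR (S k)) + clog (1 + z / INR (S k)))%C.
Proof.
  intros Hz; assert (Hk := INR_S_pos k).
  assert (Hk0 : RtoC (INR (S k)) <> 0) by (apply RtoC_neq_0; lra).
  assert (E : (z + INR (S k) = INR (S k) * (1 + z / INR (S k)))%C)
    by (field; auto).
  assert (H0 : 0 < Re (z + INR (S k))) by (rewrite Re_plus, re_RtoC; lra).
  rewrite E, clog_mult, clog_RtoC; auto.
  - now apply Re_1_plus_div_INR.
  - now rewrite <- E.
Qed.

Lemma Cexp_logG_seq (z : C) N :
  0 < Re z ->
  Cexp (logG_seq z N) =
  (Cexp (z / 2 * ln (2 * PI))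
   * Cexp (- ((z + z ^ 2 * (1 + euler_gamma)%R) / 2))
   * Cprod (fun k =>
       (1 + z / INR k) ^ k * Cexp (z ^ 2 / (2 * INR k)%R - z)) N)%C.
Proof.
  intros Hz; unfold logG_seq; unfold Cminus at 1; rewrite !Cexp_plus.
  f_equal; induction N as [|N IH]; [apply Cexp_0|].
  change (Csum ?f (S N)) with (Csum f N + f N)%C; cbv beta.
  rewrite Cexp_plus, IH.
  change (Cprod ?f (S N)) with (Cprod f N * f (S N))%C; cbv beta.
  f_equal; unfold logG_term.
  unfold Cminus at 1; rewrite <- Cplus_assoc, Cexp_plus; f_equal.
  rewrite clog_plus_INR by auto.
  rewrite Cexp_INR_mult; f_equal.
  replace (_ - _)%C with (clog (1 + z / INR (S N)))%C by ring.
  now apply Cexp_clog, Re_1_plus_div_INR.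
Qed.

(** The convergence factors cancel the first two Taylor terms of [clog (1 + z / (k + 1))]; the
    third-order remainder loses one power to the weight [k + 1]. *)
Lemma logG_term_bound : exists K, 0 <= K /\ forall z k,
  0 < Re z -> 2 * Cmod z <= INR (S k) ->
  Cmod (logG_term z k) <= K * Cmod z ^ 3 * / INR (S k) ^ 2.
Proof.
  destruct clog_expansion_2 as [K [HK B]]; exists K; split; auto.
  intros z k Hz Hk; unfold logG_term; rewrite clog_plus_INR by auto.
  assert (HS := INR_S_pos k).
  assert (HS0 : RtoC (INR (S k)) <> 0) by (apply RtoC_neq_0; lra).
  set (u := (z / INR (S k))%C).
  assert (Eu : Cmod u = Cmod z / INR (S k))
    by (unfold u; rewrite Cmod_div, Cmod_INR; auto).
  assert (Hu : Cmod u <= / 2).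
  { rewrite Eu; apply Rmult_le_reg_r with (INR (S k)); auto.
    unfold Rdiv; rewrite Rmult_assoc, Rinv_l by lra; lra. }
  specialize (B u Hu).
  replace (_ + _ - z)%C
    with (INR (S k) * (clog (1 + u) - (u - u ^ 2 / 2)))%C.
  - rewrite Cmod_mult, Cmod_INR.
    apply Rle_trans with (INR (S k) * (K * Cmod u ^ 3)).
    + apply Rmult_le_compat_l; lra.
    + rewrite Eu; right; field; lra.
  - unfold u; rewrite RtoC_mult; field; auto.
Qed.

(** Telescoping, since [/ (x + 1) ^ 2 <= / x - / (x + 1)]. *)
Lemma Rsum_inv_sqr_tail N n : (1 <= N)%nat ->
  Rsum (fun k => / INR (S (N + k)) ^ 2) n <= / INR N - / INR (N + n).
Proof.
  intros HN; induction n.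
  - rewrite Nat.add_0_r; simpl; lra.
  - change (Rsum ?f (S n)) with (Rsum f n + f n); cbv beta.
    rewrite Nat.add_succ_r.
    assert (0 < INR (N + n)) by (apply lt_0_INR; lia).
    apply Rle_trans with (1 := Rplus_le_compat_r _ _ _ IHn).
    rewrite S_INR; set (x := INR (N + n)) in *.
    assert (/ (x + 1) ^ 2 <= / x - / (x + 1)); [|lra].
    replace (/ x - / (x + 1)) with (/ (x * (x + 1))) by (field; lra).
    apply Rinv_le_contravar; nra.
Qed.

Lemma Rsum_inv_sqr_tail_le N n : (1 <= N)%nat ->
  Rsum (fun k => / INR (S (N + k)) ^ 2) n <= / INR N.
Proof.
  intros HN; apply Rle_trans with (1 := Rsum_inv_sqr_tail N n HN).
  assert (0 < / INR (N + n)); [|lra].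
  apply Rinv_0_lt_compat, lt_0_INR; lia.
Qed.

Lemma logG_seq_cv (z : C) : 0 < Re z -> Ccv (logG_seq z) (logG_lim z).
Proof.
  intros Hz.
  destruct logG_term_bound as [K [HK B]].
  destruct (INR_large (2 * Cmod z + 1)) as [N0 HN0].
  assert (HN : (1 <= N0)%nat).
  { specialize (HN0 N0 (Nat.le_refl _)); generalize (Cmod_ge_0 z).
    intros; apply (INR_le 1); change (INR 1) with 1; lra. }
  assert (HKz : 0 <= K * Cmod z ^ 3)
    by (apply Rmult_le_pos; auto; apply pow_le, Cmod_ge_0).
  destruct (Csum_abs_cv (fun k => logG_term z (N0 + k))
    (fun k => K * Cmod z ^ 3 * / INR (S (N0 + k)) ^ 2)
    (K * Cmod z ^ 3 * / INR N0)) as [l Hl].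
  - intros k; apply B; auto.
    generalize (HN0 (S (N0 + k)) ltac:(lia)); lra.
  - intros n; rewrite Rsum_scal; apply Rmult_le_compat_l; auto.
    now apply Rsum_inv_sqr_tail_le.
  - set (c := (z / 2 * ln (2 * PI) - (z + z ^ 2 * (1 + euler_gamma)%R) / 2
               + Csum (logG_term z) N0)%C).
    assert (Hc : Ccv (logG_seq z) (c + l)).
    { apply Ccv_ext_loc with (fun N => c + Csum (fun k => logG_term z (N0 + k))
                                  (N - N0))%C N0.
      - intros N HNN; unfold logG_seq, c.
        replace N with (N0 + (N - N0))%nat at 2 by lia.
        rewrite Csum_shift; ring.
      - apply Ccv_plus; [apply Ccv_const|].
        unfold Ccv.
        apply (is_lim_seq_incr_n (fun n => Cmod (Csum (fun k =>
                  logG_term z (N0 + k)) (n - N0) - l)) N0).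
        apply (is_lim_seq_ext (fun n => Cmod (Csum (fun k =>
                  logG_term z (N0 + k)) n - l))); [|exact Hl].
        intros n; now replace (n + N0 - N0)%nat with n by lia. }
    unfold logG_lim; now rewrite (Clim_seq_unique _ _ Hc).
Qed.

(** [Clim_seq] means something only for a convergent sequence. The partial products inherit
    convergence from their logarithms once the nonzero prefactor is divided off. *)
Lemma Cexp_logG_lim (z : C) :
  0 < Re z -> Cexp (logG_lim z) = BarnesG (z + 1).
Proof.
  intros Hz; unfold BarnesG; cbv zeta.
  replace (z + 1 - 1)%C with z by ring.
  set (a := (Cexp (z / 2 * ln (2 * PI))
    * Cexp (- ((z + z ^ 2 * (1 + euler_gamma)%R) / 2)))%C).
  assert (Ha : a <> 0) by (apply Cmult_neq_0; apply Cexp_neq_0).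
  rewrite (Clim_seq_unique _ (/ a * Cexp (logG_lim z))%C).
  - field; auto.
  - apply Ccv_ext with (fun N => / a * Cexp (logG_seq z N))%C.
    + intros N; rewrite Cexp_logG_seq by auto; fold a; field; auto.
    + apply Ccv_scal, Cexp_cv, logG_seq_cv; auto.
Qed.

Lemma logG_seq_tail : exists K, 0 <= K /\ forall z N,
  0 < Re z -> 2 * Cmod z <= INR N -> (1 <= N)%nat ->
  Cmod (logG_lim z - logG_seq z N) <= K * Cmod z ^ 3 * / INR N.
Proof.
  destruct logG_term_bound as [K [HK B]]; exists K; split; auto.
  intros z N Hz HzN HN.
  set (c := (z / 2 * ln (2 * PI)
             - (z + z ^ 2 * (1 + euler_gamma)%R) / 2)%C).
  replace (logG_lim z - logG_seq z N)%C
    with ((logG_lim z - c) - Csum (logG_term z) N)%C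
    by (unfold logG_seq, c; ring).
  apply (Csum_tail_le _ _ (fun k => K * Cmod z ^ 3 * / INR (S k) ^ 2)).
  - apply Ccv_ext with (fun N => logG_seq z N - c)%C.
    + intros; unfold logG_seq, c; ring.
    + apply Ccv_minus; [now apply logG_seq_cv|apply Ccv_const].
  - intros k Hk; apply B; auto.
    apply Rle_trans with (1 := HzN), le_INR; lia.
  - intros n; rewrite Rsum_scal; apply Rmult_le_compat_l.
    + apply Rmult_le_pos; auto; apply pow_le, Cmod_ge_0.
    + now apply Rsum_inv_sqr_tail_le.
Qed.

Lemma ccont_logG_seq (z : C) N : 0 < Re z -> ccont (fun z => logG_seq z N) z.
Proof.
  intros Hz; unfold logG_seq, logG_term.
  apply (ccont_ext (fun z => (ln (2 * PI) / 2 + - (/ 2)) * z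
    + - ((1 + euler_gamma)%R / 2) * z ^ 2
    + Csum (fun k => (INR (S k) * clog (z + INR (S k))
        + - (INR (S k) * ln (INR (S k))))
        + (/ (2 * INR (S k))%R * z ^ 2 + - (1) * z)) N)%C).
  - intros w; f_equal; [field|].
    apply Csum_ext; intros k _.
    assert (HS := INR_S_pos k).
    field; apply RtoC_neq_0; lra.
  - apply ccont_plus; [apply ccont_plus; apply ccont_scal|].
    + apply ccont_id.
    + apply ccont_sqr.
    + apply (ccont_Csum (fun k z => (INR (S k) * clog (z + INR (S k))
        + - (INR (S k) * ln (INR (S k))))
        + (/ (2 * INR (S k))%R * z ^ 2 + - (1) * z))%C).
      intros k; apply ccont_plus; apply ccont_plus.
      * apply ccont_scal.
        intros eps He.
        destruct (ccont_clog (z + INR (S k))) with (eps := eps)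
          as [d [Hd H]]; auto.
        { rewrite Re_plus, re_RtoC; generalize (pos_INR (S k)); lra. }
        exists d; split; auto; intros w Hw; apply H.
        replace (w + INR (S k) - (z + INR (S k)))%C with (w - z)%C by ring.
        auto.
      * apply ccont_const.
      * apply ccont_scal, ccont_sqr.
      * apply ccont_scal, ccont_id.
Qed.

(** By [logG_seq_tail] the convergence is uniform on bounded parts of the half-plane, so continuity
    passes from the partial sums to the limit. *)
Lemma ccont_logG_lim (z : C) : 0 < Re z -> ccont logG_lim z.
Proof.
  intros Hz eps He.
  destruct logG_seq_tail as [K [HK B]].
  set (R0 := Cmod z + 1).
  assert (HR0 : 0 < R0) by (unfold R0; generalize (Cmod_ge_0 z); lra).
  (* The three summands ensure in turn that [logG_seq_tail] applies whenever [Cmod w <= R0], that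
     [N >= 1], and that the tail is at most [eps / 4]. *)
  destruct (INR_large (2 * R0 + 1 + 4 * (K * R0 ^ 3) / eps)) as [N HN].
  specialize (HN N (Nat.le_refl _)).
  assert (HKR : 0 <= K * R0 ^ 3) by (apply Rmult_le_pos; auto;
    apply pow_le; lra).
  assert (0 <= 4 * (K * R0 ^ 3) / eps).
  { apply Rdiv_le_0_compat; lra. }
  assert (HN1 : (1 <= N)%nat) by (apply (INR_le 1); change (INR 1) with 1; lra).
  assert (HNp : 0 < INR N) by lra.
  assert (Ht : forall w, 0 < Re w -> Cmod w <= R0 ->
             Cmod (logG_lim w - logG_seq w N) <= eps / 4).
  { intros w Hw HwR; apply Rle_trans with (1 := B w N Hw ltac:(lra) HN1).
    apply Rle_trans with (K * R0 ^ 3 * / INR N).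
    - apply Rmult_le_compat_r; [left; now apply Rinv_0_lt_compat|].
      apply Rmult_le_compat_l; auto; apply pow_incr; split; auto.
      apply Cmod_ge_0.
    - apply Rmult_le_reg_r with (INR N); auto.
      rewrite Rmult_assoc, Rinv_l, Rmult_1_r by lra.
      assert (4 * (K * R0 ^ 3) / eps <= INR N) by lra.
      apply Rmult_le_compat_r with (r := eps) in H0; [|lra].
      unfold Rdiv in H0; rewrite Rmult_assoc, Rinv_l in H0; lra. }
  destruct (ccont_logG_seq z N Hz (eps / 4)) as [d [Hd Hc]]; [lra|].
  exists (Rmin d (Rmin 1 (Re z))); split.
  { repeat apply Rmin_pos; lra. }
  intros w Hw.
  apply Rmin_Rgt_l in Hw; destruct Hw as [H1 Hw].
  apply Rmin_Rgt_l in Hw; destruct Hw as [H2 H3].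
  apply Re_near in H3.
  assert (Cmod w <= R0) by (generalize (Cmod_minus_ge w z); unfold R0; lra).
  replace (logG_lim w - logG_lim z)%C
    with ((logG_lim w - logG_seq w N)
          + ((logG_seq w N - logG_seq z N)
             + - (logG_lim z - logG_seq z N)))%C by ring.
  assert (Cmod z <= R0) by (unfold R0; lra).
  generalize (Ht w ltac:(lra) H0) (Ht z Hz H4) (Hc w H1); intros T1 T2 T3.
  apply Rle_lt_trans with (1 := Cmod_triangle _ _).
  apply Rle_lt_trans with (eps / 4 + (eps / 4 + eps / 4)); [|lra].
  apply Rplus_le_compat; auto.
  apply Rle_trans with (1 := Cmod_triangle _ _).
  rewrite Cmod_opp; lra.
Qed.

Lemma Im_logG_lim_1 : Im (logG_lim 1) = 0.
Proof.
  assert (H := Ccv_Im _ _ (logG_seq_cv 1 ltac:(simpl; lra))).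
  assert (H0 : is_lim_seq (fun n => Im (logG_seq 1 n)) 0).
  { apply (is_lim_seq_ext (fun _ => 0)); [|apply is_lim_seq_const].
    intros n; unfold logG_seq.
    rewrite (Csum_ext _ (fun k => RtoC (INR (S k) *
        (ln (1 + INR (S k)) - ln (INR (S k)))
        + / (2 * INR (S k)) - 1))).
    - rewrite Csum_RtoC; unfold Im; simpl; field.
    - intros k _; unfold logG_term.
      rewrite <- RtoC_plus, clog_RtoC by (generalize (INR_S_pos k); lra).
      assert (HS := INR_S_pos k).
      rewrite !RtoC_minus, !RtoC_plus, !RtoC_mult, !RtoC_minus, RtoC_inv,
        RtoC_mult by lra.
      field; apply RtoC_neq_0; lra. }
  apply is_lim_seq_unique in H; apply is_lim_seq_unique in H0.
  rewrite H in H0; now injection H0.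
Qed.

(** * The remainder estimate *)

(** An exact identity for every [d]: the affine part of [asymp] has zero second difference, so each
    logarithm is a defect plus a second difference of [asymp]. The linear coefficient is chosen to
    match the prefactor [z / 2 * ln (2 * PI)]. *)
Lemma logG_seq_decomp (d : C) n (z : C) N :
  logG_seq z N =
  (asymp (ln (2 * PI) / 2) d n z
   + Csum (fun k => INR (S k) * barnes_defect n (z + INR (S k))) N
   + telescope_rest (ln (2 * PI) / 2) d n z N)%C.
Proof.
  set (c := (ln (2 * PI) / 2)%C).
  set (a := fun k => asymp c d n (z + INR k)).
  assert (E1 : Csum (logG_term z) N =
    (Csum (fun k => INR (S k) * clog (z + INR (S k))) N - sum_k_ln N
     + z ^ 2 / 2 * harmonic N - INR N * z)%C).
  { unfold sum_k_ln, harmonic.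
    induction N as [|N IH]; [simpl; ring|].
    change (Csum ?f (S N)) with (Csum f N + f N)%C; cbv beta.
    change (Rsum ?f (S N)) with (Rsum f N + f N); cbv beta.
    rewrite IH; unfold logG_term.
    assert (HS := INR_S_pos N).
    rewrite !RtoC_plus, !RtoC_mult, RtoC_inv by lra.
    rewrite S_INR in *.
    rewrite !RtoC_plus; field.
    apply Cneq_0_Re; rewrite ?Re_plus, !re_RtoC; lra. }
  assert (E2 : Csum (fun k => INR (S k) * clog (z + INR (S k)))%C N =
    (Csum (fun k => INR (S k) * barnes_defect n (z + INR (S k))) N
     + (INR N * a (S N) - (INR N + 1) * a N + a 0%nat))%C).
  { rewrite <- Csum_second_diff, <- Csum_plus; apply Csum_ext; intros k _.
    unfold barnes_defect, a, asymp.
    replace (z + INR (S (S k)))%C with (z + INR (S k) + 1)%C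
      by (rewrite (S_INR (S k)), RtoC_plus; ring).
    replace (z + INR k)%C with (z + INR (S k) - 1)%C
      by (rewrite (S_INR k), RtoC_plus; ring).
    ring. }
  unfold logG_seq; rewrite E1, E2; unfold telescope_rest.
  unfold a; simpl (INR 0); replace (z + 0)%C with z by ring.
  unfold c; field.
Qed.

(** With [s = r ^ 2] and [y = k + 1], the numbers [s + y ^ 2 - y] and [s + y ^ 2 + y] differ by
    [2 * y], and their product is at most [(s + y ^ 2) ^ 2]. So each term is at most half a
    difference of reciprocals, and these differences telescope. *)
Lemma Rsum_cubic_tail (r : R) N : 0 < r ->
  Rsum (fun k => INR (S k) / (r ^ 2 + INR (S k) ^ 2) ^ 2) N
  <= / 2 * (/ r ^ 2 - / (r ^ 2 + INR N * (INR N + 1))).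
Proof.
  intros Hr; induction N as [|N IH].
  - simpl; rewrite Rmult_0_l, Rplus_0_r; lra.
  - change (Rsum ?f (S N)) with (Rsum f N + f N); cbv beta.
    apply Rle_trans with (1 := Rplus_le_compat_r _ _ _ IH).
    rewrite S_INR; set (x := INR N).
    assert (Hx : 0 <= x) by apply pos_INR.
    assert (Hr2 : 0 < r ^ 2) by nra.
    set (s := r ^ 2) in *.
    assert ((x + 1) / (s + (x + 1) ^ 2) ^ 2
      <= / 2 * (/ (s + x * (x + 1)) - / (s + (x + 1) * (x + 1 + 1)))).
    { replace (/ 2 * _) with
        ((x + 1) * / ((s + x * (x + 1)) * (s + (x + 1) * (x + 1 + 1))))
        by (field; split; nra).
      apply Rmult_le_compat_l; [lra|].
      apply Rinv_le_contravar; [|nra].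
      apply Rmult_lt_0_compat; nra. }
    lra.
Qed.

Lemma logG_lim_asymp (d : C) n :
  is_lim_seq (fun N => harmonic N - ln (INR N)) euler_gamma ->
  Ccv (fun N => RtoC (sum_k_ln N
         - (INR N ^ 2 / 2 + INR N / 2 + / 12) * ln (INR N) + INR N ^ 2 / 4))
      (/ 12 - d) ->
  exists K, forall z, 0 < Re z -> 2 < Cmod z ->
    Cmod (logG_lim z - asymp (ln (2 * PI) / 2) d n z)
    <= K / Cmod z ^ (2 * n + 2).
Proof.
  intros Hgamma Hglaisher.
  destruct (barnes_defect_bound n) as [K [HK B]].
  exists (K / 2); intros z Hz Hm.
  set (r := Cmod z) in *.
  apply (Csum_lim_le (fun k => INR (S k) * barnes_defect n (z + INR (S k)))%C
           _ (fun k => K / r ^ (2 * n)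
                       * (INR (S k) / (r ^ 2 + INR (S k) ^ 2) ^ 2))).
  - apply Ccv_ext with (fun N => logG_seq z N
        - asymp (ln (2 * PI) / 2) d n z
        - telescope_rest (ln (2 * PI) / 2) d n z N)%C.
    + intros N; rewrite (logG_seq_decomp d n); ring.
    + eapply Ccv_eq; [|apply Ccv_minus; [apply Ccv_minus|]].
      2: now apply logG_seq_cv.
      2: apply Ccv_const.
      2: now apply telescope_rest_cv.
      ring.
  - intros k; rewrite Cmod_mult, Cmod_INR.
    set (x := INR (S k)).
    assert (Hx : 1 <= x) by (apply (le_INR 1); lia).
    (* The cross term [2 * x * Re z] is positive, so the estimate is uniform up to the imaginary
       axis. *)
    assert (E : r ^ 2 + x ^ 2 <= Cmod (z + x) ^ 2).
    { unfold r; rewrite !Cmod2_alt, Re_plus, Im_plus, re_RtoC, im_RtoC; nra. }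
    assert (Hr : r <= Cmod (z + x)).
    { apply Rsqr_incr_0_var; [unfold Rsqr; nra|apply Cmod_ge_0]. }
    assert (Hb := B (z + x)%C ltac:(rewrite Re_plus, re_RtoC; lra)
                    ltac:(lra)).
    assert (Hrp : 0 < r ^ (2 * n)) by (apply pow_lt; lra).
    assert (Hsp : 0 < r ^ 2 + x ^ 2) by nra.
    replace (K / r ^ (2 * n) * (x / (r ^ 2 + x ^ 2) ^ 2))
      with (x * (K * / (r ^ (2 * n) * (r ^ 2 + x ^ 2) ^ 2)))
      by (field; split; nra).
    apply Rmult_le_compat_l; [lra|].
    apply Rle_trans with (1 := Hb).
    apply Rmult_le_compat_l; auto.
    apply Rinv_le_contravar.
    + apply Rmult_lt_0_compat; auto; apply pow_lt; auto.
    (* Of the [2 * n + 4] powers, [2 * n] are bounded below by powers of [r] and the other four make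
       the weighted sum converge. *)
    + rewrite pow_add; apply Rmult_le_compat.
      * lra.
      * apply pow_le; lra.
      * apply pow_incr; lra.
      * replace 4%nat with (2 * 2)%nat by lia; rewrite pow_mult.
        apply pow_incr; lra.
  - intros N; rewrite Rsum_scal.
    assert (Hrp : 0 < r ^ (2 * n)) by (apply pow_lt; lra).
    replace (K / 2 / r ^ (2 * n + 2))
      with (K / r ^ (2 * n) * (/ 2 * / r ^ 2))
      by (rewrite (pow_add r (2 * n)); field; split; lra).
    apply Rmult_le_compat_l.
    { apply Rdiv_le_0_compat; auto. }
    apply Rle_trans with (1 := Rsum_cubic_tail r N ltac:(lra)).
    apply Rmult_le_compat_l; [lra|].
    assert (0 < / (r ^ 2 + INR N * (INR N + 1))); [|lra].
    apply Rinv_0_lt_compat; generalize (pos_INR N); nra.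
Qed.

(** * Complex power series *)

Definition CPS (a : nat -> C) (h l : C) : Prop :=
  Ccv (Csum (fun k => a k * h ^ k)%C) l.

Lemma is_series_Ccv (f : nat -> C) (l : C) :
  @is_series C_AbsRing C_NormedModule f l -> Ccv (Csum f) l.
Proof.
  intros H.
  assert (HS : forall n, sum_n f n = Csum f (S n)).
  { induction n as [|n IH].
    - rewrite sum_O; simpl; ring.
    - rewrite sum_Sn, IH; reflexivity. }
  apply (is_lim_seq_incr_1 (fun n => Cmod (Csum f n - l))).
  apply is_lim_seq_spec; intros eps.
  (* Balls in [C] are boxes, so [eps / 2] for each component gives [eps] for the modulus. The
     partial sum [sum_n f n] includes the index [n], hence the shift to [Csum f (S n)]. *)
  assert (He : 0 < eps / 2) by (generalize (cond_pos eps); lra).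
  assert (H1 := proj1 (filterlim_locally _ _) H (mkposreal _ He)).
  destruct H1 as [N HN]; exists N; intros n Hn.
  specialize (HN n Hn); rewrite HS in HN; destruct HN as [A B].
  change (Rabs (Re (Csum f (S n) - l)) < eps / 2) in A.
  change (Rabs (Im (Csum f (S n) - l)) < eps / 2) in B.
  rewrite Rminus_0_r, Rabs_pos_eq by apply Cmod_ge_0.
  apply Rle_lt_trans with (1 := Cmod_le_Re_Im _); lra.
Qed.

Lemma pow_n_Cpow (x : C) k : @pow_n C_Ring x k = (x ^ k)%C.
Proof. induction k; simpl; auto; rewrite <- IHk; reflexivity. Qed.

Lemma is_pseries_CPS (a : nat -> C) (h l : C) :
  @is_pseries C_AbsRing C_NormedModule a h l -> CPS a h l.
Proof.
  intros H; unfold CPS.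
  apply is_series_Ccv in H.
  eapply Ccv_ext; [|exact H]; intros n; apply Csum_ext; intros k _.
  change (@pow_n C_Ring h k * a k = a k * h ^ k)%C.
  rewrite pow_n_Cpow; ring.
Qed.

Definition analytic_near (f : C -> C) (z0 : C) : Prop :=
  exists (a : nat -> C) (r : R), 0 < r /\
    forall h, Cmod h < r -> CPS a h (f (z0 + h)%C).

Lemma analytic_at_near (f : C -> C) (z0 : C) :
  analytic_at f z0 -> analytic_near f z0.
Proof.
  intros [a [r [Hr H]]]; exists a, r; split; auto; intros h Hh.
  replace h with (z0 + h - z0)%C at 1 by ring.
  apply is_pseries_CPS, H.
  replace (z0 + h - z0)%C with h by ring; auto.
Qed.

Lemma CPS_plus a b h l m :
  CPS a h l -> CPS b h m -> CPS (fun k => a k + b k)%C h (l + m)%C.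
Proof.
  intros H H'; unfold CPS.
  eapply Ccv_ext; [|exact (Ccv_plus _ _ _ _ H H')].
  intros n; simpl; rewrite <- Csum_plus; apply Csum_ext; intros; ring.
Qed.

Lemma CPS_scal c a h l : CPS a h l -> CPS (fun k => c * a k)%C h (c * l)%C.
Proof.
  intros H; unfold CPS.
  eapply Ccv_ext; [|exact (Ccv_scal c _ _ H)].
  intros n; simpl; rewrite <- Csum_scal; apply Csum_ext; intros; ring.
Qed.

Definition Ccoef_shift (a : nat -> C) (k : nat) : C :=
  match k with O => 0 | S j => a j end.

Lemma CPS_mult_arg a h l : CPS a h l -> CPS (Ccoef_shift a) h (h * l)%C.
Proof.
  intros H; unfold CPS.
  apply (is_lim_seq_incr_1 (fun n => Cmod (Csum _ n - h * l))).
  apply (is_lim_seq_ext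
    (fun n => Cmod (h * Csum (fun k => a k * h ^ k) n - h * l)%C)).
  - intros n; do 2 f_equal; rewrite Csum_S_l; simpl Ccoef_shift.
    rewrite <- Csum_scal, Cmult_0_l, Cplus_0_l.
    apply Csum_ext; intros; rewrite Cpow_S; ring.
  - apply (Ccv_scal h _ _ H).
Qed.

Lemma CPS_ext a b h l : (forall k, a k = b k) -> CPS a h l -> CPS b h l.
Proof.
  intros E; apply Ccv_ext; intros n; apply Csum_ext; intros; now rewrite E.
Qed.

Lemma CPS_const c h : CPS (fun k => match k with O => c | _ => 0 end)%C h c.
Proof.
  apply Ccv_ext_loc with (fun _ => c) 1%nat; [|apply Ccv_const].
  intros [|n] Hn; [lia|]; rewrite Csum_S_l; simpl.
  rewrite Csum_0 by (intros; ring); ring.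
Qed.

Lemma Rsum_geom_le q n : 0 <= q < 1 -> Rsum (fun k => q ^ k) n <= / (1 - q).
Proof.
  intros Hq.
  assert (E : (1 - q) * Rsum (fun k => q ^ k) n = 1 - q ^ n).
  { induction n; simpl; [ring|].
    rewrite Rmult_plus_distr_l, IHn; ring. }
  apply Rmult_le_reg_l with (1 - q); [lra|].
  rewrite E, Rinv_r by lra.
  generalize (pow_le q n (proj1 Hq)); lra.
Qed.

Lemma CPS_tail_le a h l rho M q N :
  CPS a h l -> 0 < rho -> (forall k, Cmod (a k) * rho ^ k <= M) ->
  0 <= q < 1 -> Cmod h <= q * rho ->
  Cmod (l - Csum (fun k => a k * h ^ k)%C N) <= M * q ^ N / (1 - q).
Proof.
  intros H Hrho HM Hq Hh.
  assert (HM0 : 0 <= M).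
  { apply Rle_trans with (2 := HM 0%nat), Rmult_le_pos; simpl; [|lra].
    apply Cmod_ge_0. }
  apply (Csum_tail_le _ _ (fun k => M * q ^ k)); auto.
  - intros k _; rewrite Cmod_mult, Cmod_pow.
    apply Rle_trans with (Cmod (a k) * (q * rho) ^ k).
    + apply Rmult_le_compat_l; [apply Cmod_ge_0|].
      apply pow_incr; split; [apply Cmod_ge_0|auto].
    + rewrite Rpow_mult_distr.
      replace (Cmod (a k) * (q ^ k * rho ^ k))
        with (Cmod (a k) * rho ^ k * q ^ k) by ring.
      apply Rmult_le_compat_r; auto; apply pow_le; lra.
  - intros n.
    rewrite (Rsum_ext _ (fun k => M * q ^ N * q ^ k))
      by (intros; rewrite pow_add; ring).
    rewrite Rsum_scal; apply Rmult_le_compat_l.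
    + apply Rmult_le_pos; auto; apply pow_le; lra.
    + now apply Rsum_geom_le.
Qed.

Lemma CPS_coef_bound a (rho : R) l :
  0 <= rho -> CPS a rho l ->
  exists M, 0 < M /\ forall k, Cmod (a k) * rho ^ k <= M.
Proof.
  intros Hrho H; apply Csum_cv_term, Ccv_bounded in H.
  destruct H as [M [HM B]]; exists M; split; auto; intros k.
  generalize (B k); rewrite Cmod_mult, Cmod_pow, Cmod_R, Rabs_pos_eq; auto.
Qed.

(** Convergence at the single point [r / 2] bounds the coefficients, and for [Cmod h <= r / 4] the
    tail is dominated by a geometric series of ratio at most [/ 2]. The radius [rho] does not depend
    on the order [N]. *)
Lemma CPS_remainder a (F : C -> C) r :
  0 < r -> (forall h, Cmod h < r -> CPS a h (F h)) ->
  exists rho, 0 < rho < r /\ forall N, exists K, 0 <= K /\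
    forall h, Cmod h <= rho ->
      Cmod (F h - Csum (fun k => a k * h ^ k)%C N) <= K * Cmod h ^ N.
Proof.
  intros Hr H.
  assert (Hr2 : Cmod (r / 2)%R < r) by (rewrite Cmod_R, Rabs_pos_eq; lra).
  destruct (CPS_coef_bound a (r / 2) _ ltac:(lra) (H _ Hr2)) as [M [HM B]].
  exists (r / 4); split; [lra|]; intros N.
  exists (2 * M / (r / 2) ^ N); split.
  { apply Rdiv_le_0_compat; [lra|apply pow_lt; lra]. }
  intros h Hh.
  set (q := Cmod h / (r / 2)).
  assert (Hq : 0 <= q <= / 2).
  { unfold q; split; [apply Rdiv_le_0_compat; [apply Cmod_ge_0|lra]|].
    apply Rmult_le_reg_r with (r / 2); [lra|].
    unfold Rdiv at 1; rewrite Rmult_assoc, Rinv_l by lra; lra. }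
  apply Rle_trans with (M * q ^ N / (1 - q)).
  - apply CPS_tail_le with (r / 2); auto; try lra.
    + apply H; lra.
    + unfold q; right; field; lra.
  - assert (0 <= M * q ^ N) by (apply Rmult_le_pos; [lra|apply pow_le; lra]).
    apply Rle_trans with (M * q ^ N * 2).
    + apply Rmult_le_compat_l; auto.
      replace 2 with (/ / 2) by field; apply Rinv_le_contravar; lra.
    + unfold q, Rdiv at 1; rewrite Rpow_mult_distr, pow_inv.
      right; unfold Rdiv; ring.
Qed.

Lemma analytic_near_mult_1_minus (f : C -> C) z0 :
  analytic_near f z0 -> analytic_near (fun s => (1 - s) * f s)%C z0.
Proof.
  intros [a [r [Hr H]]].
  exists (fun k => (1 - z0) * a k + - (1) * Ccoef_shift a k)%C, r.
  split; auto; intros h Hh.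
  replace ((1 - (z0 + h)) * f (z0 + h))%C
    with ((1 - z0) * f (z0 + h) + - (1) * (h * f (z0 + h)))%C by ring.
  apply CPS_plus; apply CPS_scal; [|apply CPS_mult_arg]; auto.
Qed.

Lemma analytic_near_minus (f g : C -> C) z0 :
  analytic_near f z0 -> analytic_near g z0 ->
  analytic_near (fun s => f s - g s)%C z0.
Proof.
  intros [a [r [Hr H]]] [b [r' [Hr' H']]].
  exists (fun k => a k + - (1) * b k)%C, (Rmin r r').
  split; [now apply Rmin_pos|]; intros h Hh.
  replace (f (z0 + h) - g (z0 + h))%C
    with (f (z0 + h) + - (1) * g (z0 + h))%C by ring.
  apply CPS_plus; [|apply CPS_scal].
  - now apply H, (Rmin_Rgt_l r r').
  - now apply H', (Rmin_Rgt_l r r').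
Qed.

Lemma Csum_first_nonzero (f : nat -> C) k :
  (forall j, (j < k)%nat -> f j = 0) -> Csum f (S k) = f k.
Proof.
  intros H; change (Csum f k + f k = f k)%C.
  rewrite Csum_0 by auto; ring.
Qed.

(** If [a k] were the first nonzero coefficient, the term [a k * h ^ k] would dominate near 0, where
    [F] nevertheless has zeros arbitrarily close to 0. *)
Lemma CPS_zero_coefs a (F : C -> C) r :
  0 < r -> (forall h, Cmod h < r -> CPS a h (F h)) ->
  (forall eps, 0 < eps -> exists h, 0 < Cmod h < eps /\ F h = 0) ->
  forall k, a k = 0.
Proof.
  intros Hr H Hz k.
  destruct (CPS_remainder a F r Hr H) as [rho [Hrho HK]].
  induction k as [k IH] using Wf_nat.lt_wf_ind.
  apply Cmod_eq_0, Rle_antisym; [|apply Cmod_ge_0].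
  apply Rnot_lt_le; intros Hk.
  destruct (HK (S k)) as [K [HK0 B]].
  (* This radius makes [K * Cmod h] smaller than [Cmod (a k)]. *)
  destruct (Hz (Rmin rho (Cmod (a k) / (K + 1)))) as [h [[Hh1 Hh2] Hh3]].
  { apply Rmin_pos; [lra|]; apply Rdiv_lt_0_compat; lra. }
  apply Rmin_Rgt_l in Hh2; destruct Hh2 as [Hh4 Hh5].
  specialize (B h ltac:(lra)).
  rewrite Hh3, Csum_first_nonzero in B
    by (intros; rewrite IH by auto; ring).
  replace (0 - a k * h ^ k)%C with (- (a k * h ^ k))%C in B by ring.
  rewrite Cmod_opp, Cmod_mult, Cmod_pow in B; simpl pow in B.
  assert (Hp : 0 < Cmod h ^ k) by (apply pow_lt; auto).
  assert (Cmod (a k) <= K * Cmod h).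
  { apply Rmult_le_reg_r with (Cmod h ^ k); auto; lra. }
  apply Rmult_lt_compat_r with (r := K + 1) in Hh5; [|lra].
  unfold Rdiv in Hh5; rewrite Rmult_assoc, Rinv_l in Hh5; lra.
Qed.

Lemma CPS_zero h l : CPS (fun _ => RtoC 0) h l -> l = 0.
Proof.
  intros H; apply (Ccv_unique _ _ _ H).
  apply Ccv_ext with (fun _ => RtoC 0); [|apply Ccv_const].
  intros n; now rewrite Csum_0 by (intros; ring).
Qed.

Lemma analytic_near_zero (d : C -> C) z0 :
  analytic_near d z0 ->
  (forall eps, 0 < eps -> exists h, 0 < Cmod h < eps /\ d (z0 + h)%C = 0) ->
  exists r, 0 < r /\ forall h, Cmod h < r -> d (z0 + h)%C = 0.
Proof.
  intros [a [r [Hr H]]] Hz; exists r; split; auto; intros h Hh.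
  apply (CPS_zero h).
  apply CPS_ext with a; [|auto].
  apply (CPS_zero_coefs a (fun h => d (z0 + h)%C) r); auto.
Qed.

(** Let [T] be the supremum of the parameters up to which [d] vanishes. Zeros accumulate at [T], or
    [T = 0] and the hypothesis at [p] applies; so [d] vanishes on a disc around that point, and this
    pushes [T] up to 1. *)
Lemma identity_on_segment (d : C -> C) (p q : C) :
  p <> q ->
  (forall t, 0 <= t <= 1 -> analytic_near d (p + t * (q - p))) ->
  (exists r, 0 < r /\ forall h, Cmod h < r -> d (p + h)%C = 0) ->
  exists r, 0 < r /\ forall h, Cmod h < r -> d (q + h)%C = 0.
Proof.
  intros Hpq Ha [r0 [Hr0 H0]].
  set (m := Cmod (q - p)).
  assert (Hm : 0 < m) by (apply Cmod_gt_0; intros E; apply Hpq;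
    symmetry; now apply Ceq_minus).
  set (g := fun t : R => (p + t * (q - p))%C).
  assert (Hd : forall s t, (g t + (g s - g t))%C = g s) by (intros; ring).
  assert (Hg : forall s t, Cmod (g s - g t) = Rabs (s - t) * m).
  { intros s t; unfold g, m.
    replace (_ - _)%C with (RtoC (s - t) * (q - p))%C
      by (rewrite RtoC_minus; ring).
    now rewrite Cmod_mult, Cmod_R. }
  set (E := fun t => 0 <= t <= 1 /\ forall s, 0 <= s <= t -> d (g s) = 0).
  assert (HE0 : E 0).
  { split; [lra|]; intros s Hs; replace s with 0 by lra.
    unfold g; apply H0.
    replace (0 * (q - p))%C with (RtoC 0) by ring; now rewrite Cmod_0. }
  destruct (completeness E) as [T [HT1 HT2]].
  { exists 1; intros t [Ht _]; lra. }
  { now exists 0. }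
  assert (HT : 0 <= T <= 1).
  { split; [now apply HT1|apply HT2; intros t [Ht _]; lra]. }
  assert (Hbelow : forall s, 0 <= s < T -> d (g s) = 0).
  { intros s Hs.
    destruct (Classical_Prop.classic (exists t, E t /\ s < t))
      as [[t [[Ht Hz] Hst]]|Hn].
    - apply Hz; lra.
    - exfalso; apply (Rlt_irrefl T), Rle_lt_trans with s; [|lra].
      apply HT2; intros t Ht; apply Rnot_lt_le; intros Hst; apply Hn.
      now exists t. }
  assert (Hzero : exists r, 0 < r /\ forall h, Cmod h < r -> d (g T + h)%C = 0).
  { destruct (Rle_lt_dec T 0) as [HT0|HT0].
    - exists r0; split; auto; intros h Hh.
      replace (g T + h)%C with (p + h)%C; auto.
      unfold g; replace T with 0 by lra; ring.
    - apply analytic_near_zero; [now apply Ha|]; intros eps Heps.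
      set (s := Rmax 0 (T - eps / (2 * m))).
      assert (0 < eps / (2 * m)) by (apply Rdiv_lt_0_compat; lra).
      assert (Hs : 0 <= s < T).
      { unfold s; split; [apply Rmax_l|apply Rmax_lub_lt; lra]. }
      exists (g s - g T)%C; split.
      + rewrite Hg, Rabs_left by lra; split; [nra|].
        assert (T - eps / (2 * m) <= s) by apply Rmax_r.
        apply Rle_lt_trans with (eps / (2 * m) * m).
        * apply Rmult_le_compat_r; lra.
        * replace (eps / (2 * m) * m) with (eps / 2) by (field; lra); lra.
      + rewrite Hd; auto. }
  destruct Hzero as [r [Hr Hz]].
  assert (HT1' : T = 1).
  { apply Rle_antisym; [lra|]; apply Rnot_lt_le; intros HTl.
    set (t := Rmin 1 (T + r / (2 * m))).
    assert (0 < r / (2 * m)) by (apply Rdiv_lt_0_compat; lra).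
    assert (Ht : T < t <= 1).
    { unfold t; split; [apply Rmin_glb_lt; lra|apply Rmin_l]. }
    assert (HEt : E t).
    { split; [lra|]; intros s Hs.
      destruct (Rlt_le_dec s T) as [Hs'|Hs']; [apply Hbelow; lra|].
      rewrite <- (Hd s T); apply Hz; rewrite Hg, Rabs_pos_eq by lra.
      assert (t <= T + r / (2 * m)) by apply Rmin_r.
      apply Rle_lt_trans with (r / (2 * m) * m).
      - apply Rmult_le_compat_r; lra.
      - replace (r / (2 * m) * m) with (r / 2) by (field; lra); lra. }
    generalize (HT1 t HEt); lra. }
  exists r; split; auto; intros h Hh.
  replace (q + h)%C with (g T + h)%C; auto.
  unfold g; rewrite HT1'; ring.
Qed.

(** * Cauchy's estimate and Weierstrass' theorem *)

Definition cis (t : R) : C := Cexp (0, t).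

Lemma Cmod_cis t : Cmod (cis t) = 1.
Proof. unfold cis; rewrite Cmod_Cexp; apply exp_0. Qed.

Lemma cis_plus s t : cis (s + t) = (cis s * cis t)%C.
Proof.
  unfold cis; rewrite <- Cexp_plus; f_equal; apply C_eq; simpl; ring.
Qed.

Lemma cis_pow t n : (cis t ^ n)%C = cis (INR n * t).
Proof.
  unfold cis; rewrite <- Cexp_INR_mult; f_equal; apply C_eq; simpl; ring.
Qed.

Lemma cis_2PI : cis (2 * PI) = 1.
Proof.
  unfold cis, Cexp; simpl.
  rewrite exp_0, cos_2PI, sin_2PI; apply C_eq; simpl; ring.
Qed.

Lemma cis_opp t : (cis t * cis (- t))%C = 1.
Proof.
  rewrite <- cis_plus; replace (t + - t) with 0 by ring; apply Cexp_0.
Qed.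

Lemma roots_of_unity_sum N (m k : nat) :
  (m < N)%nat -> (k < N)%nat ->
  Csum (fun j => cis (INR j * ((INR m - INR k) * (2 * PI / INR N)))) N
  = if (m =? k)%nat then RtoC (INR N) else 0.
Proof.
  intros Hm Hk.
  assert (HN : 0 < INR N) by (apply lt_0_INR; lia).
  assert (HP := PI_RGT_0).
  destruct (Nat.eqb_spec m k) as [->|Hmk].
  - rewrite (Csum_ext _ (fun _ => RtoC 1)).
    + clear; induction N; [reflexivity|].
      change (Csum (fun _ => RtoC 1) N + 1 = INR (S N))%C.
      rewrite IHN, S_INR, RtoC_plus; auto.
    + intros j _; replace (INR j * _) with 0 by ring; apply Cexp_0.
  - set (t := (INR m - INR k) * (2 * PI / INR N)).
    rewrite (Csum_ext _ (fun j => cis t ^ j)%C)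
      by (intros; now rewrite cis_pow).
    assert (H1 : cis t <> 1).
    { intros E; assert (Et : ((0, t) : C) = 0).
      { apply Cexp_inj.
        - simpl; unfold t; rewrite Rminus_0_r, Rabs_mult.
          rewrite (Rabs_pos_eq (2 * PI / INR N))
            by (apply Rdiv_le_0_compat; lra).
          replace (2 * PI) with (INR N * (2 * PI / INR N)) at 2
            by (field; lra).
          apply Rmult_lt_compat_r; [apply Rdiv_lt_0_compat; lra|].
          apply lt_INR in Hm; apply lt_INR in Hk.
          generalize (pos_INR m) (pos_INR k); intros.
          apply Rabs_def1; lra.
        - fold (cis t); rewrite E; symmetry; apply Cexp_0. }
      injection Et; unfold t; intros E1.
      apply Rmult_integral in E1; destruct E1 as [E1|E1].
      - apply Hmk, INR_eq; lra.
      - assert (0 < 2 * PI / INR N) by (apply Rdiv_lt_0_compat; lra); lra. }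
    assert (H2 : (cis t ^ N)%C = 1).
    { rewrite cis_pow; unfold t.
      replace (INR N * _) with (INR m * (2 * PI) + - (INR k * (2 * PI)))
        by (field; lra).
      rewrite cis_plus.
      assert (H3 : forall n, cis (INR n * (2 * PI)) = 1).
      { intros n; rewrite <- cis_pow, cis_2PI; apply Cpow_1_l. }
      generalize (cis_opp (INR k * (2 * PI))); rewrite !H3; auto. }
    assert (G := Csum_geom (cis t) N); rewrite H2 in G.
    replace (Csum _ N) with (/ (1 - cis t) * (1 - 1))%C; [ring|].
    rewrite <- G; field.
    intros E; apply H1; symmetry; now apply Ceq_minus.
Qed.

(** A discrete Cauchy formula: the average of [P(h) * h ^ (- k)] over the [N] points
    [r * cis (2 * PI * j / N)] is exactly [a k], because all indices are below [N]. *)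
Lemma polynomial_coef_bound (a : nat -> C) (r B : R) N k :
  0 <= r -> (k < N)%nat ->
  (forall h, Cmod h = r -> Cmod (Csum (fun m => a m * h ^ m)%C N) <= B) ->
  Cmod (a k) * r ^ k <= B.
Proof.
  intros Hr Hk HB.
  assert (HN : 0 < INR N) by (apply lt_0_INR; lia).
  set (w := 2 * PI / INR N).
  set (S := Csum (fun j => Csum (fun m => a m * (r * cis (INR j * w)) ^ m) N
                           * cis (- (INR j * INR k * w)))%C N).
  assert (E : S = (INR N * (a k * r ^ k))%C).
  { unfold S.
    rewrite (Csum_ext _ (fun j => Csum (fun m => a m * r ^ m
        * cis (INR j * ((INR m - INR k) * w)))%C N)).
    2: { intros j _.
         rewrite Cmult_comm, <- Csum_scal; apply Csum_ext; intros m _.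
         rewrite Cpow_mult_l, cis_pow.
         replace (INR j * ((INR m - INR k) * w))
           with (INR m * (INR j * w) + - (INR j * INR k * w)) by ring.
         rewrite cis_plus; ring. }
    rewrite Csum_swap.
    rewrite (Csum_ext _ (fun m => a m * r ^ m *
               (if (m =? k)%nat then RtoC (INR N) else 0))%C).
    2: { intros m Hm; rewrite Csum_scal; f_equal.
         now apply roots_of_unity_sum. }
    replace N with (k + (1 + (N - k - 1)))%nat at 1 by lia.
    rewrite !Csum_shift.
    rewrite (Csum_0 _ k).
    2: { intros m Hm; destruct (Nat.eqb_spec m k); [lia|ring]. }
    rewrite (Csum_0 _ (N - k - 1)).
    2: { intros m Hm; destruct (Nat.eqb_spec (k + (1 + m)) k); [lia|ring]. }
    simpl Csum.
    rewrite Nat.add_0_r, Nat.eqb_refl; ring. }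
  assert (HS : Cmod S <= INR N * B).
  { apply Rle_trans with (Rsum (fun _ => B) N).
    - apply Cmod_Csum_le; intros j _.
      rewrite Cmod_mult, Cmod_cis, Rmult_1_r; apply HB.
      rewrite Cmod_mult, Cmod_cis, Cmod_R, Rabs_pos_eq; lra.
    - clear; right; induction N; [simpl; ring|].
      rewrite S_INR; simpl; rewrite IHN; ring. }
  rewrite E, !Cmod_mult, Cmod_INR, Cmod_pow, Cmod_R, Rabs_pos_eq in HS by auto.
  apply Rmult_le_reg_l with (INR N); auto.
Qed.

Lemma Rle_lim_seq_0 (x B : R) (u : nat -> R) N :
  is_lim_seq u 0 -> (forall n, (N <= n)%nat -> x <= B + u n) -> x <= B.
Proof.
  intros Hu H.
  assert (H1 : Rbar_le x (B + 0)).
  { apply (is_lim_seq_le_loc (fun _ => x) (fun n => B + u n)).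
    - now exists N.
    - apply is_lim_seq_const.
    - apply is_lim_seq_plus'; auto using is_lim_seq_const. }
  simpl in H1; lra.
Qed.

Lemma is_lim_seq_geom_scal (M q : R) :
  0 <= q < 1 -> is_lim_seq (fun n => M * q ^ n / (1 - q)) 0.
Proof.
  intros Hq.
  apply (is_lim_seq_ext (fun n => M / (1 - q) * q ^ n)).
  - intros; unfold Rdiv; ring.
  - apply is_lim_seq_scal_0, is_lim_seq_geom.
    rewrite Rabs_pos_eq; lra.
Qed.

(** The bound for polynomials is applied to the truncations, whose error on the circle is at most
    [M * q ^ n / (1 - q)]. The radius [rho] between [r] and [R] provides the ratio [q < 1]. *)
Lemma cauchy_estimate a (F : C -> C) (r R B : R) :
  0 < r < R -> (forall h, Cmod h < R -> CPS a h (F h)) ->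
  (forall h, Cmod h = r -> Cmod (F h) <= B) ->
  forall k, Cmod (a k) * r ^ k <= B.
Proof.
  intros Hr H HB k.
  set (rho := (r + R) / 2).
  assert (Hrho : r < rho < R) by (unfold rho; lra).
  assert (H1 : Cmod rho < R) by (rewrite Cmod_R, Rabs_pos_eq; lra).
  destruct (CPS_coef_bound a rho _ ltac:(lra) (H _ H1)) as [M [HM Bd]].
  set (q := r / rho).
  assert (Hq : 0 <= q < 1).
  { unfold q; split; [apply Rdiv_le_0_compat; lra|].
    apply Rmult_lt_reg_r with rho; [lra|].
    unfold Rdiv; rewrite Rmult_assoc, Rinv_l; lra. }
  apply (Rle_lim_seq_0 _ _ (fun n => M * q ^ n / (1 - q)) (S k)).
  - now apply is_lim_seq_geom_scal.
  - intros n Hn; apply polynomial_coef_bound with n; [lra|lia|].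
    intros h Hh.
    assert (T := CPS_tail_le a h (F h) rho M q n (H h ltac:(lra)) ltac:(lra)
                   Bd Hq ltac:(rewrite Hh; unfold q; right; field; lra)).
    generalize (HB h Hh); rewrite Cmod_minus_sym in T.
    generalize (Cmod_minus_ge (Csum (fun k => a k * h ^ k)%C n) (F h)); lra.
Qed.

(** Cauchy's estimate turns the majorants [M n] into majorants for each coefficient, so the
    coefficient series converge. Cutting every [f n] after [K] powers costs at most
    [M n * q ^ K / (1 - q)], which is summable in [n] and small in [K]. *)
Lemma weierstrass (a : nat -> nat -> C) (f : nat -> C -> C) (F : C -> C)
    (M : nat -> R) (r R B : R) :
  0 < r < R ->
  (forall n h, Cmod h < R -> CPS (a n) h (f n h)) ->
  (forall n h, Cmod h <= r -> Cmod (f n h) <= M n) ->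
  (forall n, Rsum M n <= B) ->
  (forall h, Cmod h < r -> Ccv (Csum (fun n => f n h)) (F h)) ->
  exists A, (forall h, Cmod h < r -> CPS A h (F h)) /\
            (forall k, Ccv (Csum (fun n => a n k)) (A k)).
Proof.
  intros Hr Ha HM HB HF.
  assert (HC : forall n k, Cmod (a n k) * r ^ k <= M n).
  { intros n; apply (cauchy_estimate (a n) (f n) r R); auto.
    intros h Hh; apply HM; lra. }
  assert (HA : forall k, exists l, Ccv (Csum (fun n => a n k)) l).
  { intros k; assert (Hk : 0 < r ^ k) by (apply pow_lt; lra).
    apply (Csum_abs_cv _ (fun n => / r ^ k * M n) (/ r ^ k * B)).
    - intros n; apply Rmult_le_reg_r with (r ^ k); auto.
      apply Rle_trans with (1 := HC n k); right; field; lra.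
    - intros n; rewrite Rsum_scal; apply Rmult_le_compat_l; auto.
      left; now apply Rinv_0_lt_compat. }
  exists (fun k => Clim_seq (Csum (fun n => a n k))).
  assert (HA' : forall k, Ccv (Csum (fun n => a n k))
                  (Clim_seq (Csum (fun n => a n k)))).
  { intros k; destruct (HA k) as [l Hl]; now rewrite (Clim_seq_unique _ _ Hl). }
  split; auto; intros h Hh.
  set (q := Cmod h / r).
  assert (Hq : 0 <= q < 1).
  { unfold q; split; [apply Rdiv_le_0_compat; [apply Cmod_ge_0|lra]|].
    apply Rmult_lt_reg_r with r; [lra|].
    unfold Rdiv; rewrite Rmult_assoc, Rinv_l; lra. }
  apply Ccv_le with (fun K => B * q ^ K / (1 - q));
    [|now apply is_lim_seq_geom_scal].
  exists O; intros K _; rewrite Cmod_minus_sym.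
  apply (Csum_lim_le (fun n => f n h - Csum (fun k => a n k * h ^ k) K)%C _
           (fun n => q ^ K / (1 - q) * M n)).
  - apply Ccv_ext with (fun N => Csum (fun n => f n h) N
      - Csum (fun k => Csum (fun n => a n k) N * h ^ k) K)%C.
    + intros N; rewrite Csum_minus; f_equal.
      rewrite Csum_swap; apply Csum_ext; intros k _.
      rewrite Cmult_comm, <- Csum_scal; apply Csum_ext; intros; ring.
    + apply Ccv_minus; [now apply HF|].
      apply (Ccv_Csum (fun k N => Csum (fun n => a n k) N * h ^ k)%C).
      intros k; apply Ccv_mult; [apply HA'|apply Ccv_const].
  - intros n; replace (q ^ K / (1 - q) * M n) with (M n * q ^ K / (1 - q))
      by (unfold Rdiv; ring).
    apply CPS_tail_le with r; auto; try lra.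
    + apply Ha; lra.
    + unfold q; right; field; lra.
  - intros N; rewrite Rsum_scal.
    replace (B * q ^ K / (1 - q)) with (q ^ K / (1 - q) * B)
      by (unfold Rdiv; ring).
    apply Rmult_le_compat_l; auto.
    apply Rdiv_le_0_compat; [apply pow_le|]; lra.
Qed.

Lemma is_derive_quadratic (f : R -> R) (l K rho : R) :
  0 < rho -> (forall t, Rabs t <= rho ->
                Rabs (f t - f 0 - l * t) <= K * Rabs t ^ 2) ->
  is_derive f 0 l.
Proof.
  intros Hrho H; apply is_derive_Reals; intros eps Heps.
  assert (HK := Rabs_pos K).
  assert (Hd : 0 < Rmin rho (eps / (Rabs K + 1))).
  { apply Rmin_pos; auto; apply Rdiv_lt_0_compat; lra. }
  exists (mkposreal _ Hd); intros h Hh0 Hh; simpl in Hh.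
  apply Rmin_Rgt_l in Hh; destruct Hh as [H1 H2].
  rewrite Rplus_0_l.
  replace ((f h - f 0) / h - l) with ((f h - f 0 - l * h) / h)
    by (field; auto).
  assert (Hp : 0 < Rabs h) by now apply Rabs_pos_lt.
  unfold Rdiv; rewrite Rabs_mult, Rabs_inv.
  apply Rle_lt_trans with (K * Rabs h).
  - apply Rmult_le_reg_r with (Rabs h); auto.
    rewrite Rmult_assoc, Rinv_l, Rmult_1_r by lra.
    apply Rle_trans with (1 := H h ltac:(lra)); right; ring.
  - apply Rmult_lt_of_lt_div; auto; lra.
Qed.

Lemma CPS_quadratic a (F : C -> C) r :
  0 < r -> (forall h, Cmod h < r -> CPS a h (F h)) ->
  a 0%nat = F 0 /\ exists rho K, 0 < rho /\ 0 <= K /\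
  forall h, Cmod h <= rho -> Cmod (F h - F 0 - a 1%nat * h) <= K * Cmod h ^ 2.
Proof.
  intros Hr H.
  destruct (CPS_remainder a F r Hr H) as [rho [Hrho HK]].
  assert (E0 : a 0%nat = F 0).
  { destruct (HK 1%nat) as [K [_ B]].
    specialize (B 0 ltac:(rewrite Cmod_0; lra)).
    rewrite Cmod_0 in B; simpl in B; rewrite Rmult_0_l, Rmult_0_r in B.
    assert (E : (F 0 - (0 + a 0%nat * 1))%C = 0).
    { apply Cmod_eq_0, Rle_antisym; auto using Cmod_ge_0. }
    apply Ceq_minus in E; rewrite E; ring. }
  split; auto; destruct (HK 2%nat) as [K [HK0 B]].
  exists rho, K; repeat split; auto; try lra.
  intros h Hh; rewrite <- E0.
  replace (F h - a 0%nat - a 1%nat * h)%C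
    with (F h - Csum (fun k => a k * h ^ k) 2)%C by (simpl; ring).
  now apply B.
Qed.

Lemma CPS_cder a (F : C -> C) r :
  0 < r -> (forall h, Cmod h < r -> CPS a h (F h)) ->
  cder (fun t => F (RtoC t)) 0 (a 1%nat).
Proof.
  intros Hr H.
  destruct (CPS_quadratic a F r Hr H) as [_ [rho [K [Hrho [HK B]]]]].
  split; apply is_derive_quadratic with K rho; auto; intros t Ht;
    specialize (B t ltac:(now rewrite Cmod_R));
    rewrite Cmod_R in B; apply Rle_trans with (2 := B).
  - replace (_ - _ - _) with (Re (F t - F 0 - a 1%nat * t))
      by (rewrite !Re_minus, re_scal_r; ring).
    apply re_le_Cmod.
  - replace (_ - _ - _) with (Im (F t - F 0 - a 1%nat * t))
      by (rewrite !Im_minus, im_scal_r; ring).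
    apply Im_le_Cmod.
Qed.

Lemma cder_unique (f : R -> C) t l m : cder f t l -> cder f t m -> l = m.
Proof.
  intros [A B] [A' B']; apply C_eq.
  - now rewrite <- (is_derive_unique _ _ _ A), <- (is_derive_unique _ _ _ A').
  - now rewrite <- (is_derive_unique _ _ _ B), <- (is_derive_unique _ _ _ B').
Qed.

(** [C_derive] takes its limit along the horizontal line through [z], so a derivative in a real
    parameter determines it. *)
Lemma C_derive_cder (f : C -> C) (z l : C) :
  cder (fun t => f (z + RtoC t)%C) 0 l -> C_derive f z = l.
Proof.
  intros [A B]; unfold C_derive, C_lim.
  assert (Hq : forall x : R, x <> fst z ->
    ((f (x, snd z) - f z) / ((x, snd z) - z))%C =
    ((Re (f (z + RtoC (x - fst z))%C) - Re (f (z + 0)%C)) / (x - fst z),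
     (Im (f (z + RtoC (x - fst z))%C) - Im (f (z + 0)%C)) / (x - fst z))).
  { intros x Hx.
    replace ((x, snd z) - z)%C with (RtoC (x - fst z))
      by (apply C_eq; unfold Re, Im; simpl; ring).
    replace (z + RtoC (x - fst z))%C with ((x, snd z) : C)
      by (apply C_eq; unfold Re, Im; simpl; ring).
    replace (z + 0)%C with z by ring.
    unfold Cdiv; rewrite <- RtoC_inv by lra.
    apply C_eq; unfold Re, Im; simpl; unfold Rdiv; ring. }
  assert (Hl : forall (g : R -> R) m, is_derive g 0 m ->
    is_lim (fun x => (g (x - fst z) - g 0) / (x - fst z)) (fst z) m).
  { intros g m Hg; apply is_derive_Reals in Hg.
    apply is_lim_spec; intros eps.
    destruct (Hg eps (cond_pos eps)) as [d Hd].
    exists d; intros x Hx Hx0.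
    specialize (Hd (x - fst z) ltac:(lra) Hx).
    rewrite Rplus_0_l in Hd; exact Hd. }
  assert (Hloc : forall P : R -> Prop, (forall x, x <> fst z -> P x) ->
            Rbar_locally' (fst z) P).
  { intros P HP; exists (mkposreal 1 Rlt_0_1); auto. }
  apply C_eq.
  - change (real (Lim (fun x : R => fst ((f (x, snd z) - f z) /
              ((x, snd z) - z))%C) (fst z)) = Re l).
    rewrite (is_lim_unique _ _ (Re l)); auto.
    eapply is_lim_ext_loc; [|apply (Hl _ _ A)].
    apply Hloc; intros x Hx; rewrite Hq; auto.
  - change (real (Lim (fun x : R => snd ((f (x, snd z) - f z) /
              ((x, snd z) - z))%C) (fst z)) = Im l).
    rewrite (is_lim_unique _ _ (Im l)); auto.
    eapply is_lim_ext_loc; [|apply (Hl _ _ B)].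
    apply Hloc; intros x Hx; rewrite Hq; auto.
Qed.

(** * Euler's constant and Stirling's constant *)

Lemma ln_le_minus_1 (x : R) : 0 < x -> ln x <= x - 1.
Proof.
  intros Hx; generalize (exp_ineq1_le (ln x)); rewrite exp_ln by auto; lra.
Qed.

Lemma harmonic_sum_n_m N :
  harmonic N = sum_n_m (fun k => / INR k) 1 N.
Proof.
  unfold harmonic; induction N as [|N IH].
  - rewrite sum_n_m_zero by lia; reflexivity.
  - rewrite sum_n_Sm by lia.
    rewrite <- IH; reflexivity.
Qed.

(** The limit must be shown to exist, since [euler_gamma] is the real part of a [Lim_seq]. The
    sequence decreases and is bounded below by 0, both by [ln x <= x - 1]; the shift by one keeps
    [ln 0] out. *)
Lemma euler_gamma_lim :
  is_lim_seq (fun N => harmonic N - ln (INR N)) euler_gamma.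
Proof.
  assert (H : ex_finite_lim_seq
                (fun N => harmonic (N + 1) - ln (INR (N + 1)))).
  { apply (ex_finite_lim_seq_decr _ 0).
    - intros n; rewrite !Nat.add_1_r.
      change (harmonic (S (S n))) with (harmonic (S n) + / INR (S (S n))).
      assert (Hn : 0 < INR (S n)) by (apply lt_0_INR; lia).
      rewrite (S_INR (S n)); set (x := INR (S n)) in *.
      assert (Hl := ln_le_minus_1 (x / (x + 1))
                      ltac:(apply Rdiv_lt_0_compat; lra)).
      rewrite ln_div in Hl by lra.
      replace (x / (x + 1) - 1) with (- / (x + 1)) in Hl by (field; lra).
      lra.
    - intros n; rewrite Nat.add_1_r.
      assert (ln (INR (S (S n))) <= harmonic (S n)).
      { induction n as [|n IH].
        - unfold harmonic; simpl.
          generalize (ln_le_minus_1 2 ltac:(lra)).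
          replace (1 + 1) with 2 by ring; lra.
        - change (harmonic (S (S n))) with (harmonic (S n) + / INR (S (S n))).
          assert (Hn : 0 < INR (S (S n))) by (apply lt_0_INR; lia).
          rewrite (S_INR (S (S n))); set (x := INR (S (S n))) in *.
          assert (Hl := ln_le_minus_1 ((x + 1) / x)
                          ltac:(apply Rdiv_lt_0_compat; lra)).
          rewrite ln_div in Hl by lra.
          replace ((x + 1) / x - 1) with (/ x) in Hl by (field; lra).
          lra. }
      assert (ln (INR (S n)) <= ln (INR (S (S n)))).
      { apply ln_le; [apply lt_0_INR; lia|apply le_INR; lia]. }
      lra. }
  destruct H as [l Hl].
  apply (is_lim_seq_incr_n (fun N => harmonic N - ln (INR N))) in Hl.
  unfold euler_gamma.
  rewrite (Lim_seq_ext _ (fun N => harmonic N - ln (INR N)))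
    by (intros; now rewrite harmonic_sum_n_m).
  now rewrite (is_lim_seq_unique _ _ Hl).
Qed.

Definition wallis (n : nat) : R := RInt (fun x => sin x ^ n) 0 (PI / 2).

Lemma continuous_sin_pow n x : continuous (fun x => sin x ^ n) x.
Proof.
  apply (ex_derive_continuous (fun x => sin x ^ n)).
  auto_derive; auto.
Qed.

Lemma ex_RInt_sin_pow n : ex_RInt (fun x => sin x ^ n) 0 (PI / 2).
Proof.
  apply (ex_RInt_continuous (V := R_CompleteNormedModule)).
  intros; apply continuous_sin_pow.
Qed.

(** Integrate the derivative of [sin x ^ (n + 1) * cos x], which vanishes at both ends. *)
Lemma wallis_rec n : INR (n + 2) * wallis (n + 2) = INR (n + 1) * wallis n.
Proof.
  set (df := fun x => INR (n + 1) * sin x ^ n - INR (n + 2) * sin x ^ (n + 2)).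
  assert (H1 : is_RInt df 0 (PI / 2)
    (minus (sin (PI / 2) ^ (n + 1) * cos (PI / 2)) (sin 0 ^ (n + 1) * cos 0))).
  { apply (is_RInt_derive (fun x => sin x ^ (n + 1) * cos x)).
    - intros x _; unfold df; auto_derive; auto.
      replace (Nat.pred (n + 1)) with n by lia.
      rewrite !plus_INR, !pow_add.
      change (INR 1) with 1; change (INR 2) with 2.
      simpl (_ ^ 1); simpl (_ ^ 2).
      generalize (sin2_cos2 x); unfold Rsqr; intros E.
      match goal with |- ?a = ?b => replace a with
        ((INR n + 1) * sin x ^ n * (cos x * cos x) - sin x * sin x ^ n * sin x)
        by ring end.
      replace (cos x * cos x) with (1 - sin x * sin x) by lra.
      ring.
    - intros x _; unfold df.
      apply (continuous_minus (V := R_NormedModule));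
        apply (continuous_scal_r (V := R_NormedModule)), continuous_sin_pow. }
  assert (H2 : is_RInt df 0 (PI / 2)
    (INR (n + 1) * wallis n - INR (n + 2) * wallis (n + 2))).
  { unfold wallis; apply (is_RInt_minus (V := R_NormedModule));
      apply (is_RInt_scal (V := R_NormedModule)),
        (RInt_correct (V := R_CompleteNormedModule)), ex_RInt_sin_pow. }
  assert (E := eq_trans (eq_sym (is_RInt_unique _ _ _ _ H1))
                 (is_RInt_unique _ _ _ _ H2)).
  rewrite sin_0, cos_PI2 in E.
  unfold minus, plus, opp in E; simpl in E.
  rewrite (pow_add 0) in E; simpl in E; lra.
Qed.

Lemma wallis_decr n : wallis (S n) <= wallis n.
Proof.
  assert (HP := PI_RGT_0).
  apply RInt_le; [lra|apply ex_RInt_sin_pow|apply ex_RInt_sin_pow|].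
  intros x Hx; simpl.
  assert (0 <= sin x) by (apply sin_ge_0; lra).
  generalize (SIN_bound x) (pow_le (sin x) n H); nra.
Qed.

Lemma wallis_0 : wallis 0 = PI / 2.
Proof.
  unfold wallis; simpl; rewrite RInt_const; unfold scal; simpl.
  unfold mult; simpl; ring.
Qed.

Lemma wallis_1 : wallis 1 = 1.
Proof.
  unfold wallis; apply is_RInt_unique.
  assert (H : is_RInt (fun x => sin x ^ 1) 0 (PI / 2)
                (minus (- cos (PI / 2)) (- cos 0))).
  { apply (is_RInt_derive (fun x => - cos x) (fun x => sin x ^ 1)).
    - intros; auto_derive; auto; ring.
    - intros; apply continuous_sin_pow. }
  rewrite cos_PI2, cos_0 in H.
  replace (minus (- 0) (- (1))) with 1 in H
    by (unfold minus, plus, opp; simpl; ring).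
  exact H.
Qed.

Definition ln_fact (N : nat) : R := Rsum (fun k => ln (INR (S k))) N.

(** The logarithm of [binom(2 N, N) / 4 ^ N]. *)
Definition ln_central (N : nat) : R :=
  ln_fact (2 * N) - 2 * ln_fact N - 2 * INR N * ln 2.

Lemma ln_central_S N :
  ln_central (S N) = ln_central N + ln (2 * INR N + 1) - ln (2 * INR N + 2).
Proof.
  unfold ln_central; replace (2 * S N)%nat with (S (S (2 * N))) by lia.
  change (ln_fact (S (S (2 * N)))) with
    (ln_fact (2 * N) + ln (INR (S (2 * N))) + ln (INR (S (S (2 * N))))).
  change (ln_fact (S N)) with (ln_fact N + ln (INR (S N))).
  rewrite !S_INR, mult_INR; change (INR 2) with 2.
  assert (HN := pos_INR N).
  replace (2 * INR N + 1 + 1) with (2 * (INR N + 1)) by ring.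
  replace (2 * INR N + 2) with (2 * (INR N + 1)) by ring.
  rewrite ln_mult by lra; ring.
Qed.

Lemma wallis_closed N :
  wallis (2 * N) = PI / 2 * exp (ln_central N) /\
  wallis (2 * N + 1) = / ((2 * INR N + 1) * exp (ln_central N)).
Proof.
  induction N as [|N [IH1 IH2]].
  - change (2 * 0)%nat with 0%nat; change (0 + 1)%nat with 1%nat.
    rewrite wallis_0, wallis_1.
    replace (ln_central 0) with 0
      by (unfold ln_central, ln_fact; simpl; ring).
    rewrite exp_0; simpl; split; field.
  - assert (HN := pos_INR N).
    assert (E : exp (ln_central (S N))
      = exp (ln_central N) * (2 * INR N + 1) / (2 * INR N + 2)).
    { rewrite ln_central_S; unfold Rminus, Rdiv; rewrite !exp_plus, exp_Ropp.
      rewrite !exp_ln by lra; ring. }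
    assert (He := exp_pos (ln_central N)).
    rewrite E; split.
    + assert (H := wallis_rec (2 * N)).
      replace (2 * S N)%nat with (2 * N + 2)%nat by lia.
      rewrite IH1, !plus_INR, mult_INR in H; simpl (INR 2) in H;
        simpl (INR 1) in H.
      apply Rmult_eq_reg_l with (2 * INR N + 2); [|lra].
      replace (2 * INR N + 2) with ((1 + 1) * INR N + (1 + 1)) at 1 by ring.
      rewrite H; field; lra.
    + assert (H := wallis_rec (2 * N + 1)).
      replace (2 * S N + 1)%nat with (2 * N + 1 + 2)%nat by lia.
      rewrite IH2, !plus_INR, mult_INR in H; simpl (INR 2) in H;
        simpl (INR 1) in H.
      apply Rmult_eq_reg_l with (2 * INR N + 3); [|lra].
      replace (2 * INR N + 3) with ((1 + 1) * INR N + 1 + (1 + 1)) at 1 by ring.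
      rewrite H, S_INR; field; lra.
Qed.

(** The integrals decrease with the exponent; comparing those with exponents [2 N + 1], [2 N] and
    [2 N - 1] places [PI / 2 * p ^ 2] between [/ (2 N + 1)] and [/ (2 N)]. *)
Lemma ln_central_bounds N : (1 <= N)%nat ->
  - ln (2 * INR N + 1) <= ln (PI / 2) + 2 * ln_central N <= - ln (2 * INR N).
Proof.
  intros HN1; assert (HP := PI_RGT_0).
  assert (HN : 1 <= INR N) by now apply (le_INR 1).
  destruct (wallis_closed N) as [E1 E2].
  assert (He := exp_pos (ln_central N)); set (p := exp (ln_central N)) in *.
  replace (ln (PI / 2) + 2 * ln_central N) with (ln (PI / 2 * (p * p))).
  2: { rewrite (ln_mult (PI / 2) (p * p)), (ln_mult p p) by nra.
       unfold p; rewrite ln_exp; ring. }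
  rewrite <- (ln_Rinv (2 * INR N + 1)), <- (ln_Rinv (2 * INR N)) by lra.
  assert (H1 := wallis_decr (2 * N)).
  assert (H2 := wallis_decr (2 * N - 1)).
  assert (H3 := wallis_rec (2 * N - 1)).
  replace (S (2 * N)) with (2 * N + 1)%nat in H1 by lia.
  replace (S (2 * N - 1)) with (2 * N)%nat in H2 by lia.
  replace (2 * N - 1 + 2)%nat with (2 * N + 1)%nat in H3 by lia.
  replace (2 * N - 1 + 1)%nat with (2 * N)%nat in H3 by lia.
  rewrite plus_INR, mult_INR in H3; simpl (INR 2) in H3; simpl (INR 1) in H3.
  rewrite E2 in H1, H3; rewrite E1 in H1, H2.
  set (W := wallis (2 * N - 1)) in *.
  assert (EW : W = / (2 * INR N * p)).
  { apply Rmult_eq_reg_l with ((1 + 1) * INR N); [|lra].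
    rewrite <- H3; field; lra. }
  rewrite EW in H2; split; apply ln_le.
  - apply Rinv_0_lt_compat; lra.
  - apply Rmult_le_compat_r with (r := p) in H1; [|lra].
    replace (/ ((2 * INR N + 1) * p) * p) with (/ (2 * INR N + 1)) in H1
      by (field; lra).
    lra.
  - assert (0 < p * p) by nra; nra.
  - apply Rmult_le_compat_r with (r := p) in H2; [|lra].
    replace (/ (2 * INR N * p) * p) with (/ (2 * INR N)) in H2
      by (field; lra).
    lra.
Qed.

Lemma is_lim_seq_ln_ratio :
  is_lim_seq (fun N => ln (2 * INR N + 1) - ln (2 * INR N)) 0.
Proof.
  apply (is_lim_seq_le_le_loc (fun _ => 0) _ (fun N => / INR N)).
  - exists 1%nat; intros N HN1.
    assert (HN : 1 <= INR N) by now apply (le_INR 1).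
    split.
    + assert (ln (2 * INR N) <= ln (2 * INR N + 1)) by (apply ln_le; lra).
      lra.
    + rewrite <- (ln_div (2 * INR N + 1) (2 * INR N)) by lra.
      apply Rle_trans with ((2 * INR N + 1) / (2 * INR N) - 1).
      { apply ln_le_minus_1, Rdiv_lt_0_compat; lra. }
      replace ((2 * INR N + 1) / (2 * INR N) - 1) with (/ 2 * / INR N)
        by (field; lra).
      assert (0 < / INR N) by (apply Rinv_0_lt_compat; lra); lra.
  - apply is_lim_seq_const.
  - apply is_lim_seq_inv_INR.
Qed.

(** In [a (2 N) - 2 * a N] the main terms cancel and [ln_central] appears, whose size is known from
    Wallis' integrals; the same combination tends to [- l]. *)
Lemma stirling_constant (l : R) :
  is_lim_seq (fun N => INR N * ln (INR N) - INR N + ln (INR N) / 2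
                       - ln_fact N) l ->
  l = - (ln (2 * PI) / 2).
Proof.
  intros H.
  set (a := fun N => INR N * ln (INR N) - INR N + ln (INR N) / 2
                     - ln_fact N) in H.
  assert (HP := PI_RGT_0).
  assert (H2 : is_lim_seq (fun N => a (2 * N)%nat) l).
  { apply (is_lim_seq_subseq a); auto.
    apply eventually_subseq; intros; lia. }
  assert (H3 : is_lim_seq (fun N => 2 * (a (2 * N)%nat - 2 * a N))
                 (2 * (l - 2 * l))).
  { apply (is_lim_seq_scal_l _ 2 (l - 2 * l)), is_lim_seq_minus'; auto.
    apply (is_lim_seq_scal_l _ 2 l); auto. }
  assert (H4 : is_lim_seq (fun N => 2 * (a (2 * N)%nat - 2 * a N))
                 (ln (2 * PI))).
  { apply (is_lim_seq_le_le_loc (fun N => ln (2 * PI)) _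
      (fun N => ln (2 * PI) + (ln (2 * INR N + 1) - ln (2 * INR N)))).
    - exists 1%nat; intros N HN1.
      assert (HN : 1 <= INR N) by now apply (le_INR 1).
      assert (E : 2 * (a (2 * N)%nat - 2 * a N)
                  = ln 2 - ln (INR N) - 2 * ln_central N).
      { unfold a, ln_central; rewrite mult_INR; change (INR 2) with 2.
        rewrite ln_mult by lra; field. }
      rewrite E; generalize (ln_central_bounds N HN1).
      rewrite ln_div, !(ln_mult 2) by lra; lra.
    - apply is_lim_seq_const.
    - replace (Finite (ln (2 * PI))) with (Finite (ln (2 * PI) + 0))
        by (f_equal; ring).
      apply is_lim_seq_plus'; [apply is_lim_seq_const|].
      apply is_lim_seq_ln_ratio. }
  apply is_lim_seq_unique in H3; apply is_lim_seq_unique in H4.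
  rewrite H3 in H4; injection H4; lra.
Qed.

(** * The zeta function by Euler-Maclaurin summation *)

Lemma is_derive_pow_scal (c : R) n t :
  is_derive (fun t => c * t ^ S n) t (c * (INR (S n) * t ^ n)).
Proof.
  apply is_derive_scal.
  eapply is_derive_eq; [|apply is_derive_pow, @is_derive_id].
  unfold one; simpl Nat.pred; cbn -[INR pow]; ring.
Qed.

(** Along [t * h], the derivative of a remainder is [h] times the remainder of the preceding
    order. *)
Lemma Cexp_taylor (K : nat) : forall h,
  Cmod (Cexp h - Csum (fun k => / INR (fact k) * h ^ k)%C K)
  <= exp (Cmod h) * (Cmod h ^ K / INR (fact K)).
Proof.
  induction K as [|K IH]; intros h.
  - simpl Csum; replace (_ - 0)%C with (Cexp h) by ring.
    rewrite Cmod_Cexp; change (INR (fact 0)) with 1; simpl pow.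
    replace (exp (Cmod h) * (1 / 1)) with (exp (Cmod h)) by field.
    destruct (Re_le_Cmod h) as [H|H]; [left; now apply exp_increasing|].
    rewrite H; lra.
  - assert (Hf := INR_fact_neq_0 K).
    assert (HS := not_0_INR (S K) (Nat.neq_succ_0 K)).
    set (f := fun t : R =>
      (Cexp (t * h) - Csum (fun k => / INR (fact k) * (t * h) ^ k) (S K))%C).
    replace (_ - _)%C with (f 1 - f 0)%C.
    2: { unfold f; rewrite !Cmult_0_l, !Cmult_1_l, Cexp_0.
         rewrite (Csum_power_series_0 (fun k => / INR (fact k))%C).
         change (INR (fact 0)) with 1.
         rewrite <- RtoC_inv, Rinv_1 by lra; ring. }
    set (B := exp (Cmod h) * (Cmod h ^ S K / INR (fact (S K)))).
    replace B with (B * 1 ^ S K - B * 0 ^ S K)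
      by (rewrite pow1; simpl; ring).
    apply mean_value_ineq with (g := fun t => B * t ^ S K)
      (f' := fun t : R => (h * (Cexp (t * h) -
         Csum (fun k => / INR (fact k) * (t * h) ^ k) K))%C)
      (g' := fun t => B * (INR (S K) * t ^ K)); [lra| | |].
    + intros t Ht.
      assert (Hd := cder_id_mult h t).
      unfold f.
      apply cder_ext with (fun t : R => Cexp (t * h)
        - (/ INR (fact 0) + Csum (fun k => / INR (fact (S k))
             * (t * h) ^ (S k)) K))%C.
      { intros; rewrite (Csum_S_l _ K); simpl (_ ^ 0)%C; do 3 f_equal; ring. }
      eapply cder_eq; [|apply cder_minus].
      2: { apply cder_Cexp, Hd. }
      2: { apply cder_plus; [apply cder_const|].
           apply (cder_Csum (fun k t => / INR (fact (S k))
             * (t * h) ^ (S k))%C).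
           intros k; apply cder_scal, cder_pow, Hd. }
      rewrite (Csum_ext _ (fun k => h * (/ INR (fact k) * (t * h) ^ k))%C).
      2: { intros k _; rewrite fact_simpl, mult_INR, RtoC_mult; field.
           split; apply RtoC_neq_0; [apply INR_fact_neq_0|].
           apply not_0_INR; lia. }
      rewrite Csum_scal; ring.
    + intros; apply is_derive_pow_scal.
    + intros t Ht; rewrite Cmod_mult.
      assert (Hm : Cmod (t * h) = t * Cmod h)
        by (rewrite Cmod_mult, Cmod_R, Rabs_pos_eq; lra).
      apply Rle_trans with (Cmod h * (exp (Cmod h) *
             ((t * Cmod h) ^ K / INR (fact K)))).
      * apply Rmult_le_compat_l; [apply Cmod_ge_0|].
        apply Rle_trans with (1 := IH _); rewrite Hm.
        apply Rmult_le_compat_r.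
        { apply Rdiv_le_0_compat; [|apply INR_fact_lt_0].
          apply pow_le, Rmult_le_pos; [lra|apply Cmod_ge_0]. }
        assert (Hle : t * Cmod h <= Cmod h)
          by (generalize (Cmod_ge_0 h); nra).
        destruct Hle as [Hle|Hle]; [left; now apply exp_increasing|].
        rewrite Hle; lra.
      * right; unfold B; rewrite Rpow_mult_distr, fact_simpl, mult_INR.
        simpl (Cmod h ^ S K); field; split; auto.
Qed.

Lemma CPS_Cexp c L h :
  CPS (fun k => Cexp c * (/ INR (fact k) * L ^ k))%C h (Cexp (c + L * h)).
Proof.
  rewrite Cexp_plus; apply (CPS_scal (Cexp c)
    (fun k => / INR (fact k) * L ^ k)%C).
  apply Ccv_ext with (Csum (fun k => / INR (fact k) * (L * h) ^ k)%C).
  { intros n; apply Csum_ext; intros; rewrite Cpow_mult_l; ring. }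
  apply Ccv_le with (fun K => exp (Cmod (L * h)) *
                       (Cmod (L * h) ^ K / INR (fact K))).
  - exists O; intros n _; rewrite Cmod_minus_sym; apply Cexp_taylor.
  - apply is_lim_seq_scal_0, is_lim_seq_Reals, cv_speed_pow_fact.
Qed.

(* In [Type], so that a sequence of coefficient sequences can be extracted
   without the axiom of choice. *)
Definition entire_series (f : C -> C) (s0 : C) : Type :=
  {a : nat -> C | forall h, CPS a h (f (s0 + h)%C)}.

Lemma entire_series_ext f g s0 :
  (forall s, f s = g s) -> entire_series f s0 -> entire_series g s0.
Proof. intros E [a H]; exists a; intros h; rewrite <- E; auto. Qed.

Lemma entire_series_const c s0 : entire_series (fun _ => c) s0.
Proof. eexists; intros h; apply CPS_const. Qed.

Lemma entire_series_plus f g s0 :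
  entire_series f s0 -> entire_series g s0 ->
  entire_series (fun s => f s + g s)%C s0.
Proof. intros [a H] [b H']; eexists; intros h; apply CPS_plus; auto. Qed.

Lemma entire_series_scal c f s0 :
  entire_series f s0 -> entire_series (fun s => c * f s)%C s0.
Proof. intros [a H]; eexists; intros h; apply CPS_scal; auto. Qed.

Lemma entire_series_mult_arg f s0 :
  entire_series f s0 -> entire_series (fun s => s * f s)%C s0.
Proof.
  intros [a H].
  exists (fun k => s0 * a k + Ccoef_shift a k)%C; intros h.
  replace ((s0 + h) * f (s0 + h))%C
    with (s0 * f (s0 + h) + h * f (s0 + h))%C by ring.
  apply CPS_plus; [apply CPS_scal|apply CPS_mult_arg]; auto.
Qed.

Lemma entire_series_Csum (f : nat -> C -> C) s0 n :
  (forall k, entire_series (f k) s0) ->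
  entire_series (fun s => Csum (fun k => f k s) n) s0.
Proof.
  intros H; induction n; simpl; [apply entire_series_const|].
  now apply entire_series_plus.
Qed.

Definition npow (n : nat) (s : C) : C := Cexp (- s * ln (INR n)).

Lemma entire_series_npow n s0 : entire_series (npow n) s0.
Proof.
  eexists; intros h; unfold npow.
  replace (- (s0 + h) * ln (INR n))%C
    with (- s0 * ln (INR n) + (- ln (INR n)) * h)%C by ring.
  apply CPS_Cexp.
Qed.

Lemma Cmod_npow n s : Cmod (npow n s) = exp (- Re s * ln (INR n)).
Proof. unfold npow; rewrite Cmod_Cexp, re_scal_r, Re_opp; auto. Qed.

Lemma cder_npow n s :
  cder (fun t => npow n (s + RtoC t)) 0 (- ln (INR n) * npow n s)%C.
Proof.
  unfold npow; eapply cder_eq; [|apply cder_Cexp, cder_mult;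
    [apply cder_opp, cder_plus; [apply cder_const|apply cder_id]
    |apply cder_const]].
  cbv beta; replace (s + 0)%C with s by ring; ring.
Qed.

(** Euler-Maclaurin up to the [B_2] term, without the polar term [N ^ (1 - s) / (s - 1)];
    [zeta_approx] adds the latter after multiplication by [1 - s]. *)
Definition zeta_trunc (N : nat) (s : C) : C :=
  (Csum (fun k => npow (S k) s) N - npow N s / 2
   + s / 12 * (npow N s / INR N))%C.

(* [(1 - s)] times the Euler-Maclaurin approximation of [zeta s] with cutoff
   [N]. *)
Definition zeta_approx (N : nat) (s : C) : C :=
  match N with
  | O => 0
  | S _ => ((1 - s) * zeta_trunc N s - INR N * npow N s)%C
  end.

(** Turns the sequence of approximations into a series, the form that [weierstrass] asks for; the
    value 0 of [zeta_approx 0] makes the telescoping exact. *)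
Definition zeta_step (k : nat) (s : C) : C :=
  (zeta_approx (S k) s - zeta_approx k s)%C.

Lemma Csum_zeta_step N s : Csum (fun k => zeta_step k s) N = zeta_approx N s.
Proof.
  induction N as [|N IH]; [reflexivity|].
  change (Csum ?f (S N)) with (Csum f N + f N)%C; cbv beta.
  rewrite IH; unfold zeta_step; ring.
Qed.

Lemma entire_series_zeta_approx N s0 : entire_series (zeta_approx N) s0.
Proof.
  destruct N as [|N]; [exact (entire_series_const 0 s0)|].
  set (T := fun s : C => (Csum (fun k => npow (S k) s) (S N)
     + - (/ 2) * npow (S N) s + (/ 12 * / INR (S N)) * (s * npow (S N) s))%C).
  apply (entire_series_ext (fun s => (T s + - (1) * (s * T s))
                               + - INR (S N) * npow (S N) s)%C).
  { intros s; unfold zeta_approx, zeta_trunc, T; field.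
    apply RtoC_INR_S_neq_0. }
  assert (HT : entire_series T s0).
  { unfold T; apply entire_series_plus; [apply entire_series_plus|].
    - apply (entire_series_Csum (fun k => npow (S k))).
      intros; apply entire_series_npow.
    - apply entire_series_scal, entire_series_npow.
    - apply entire_series_scal, entire_series_mult_arg, entire_series_npow. }
  apply entire_series_plus; [apply entire_series_plus|]; auto.
  - apply entire_series_scal, entire_series_mult_arg; auto.
  - apply entire_series_scal, entire_series_npow.
Qed.

Lemma entire_series_zeta_step k s0 : entire_series (zeta_step k) s0.
Proof.
  apply (entire_series_ext (fun s => zeta_approx (S k) s
                               + - (1) * zeta_approx k s)%C).
  { intros; unfold zeta_step; ring. }
  apply entire_series_plus; [|apply entire_series_scal];
    apply entire_series_zeta_approx.
Qed.

Lemma is_derive_ln_1_plus u :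
  0 <= u -> is_derive (fun u => ln (1 + u)) u (/ (1 + u)).
Proof. intros Hu; auto_derive; [lra|field; lra]. Qed.

(** This is [(1 + u) ^ (- s)]; at [u = / k] it is the ratio of [(k + 1) ^ (- s)] to [k ^ (- s)]. *)
Definition em_kernel (s : C) (u : R) : C := Cexp (- s * ln (1 + u)).

Lemma cder_em_kernel s u :
  0 <= u -> cder (em_kernel s) u (- s * em_kernel s u / (1 + u)%R)%C.
Proof.
  intros Hu; unfold em_kernel; eapply cder_eq; [|apply cder_Cexp, cder_mult;
    [apply cder_const|apply cder_RtoC, is_derive_ln_1_plus; auto]].
  rewrite RtoC_inv by lra; unfold Cdiv; ring.
Qed.

Lemma em_kernel_0 s : em_kernel s 0 = 1.
Proof.
  unfold em_kernel; rewrite Rplus_0_r, ln_1, <- Cexp_0; f_equal; ring.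
Qed.

Lemma mean_value_pow (f f' : R -> C) (K u : R) n :
  0 <= u -> f 0 = 0 -> 0 <= K ->
  (forall t, 0 <= t <= u -> cder f t (f' t)) ->
  (forall t, 0 <= t <= u -> Cmod (f' t) <= K * t ^ n) ->
  Cmod (f u) <= K / INR (S n) * u ^ S n.
Proof.
  intros Hu H0 HK Hd Hb.
  assert (HS := INR_S_pos n).
  replace (f u) with (f u - f 0)%C by (rewrite H0; ring).
  replace (K / INR (S n) * u ^ S n)
    with (K / INR (S n) * u ^ S n - K / INR (S n) * 0 ^ S n)
    by (simpl; ring).
  apply mean_value_ineq with (g := fun t => K / INR (S n) * t ^ S n)
    (f' := f') (g' := fun t => K / INR (S n) * (INR (S n) * t ^ n)); auto.
  - intros; apply is_derive_pow_scal.
  - intros t Ht; apply Rle_trans with (1 := Hb t Ht); right; field; lra.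
Qed.

Ltac cder_tac :=
  match goal with
  | |- cder (fun _ => ?c) _ _ => apply (cder_const c)
  | |- cder (fun t => RtoC t) _ _ => apply cder_id
  | |- cder (fun t => (@?f t + @?g t)%C) _ _ => apply (cder_plus f g); cder_tac
  | |- cder (fun t => (@?f t - @?g t)%C) _ _ => apply (cder_minus f g); cder_tac
  | |- cder (fun t => (@?f t * @?g t)%C) _ _ => apply (cder_mult f g); cder_tac
  | |- cder (fun t => (@?f t / ?c)%C) _ _ =>
      apply (cder_mult f (fun _ => (/ c)%C)); cder_tac
  | _ => eassumption
  end.

(** One step of [zeta_approx] from [k] to [k + 1], divided by [k * k ^ (- s)] and written in
    [u = / k]; this is [zeta_step_S]. *)
Definition em_remainder (s : C) (u : R) : C :=
  ((1 - s) * (u / 2) * (em_kernel s u + 1)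
   - ((1 + u)%R * em_kernel s u - 1)
   + (1 - s) * s * (u * u / 12) * (em_kernel s u / (1 + u)%R - 1))%C.

(* The first two derivatives of [em_remainder] vanish at [0] and the third
   one is [O(u ^ 2)]. *)
Lemma em_remainder_bound s u :
  - 2 <= Re s -> Cmod s <= 3 -> 0 <= u <= 1 ->
  Cmod (em_remainder s u) <= 2 * u ^ 5.
Proof.
  intros Hs1 Hs2 Hu.
  set (E := em_kernel s).
  set (w := fun u : R => (/ (1 + u)%R)%C).
  (* The derivative of [em_remainder s] is [(1 - s) * psi], and [psi1], [psi2] are the next two
     derivatives of [psi]. *)
  set (psi := fun u : R => ((1 - E u) / 2 + - (s / 2) * (u * (E u * w u))
     + s / 6 * (u * (E u * w u - 1))
     + - (s * (s + 1) / 12) * (u * u * (E u * (w u * w u))))%C).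
  set (psi1 := fun u : R => (s * (s + 1) / 6 * (u * (E u * (w u * w u)))
     + s / 6 * (E u * w u - 1)
     + s * (s + 1) * (s + 2) / 12 * (u * u * (E u * (w u * w u * w u))))%C).
  set (psi2 := fun u : R => (- (s * (s + 1) * (s + 2) * (s + 3) * (u * u) / 12
       * (E u * / ((1 + u)%R * (1 + u)%R * (1 + u)%R * (1 + u)%R))))%C).
  assert (Hv : forall t, 0 <= t -> RtoC (1 + t) <> 0)
    by (intros; apply RtoC_neq_0; lra).
  assert (HE : forall t, 0 <= t -> cder E t (- s * E t / (1 + t)%R)%C)
    by (intros; now apply cder_em_kernel).
  assert (Hw : forall t, 0 <= t -> cder w t (- (w t * w t))%C).
  { intros t Ht; eapply cder_eq;
      [|apply (cder_inv (fun t => RtoC (1 + t)) t 1); auto].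
    - unfold w; field; auto.
    - apply cder_RtoC; auto_derive; auto. }
  assert (Hw0 : w 0 = 1) by (unfold w; rewrite Rplus_0_r; field; apply C1_nz).
  assert (HE0 : E 0 = 1) by apply em_kernel_0.
  assert (HEm : forall t, 0 <= t -> Cmod (E t) <= (1 + t) ^ 2).
  { intros t Ht; unfold E, em_kernel; rewrite Cmod_Cexp, re_scal_r, Re_opp.
    rewrite <- (exp_ln ((1 + t) ^ 2)) by (apply pow_lt; lra).
    assert (Hl : 0 <= ln (1 + t)) by (rewrite <- ln_1; apply ln_le; lra).
    replace (ln ((1 + t) ^ 2)) with (2 * ln (1 + t))
      by (simpl; rewrite Rmult_1_r, ln_mult by lra; ring).
    assert (- Re s * ln (1 + t) <= 2 * ln (1 + t)) as [H|H] by nra.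
    - left; now apply exp_increasing.
    - rewrite H; lra. }
  (* The constant is [3 * 4 * 5 * 6 / 12], from [Cmod (s + j) <= 3 + j]; the kernel is absorbed by
     the fourth power of [1 + t]. Integrating three times gives 10, 5/2 and, with
     [Cmod (1 - s) <= 4], the final 2. *)
  assert (B2 : forall t, 0 <= t -> Cmod (psi2 t) <= 30 * t ^ 2).
  { intros t Ht; unfold psi2.
    assert (Hsj : forall j : R, 0 <= j -> Cmod (s + j) <= 3 + j).
    { intros j Hj; apply Rle_trans with (1 := Cmod_triangle _ _).
      rewrite Cmod_R, Rabs_pos_eq; lra. }
    rewrite Cmod_opp; unfold Cdiv.
    rewrite !Cmod_mult, !Cmod_inv by (repeat apply Cmult_neq_0; auto;
      apply RtoC_neq_0; lra).
    rewrite !Cmod_mult, !Cmod_R, (Rabs_pos_eq t), (Rabs_pos_eq (1 + t)),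
      (Rabs_pos_eq 12) by lra.
    assert (H1 := Hsj 1 ltac:(lra)); assert (H2 := Hsj 2 ltac:(lra));
      assert (H3 := Hsj 3 ltac:(lra)).
    assert (HP : Cmod s * Cmod (s + 1) * Cmod (s + 2) * Cmod (s + 3) <= 360).
    { replace 360 with (3 * (3 + 1) * (3 + 2) * (3 + 3)) by ring.
      repeat apply Rmult_le_compat; auto using Cmod_ge_0;
        repeat apply Rmult_le_pos; auto using Cmod_ge_0. }
    assert (HQ : Cmod (E t) * / ((1 + t) * (1 + t) * (1 + t) * (1 + t)) <= 1).
    { assert (0 < (1 + t) * (1 + t) * (1 + t) * (1 + t))
        by (repeat apply Rmult_lt_0_compat; lra).
      apply Rmult_le_reg_r with ((1 + t) * (1 + t) * (1 + t) * (1 + t)); auto.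
      rewrite Rmult_assoc, Rinv_l, Rmult_1_r, Rmult_1_l by lra.
      apply Rle_trans with (1 := HEm t Ht).
      assert (1 <= (1 + t) * (1 + t)) by nra.
      replace ((1 + t) ^ 2) with ((1 + t) * (1 + t)) by ring; nra. }
    replace (30 * t ^ 2) with (360 * (t * t) * / 12 * 1) by field.
    apply Rmult_le_compat; auto.
    - repeat apply Rmult_le_pos; auto using Cmod_ge_0; lra.
    - apply Rmult_le_pos; [apply Cmod_ge_0|].
      left; apply Rinv_0_lt_compat; repeat apply Rmult_lt_0_compat; lra.
    - apply Rmult_le_compat_r; [lra|].
      apply Rmult_le_compat_r; [nra|auto]. }
  (* Expressing [t] through [1 + t] leaves [field] with the single atom whose nonvanishing is
     known. *)
  assert (Hvt : forall t : R, RtoC t = (RtoC (1 + t) - 1)%C)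
    by (intros; rewrite RtoC_plus; ring).
  assert (D1 : forall t, 0 <= t -> cder psi1 t (psi2 t)).
  { intros t Ht; assert (Ht0 := Hv t Ht); assert (Et := HE t Ht);
      assert (Wt := Hw t Ht).
    unfold psi1; eapply cder_eq; [|cder_tac].
    unfold psi2, w; rewrite (Hvt t); field; auto. }
  assert (D0 : forall t, 0 <= t -> cder psi t (psi1 t)).
  { intros t Ht; assert (Ht0 := Hv t Ht); assert (Et := HE t Ht);
      assert (Wt := Hw t Ht).
    unfold psi; eapply cder_eq; [|cder_tac].
    unfold psi1, w; rewrite (Hvt t); field; auto. }
  assert (D : forall t, 0 <= t ->
            cder (em_remainder s) t ((1 - s) * psi t)%C).
  { intros t Ht; assert (Ht0 := Hv t Ht); assert (Et := HE t Ht);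
      assert (Wt := Hw t Ht).
    apply cder_ext with (fun u : R =>
      (1 - s) / 2 * (u * (E u + 1)) - ((1 + u) * E u - 1)
      + (1 - s) * s / 12 * (u * u * (E u * w u - 1)))%C.
    { intros u'; unfold em_remainder, w; fold (E u').
      rewrite (RtoC_plus 1 u'); unfold Cdiv; ring. }
    eapply cder_eq; [|cder_tac].
    unfold psi, w; rewrite (Hvt t); field; auto. }
  assert (B1 : forall t, 0 <= t -> Cmod (psi1 t) <= 10 * t ^ 3).
  { intros t Ht; apply Rle_trans with (30 / INR 3 * t ^ 3).
    - apply mean_value_pow with psi2; auto; try lra.
      + unfold psi1; rewrite HE0, Hw0; ring.
      + intros; apply D1; lra.
      + intros; apply B2; lra.
    - right; simpl INR; field. }
  assert (B0 : forall t, 0 <= t -> Cmod (psi t) <= 5 / 2 * t ^ 4).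
  { intros t Ht; apply Rle_trans with (10 / INR 4 * t ^ 4).
    - apply mean_value_pow with psi1; auto; try lra.
      + unfold psi; rewrite HE0, Hw0; field.
      + intros; apply D0; lra.
      + intros; apply B1; lra.
    - right; simpl INR; field. }
  apply Rle_trans with (10 / INR 5 * u ^ 5).
  - apply mean_value_pow with (fun t => (1 - s) * psi t)%C; auto; try lra.
    + unfold em_remainder; rewrite Rplus_0_r; fold E.
      rewrite HE0; field; apply C1_nz.
    + intros; apply D; lra.
    + intros t Ht; rewrite Cmod_mult.
      assert (H1 : Cmod (1 - s) <= 4).
      { apply Rle_trans with (1 := Cmod_minus_le _ _); rewrite Cmod_1; lra. }
      apply Rle_trans with (4 * (5 / 2 * t ^ 4)); [|lra].
      apply Rmult_le_compat; auto using Cmod_ge_0; apply B0; lra.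
  - right; simpl INR; field.
Qed.

Lemma npow_S k s :
  npow (S (S k)) s = (npow (S k) s * em_kernel s (/ INR (S k)))%C.
Proof.
  assert (Hk := INR_S_pos k).
  assert (0 < / INR (S k)) by now apply Rinv_0_lt_compat.
  unfold npow, em_kernel; rewrite <- Cexp_plus; f_equal.
  replace (INR (S (S k))) with (INR (S k) * (1 + / INR (S k)))
    by (rewrite (S_INR (S k)); field; lra).
  rewrite ln_mult, RtoC_plus by lra; ring.
Qed.

Lemma npow_1 s : npow 1 s = 1.
Proof.
  unfold npow; simpl INR; rewrite ln_1, <- Cexp_0; f_equal; ring.
Qed.

Lemma zeta_step_S k s :
  zeta_step (S k) s =
  (INR (S k) * npow (S k) s * em_remainder s (/ INR (S k)))%C.
Proof.
  assert (Hk := INR_S_pos k).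
  unfold zeta_step, zeta_approx, zeta_trunc, em_remainder.
  change (Csum (fun k0 => npow (S k0) s) (S (S k))) with
    (Csum (fun k0 => npow (S k0) s) (S k) + npow (S (S k)) s)%C.
  rewrite npow_S.
  set (E := em_kernel s (/ INR (S k))); set (P := npow (S k) s).
  set (Z := Csum _ (S k)).
  rewrite (S_INR (S k)), !RtoC_plus.
  set (n := INR (S k)) in *.
  rewrite RtoC_inv by lra.
  assert (Hn : RtoC n <> 0) by (apply RtoC_neq_0; lra).
  assert (Hn1 : (n + 1)%C <> 0)
    by (rewrite <- RtoC_plus; apply RtoC_neq_0; lra).
  assert (Hn2 : (1 + n)%C <> 0)
    by (rewrite <- RtoC_plus; apply RtoC_neq_0; lra).
  field; auto.
Qed.

(** For [k >= 1] the three factors of [zeta_step_S] are at most [k], [k ^ 2] and [2 * k ^ (-5)],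
    together [2 / k ^ 2]; the 8 pays for [k + 1 <= 2 * k]. *)
Lemma zeta_step_bound k s : - 2 <= Re s -> Cmod s <= 3 ->
  Cmod (zeta_step k s) <= 8 * / INR (S k) ^ 2.
Proof.
  intros H1 H2; destruct k as [|k].
  - unfold zeta_step, zeta_approx, zeta_trunc.
    simpl Csum; simpl (INR 1); rewrite npow_1.
    replace (_ - 0)%C with ((1 - s) * (/ 2 + s / 12) - 1)%C
      by (field; apply C1_nz).
    apply Rle_trans with (1 := Cmod_minus_le _ _).
    rewrite Cmod_mult, Cmod_1.
    assert (Cmod (1 - s) <= 4).
    { apply Rle_trans with (1 := Cmod_minus_le _ _); rewrite Cmod_1; lra. }
    assert (Cmod (/ 2 + s / 12) <= 3 / 4).
    { apply Rle_trans with (1 := Cmod_triangle _ _).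
      rewrite Cmod_div, Cmod_inv, !Cmod_R, !Rabs_pos_eq
        by (try lra; apply RtoC_neq_0; lra).
      lra. }
    assert (Cmod (1 - s) * Cmod (/ 2 + s / 12) <= 4 * (3 / 4))
      by (apply Rmult_le_compat; auto using Cmod_ge_0).
    simpl; lra.
  - rewrite zeta_step_S, !Cmod_mult, Cmod_INR, Cmod_npow.
    assert (Hk := INR_S_pos k).
    assert (Hn : 1 <= INR (S k)) by (apply (le_INR 1); lia).
    rewrite (S_INR (S k)); set (n := INR (S k)) in *.
    assert (Hi : 0 <= / n <= 1).
    { split; [left; apply Rinv_0_lt_compat; lra|].
      rewrite <- Rinv_1; apply Rinv_le_contravar; lra. }
    assert (B := em_remainder_bound s (/ n) H1 H2 Hi).
    assert (Hl : 0 <= ln n) by (rewrite <- ln_1; apply ln_le; lra).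
    assert (He : exp (- Re s * ln n) <= n ^ 2).
    { apply Rle_trans with (exp (2 * ln n)).
      - assert (- Re s * ln n <= 2 * ln n) as [H|H] by nra.
        + left; now apply exp_increasing.
        + rewrite H; lra.
      - replace (2 * ln n) with (ln n + ln n) by ring.
        rewrite exp_plus, exp_ln by lra; simpl; lra. }
    apply Rle_trans with (n * n ^ 2 * (2 * (/ n) ^ 5)).
    + apply Rmult_le_compat; auto using Cmod_ge_0.
      * apply Rmult_le_pos; [lra|left; apply exp_pos].
      * apply Rmult_le_compat_l; lra.
    + replace (n * n ^ 2 * (2 * (/ n) ^ 5)) with (8 * / (2 * n) ^ 2)
        by (field; lra).
      apply Rmult_le_compat_l; [lra|].
      apply Rinv_le_contravar; [apply pow_lt; lra|].
      apply pow_incr; lra.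
Qed.

Lemma Rsum_inv_sqr_bound n : Rsum (fun k => / INR (S k) ^ 2) n <= 2.
Proof.
  destruct n as [|n]; [simpl; lra|].
  rewrite Rsum_S_l.
  generalize (Rsum_inv_sqr_tail_le 1 n (Nat.le_refl _)).
  simpl (1 + _)%nat; simpl (INR 1); lra.
Qed.

Definition zeta_ext (s : C) : C := Clim_seq (fun N => zeta_approx N s).

Lemma zeta_approx_cv s : - 2 <= Re s -> Cmod s <= 3 ->
  Ccv (fun N => zeta_approx N s) (zeta_ext s).
Proof.
  intros H1 H2.
  destruct (Csum_abs_cv (fun k => zeta_step k s)
    (fun k => 8 * / INR (S k) ^ 2) (8 * 2)) as [l Hl].
  - intros k; now apply zeta_step_bound.
  - intros n; rewrite Rsum_scal; generalize (Rsum_inv_sqr_bound n); lra.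
  - assert (H : Ccv (fun N => zeta_approx N s) l)
      by (eapply Ccv_ext; [|exact Hl]; intros; apply Csum_zeta_step).
    unfold zeta_ext; now rewrite (Clim_seq_unique _ _ H).
Qed.

Definition zeta_trunc' (N : nat) (s : C) : C :=
  (Csum (fun k => - ln (INR (S k)) * npow (S k) s) N
   + ln (INR N) * npow N s / 2
   + (npow N s / INR N / 12 - s / 12 * (ln (INR N) * npow N s / INR N)))%C.

Definition zeta_approx' (N : nat) (s : C) : C :=
  (- zeta_trunc N s + (1 - s) * zeta_trunc' N s
   + INR N * ln (INR N) * npow N s)%C.

Lemma cder_zeta_approx N s :
  cder (fun t => zeta_approx (S N) (s + RtoC t)) 0 (zeta_approx' (S N) s).
Proof.
  assert (Hp := fun k => cder_npow k s).
  assert (Hs : cder (fun t => s + RtoC t)%C 0 1).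
  { eapply cder_eq; [|apply cder_plus; [apply cder_const|apply cder_id]].
    ring. }
  assert (HC := cder_Csum (fun k t => npow (S k) (s + RtoC t)) 0 _ (S N)
                  (fun k => Hp (S k))).
  assert (HT : cder (fun t => zeta_trunc (S N) (s + RtoC t)) 0
                 (zeta_trunc' (S N) s)).
  { assert (HpN := Hp (S N)).
    set (P := fun t => npow (S N) (s + RtoC t)) in *.
    set (Q := fun t : R => (s + RtoC t)%C) in *.
    set (Z := fun t => Csum (fun k => npow (S k) (s + RtoC t)) (S N)) in *.
    apply cder_ext with (fun t : R =>
      Z t - P t / 2 + Q t / 12 * (P t / INR (S N)))%C; [reflexivity|].
    eapply cder_eq; [|cder_tac].
    unfold zeta_trunc', P, Q; replace (s + 0)%C with s by ring.
    field; apply RtoC_INR_S_neq_0. }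
  assert (HpN := Hp (S N)).
  set (T := fun t => zeta_trunc (S N) (s + RtoC t)) in *.
  set (P := fun t => npow (S N) (s + RtoC t)) in *.
  set (Q := fun t : R => (s + RtoC t)%C) in *.
  apply cder_ext with (fun t : R => (1 - Q t) * T t - INR (S N) * P t)%C;
    [reflexivity|].
  eapply cder_eq; [|cder_tac].
  unfold zeta_approx', T, P, Q; replace (s + 0)%C with s by ring; ring.
Qed.

Lemma Re_shift_le s0 h : Cmod h <= 1 -> Re s0 - 1 <= Re (s0 + h).
Proof.
  intros H; rewrite Re_plus; generalize (re_le_Cmod h); intros H1.
  apply Rabs_le_between in H1; lra.
Qed.

Lemma zeta_ext_series s0 : - 1 <= Re s0 -> Cmod s0 <= 2 ->
  exists A, (forall h, Cmod h < 1 -> CPS A h (zeta_ext (s0 + h))) /\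
            Ccv (fun N => zeta_approx' N s0) (A 1%nat).
Proof.
  intros H1 H2.
  assert (Hreg : forall h, Cmod h <= 1 ->
            - 2 <= Re (s0 + h) /\ Cmod (s0 + h) <= 3).
  { intros h Hh; split; [generalize (Re_shift_le s0 h Hh); lra|].
    apply Rle_trans with (1 := Cmod_triangle _ _); lra. }
  set (a := fun n => proj1_sig (entire_series_zeta_step n s0)).
  assert (Ha : forall n h, CPS (a n) h (zeta_step n (s0 + h)))
    by (intros n; exact (proj2_sig (entire_series_zeta_step n s0))).
  destruct (weierstrass a (fun n h => zeta_step n (s0 + h))
    (fun h => zeta_ext (s0 + h)) (fun k => 8 * / INR (S k) ^ 2) 1 2 (8 * 2))
    as [A [HA1 HA2]].
  - lra.
  - auto.
  - intros n h Hh; apply zeta_step_bound; apply Hreg; auto.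
  - intros n; rewrite Rsum_scal; generalize (Rsum_inv_sqr_bound n); lra.
  - intros h Hh; destruct (Hreg h ltac:(lra)).
    eapply Ccv_ext; [|now apply zeta_approx_cv].
    intros n; symmetry; apply Csum_zeta_step.
  - exists A; split; auto.
    (* The coefficient of index 1 of a finite sum of steps is the derivative of [zeta_approx] at
       [s0], which also has the closed form [zeta_approx']. *)
    apply Ccv_ext_loc with (Csum (fun n => a n 1%nat)) 1%nat; [|apply HA2].
    intros [|N] HN; [lia|].
    apply (cder_unique (fun t => zeta_approx (S N) (s0 + RtoC t)) 0).
    + apply cder_ext with
        (fun t => Csum (fun k => zeta_step k (s0 + RtoC t)) (S N)).
      { intros; apply Csum_zeta_step. }
      apply (cder_Csum (fun k t => zeta_step k (s0 + RtoC t))).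
      intros k; apply (CPS_cder (a k) (fun h => zeta_step k (s0 + h)) 1);
        auto; lra.
    + apply cder_zeta_approx.
Qed.

(** * The derivatives of zeta at 0 and -1 *)

Lemma is_lim_seq_ln_INR : is_lim_seq (fun N => ln (INR N)) p_infty.
Proof.
  apply (is_lim_comp_seq ln INR p_infty p_infty).
  - apply is_lim_ln_p.
  - exists O; intros; discriminate.
  - apply is_lim_seq_INR.
Qed.

(** For [Re s > 1] the corrections [N ^ (1 - s)], [N ^ (- s)] and [N ^ (- s - 1)] all tend to 0, so
    only the Dirichlet series is left. *)
Lemma zeta_approx_right (zeta : C -> C) s :
  is_riemann_zeta zeta -> 1 < Re s ->
  Ccv (fun N => zeta_approx N s) ((1 - s) * zeta s).
Proof.
  intros [_ Hz] Hs.
  assert (HZ := is_series_Ccv _ _ (Hz s Hs)).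
  change (Ccv (Csum (fun k => npow (S k) s)) (zeta s)) in HZ.
  assert (HP : Ccv (fun N => INR N * npow N s)%C 0).
  { apply Ccv_le with (fun N => exp (- (Re s - 1) * ln (INR N))).
    - exists 1%nat; intros N HN.
      assert (HNp : 0 < INR N) by (apply lt_0_INR; lia).
      replace (_ - 0)%C with (INR N * npow N s)%C by ring.
      rewrite Cmod_mult, Cmod_INR, Cmod_npow.
      rewrite <- (exp_ln (INR N)) at 1 by auto.
      rewrite <- exp_plus; right; f_equal; ring.
    - apply (is_lim_comp_seq exp _ m_infty 0).
      + apply is_lim_exp_m.
      + exists O; intros; discriminate.
      + replace m_infty with (Rbar_mult (- (Re s - 1)) p_infty).
        * apply is_lim_seq_scal_l, is_lim_seq_ln_INR.
        * simpl; destruct (Rle_dec 0 (- (Re s - 1))); [exfalso; lra|].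
          reflexivity. }
  assert (Hle : forall u : nat -> C, (forall N, (1 <= N)%nat ->
            Cmod (u N) <= Cmod (INR N * npow N s)) -> Ccv u 0).
  { intros u Hu; apply Ccv_le with (fun N => Cmod (INR N * npow N s - 0)%C).
    - exists 1%nat; intros N HN.
      replace (u N - 0)%C with (u N) by ring.
      replace (_ - 0)%C with (INR N * npow N s)%C by ring; auto.
    - exact HP. }
  assert (HP1 : Ccv (fun N => npow N s) 0).
  { apply Hle; intros N HN; rewrite Cmod_mult, Cmod_INR.
    apply (le_INR 1) in HN; simpl INR in HN.
    generalize (Cmod_ge_0 (npow N s)); nra. }
  assert (HP2 : Ccv (fun N => npow N s / INR N)%C 0).
  { apply Hle; intros N HN.
    apply (le_INR 1) in HN; simpl INR in HN.
    rewrite Cmod_div, Cmod_mult, Cmod_INR by (apply RtoC_neq_0; lra).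
    generalize (Cmod_ge_0 (npow N s)); intros H0.
    apply Rle_trans with (Cmod (npow N s)); [|nra].
    apply Rmult_le_reg_r with (INR N); [lra|].
    unfold Rdiv; rewrite Rmult_assoc, Rinv_l by lra; nra. }
  apply Ccv_ext_loc with (fun N => (1 - s) * (Csum (fun k => npow (S k) s) N
     - / 2 * npow N s + s / 12 * (npow N s / INR N))
     - INR N * npow N s)%C 1%nat.
  - intros [|N] HN; [lia|].
    unfold zeta_approx, zeta_trunc; field.
    apply RtoC_INR_S_neq_0.
  - set (Z := Csum (fun k => npow (S k) s)) in *.
    set (P := fun N => (INR N * npow N s)%C) in *.
    set (P2 := fun N => (npow N s / INR N)%C) in *.
    set (P1 := fun N => npow N s) in *.
    apply Ccv_ext with (fun N => (1 - s) * (Z N - / 2 * P1 N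
       + s / 12 * P2 N) - P N)%C; [reflexivity|].
    clearbody Z P P1 P2.
    eapply Ccv_eq; [|ccv]; ring.
Qed.

Lemma zeta_continuation (zeta : C -> C) (s1 : C) :
  is_riemann_zeta zeta -> s1 = 0 \/ s1 = (- (1))%C ->
  exists r, 0 < r /\ forall h, Cmod h < r ->
    ((1 - (s1 + h)) * zeta (s1 + h) - zeta_ext (s1 + h))%C = 0.
Proof.
  intros Hz Hs1.
  set (d := fun s => ((1 - s) * zeta s - zeta_ext s)%C).
  assert (Hd : forall s : C, s <> RtoC 1 -> - 1 <= Re s -> Cmod s <= 2 ->
            analytic_near d s).
  { intros s H1 H2 H3; apply analytic_near_minus.
    - apply analytic_near_mult_1_minus, analytic_at_near, Hz, H1.
    - destruct (zeta_ext_series s H2 H3) as [A [HA _]].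
      exists A, 1; split; [lra|auto]. }
  (* The region [-1 <= Re s], [Cmod s <= 2] is convex, so it is enough to have the endpoints in
     it. *)
  assert (Hsegment : forall p q : C, p <> q ->
    - 1 <= Re p -> - 1 <= Re q -> Cmod p <= 2 -> Cmod q <= 2 ->
    (forall t, 0 <= t <= 1 -> (p + t * (q - p))%C <> 1) ->
    (exists r, 0 < r /\ forall h, Cmod h < r -> d (p + h)%C = 0) ->
    exists r, 0 < r /\ forall h, Cmod h < r -> d (q + h)%C = 0).
  { intros p q Hpq Hp Hq Hp2 Hq2 Hne; apply identity_on_segment; auto.
    intros t Ht; apply Hd; auto.
    - rewrite Re_plus, re_scal_l, Re_minus; nra.
    - replace (p + t * (q - p))%C with ((1 - t)%R * p + t * q)%C
        by (rewrite RtoC_minus; ring).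
      apply Rle_trans with (1 := Cmod_triangle _ _).
      rewrite !Cmod_mult, !Cmod_R, !Rabs_pos_eq by lra; nra. }
  change (exists r, 0 < r /\ forall h, Cmod h < r -> d (s1 + h)%C = 0).
  (* The straight segment from 2 to 0 or -1 passes through the pole, hence the detour through
     [Ci]. *)
  assert (Hi : exists r, 0 < r /\ forall h, Cmod h < r -> d (Ci + h)%C = 0).
  { apply (Hsegment 2 Ci).
    - intros E; injection E; lra.
    - simpl; lra.
    - simpl; lra.
    - rewrite Cmod_R, Rabs_pos_eq; lra.
    - rewrite Cmod_Ci; lra.
    - intros t Ht E; injection E; simpl; lra.
    (* Within [/ 2] of the point 2 the Dirichlet series converges, and both functions are limits of
       the same [zeta_approx]. *)
    - exists (/ 2); split; [lra|]; intros h Hh.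
      assert (H1 := Re_shift_le 2 h ltac:(lra)).
      assert (H2 : / 2 <= Re h + 1).
      { generalize (re_le_Cmod h); intros H; apply Rabs_le_between in H; lra. }
      assert (H3 : 1 < Re (2 + h)) by (rewrite Re_plus, re_RtoC; lra).
      unfold d; apply (proj1 (Ceq_minus _ _)).
      apply (Ccv_unique (fun N => zeta_approx N (2 + h))).
      + now apply zeta_approx_right.
      + apply zeta_approx_cv; [lra|].
        apply Rle_trans with (1 := Cmod_triangle _ _).
        rewrite Cmod_R, Rabs_pos_eq; lra. }
  destruct Hs1 as [-> | ->]; apply (Hsegment Ci); auto.
  - apply Ci_nz.
  - simpl; lra.
  - simpl; lra.
  - rewrite Cmod_Ci; lra.
  - rewrite Cmod_0; lra.
  - intros t Ht E; injection E; simpl; lra.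
  - intros E; injection E; lra.
  - simpl; lra.
  - simpl; lra.
  - rewrite Cmod_Ci; lra.
  - rewrite Cmod_m1; lra.
  - intros t Ht E; injection E; simpl; lra.
Qed.

(** Near [s1] the functions [zeta_ext] and [(1 - s) * zeta s] agree, so the limit of the derivatives
    is given by the product rule. *)
Lemma zeta_derivative_limit (zeta : C -> C) (s1 : C) :
  is_riemann_zeta zeta -> s1 = 0 \/ s1 = (- (1))%C ->
  Ccv (fun N => zeta_approx N s1) ((1 - s1) * zeta s1) /\
  Ccv (fun N => zeta_approx' N s1)
      ((1 - s1) * C_derive zeta s1 - zeta s1).
Proof.
  intros Hz Hs1.
  destruct (zeta_continuation zeta s1 Hz Hs1) as [r [Hr Hd]].
  assert (Hreg : - 1 <= Re s1 /\ Cmod s1 <= 2 /\ s1 <> 1).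
  { destruct Hs1 as [-> | ->].
    - rewrite Cmod_0; simpl; repeat split; try lra.
      intros E; injection E; lra.
    - rewrite Cmod_m1; simpl; repeat split; try lra.
      intros E; injection E; lra. }
  destruct Hreg as [H1 [H2 H3]].
  assert (E0 : zeta_ext s1 = ((1 - s1) * zeta s1)%C).
  { specialize (Hd 0 ltac:(rewrite Cmod_0; lra)).
    replace (s1 + 0)%C with s1 in Hd by ring.
    now apply Ceq_minus in Hd. }
  split.
  - rewrite <- E0; apply zeta_approx_cv; lra.
  - destruct (zeta_ext_series s1 H1 H2) as [A [HA1 HA2]].
    destruct (analytic_at_near _ _ (proj1 Hz s1 H3)) as [b [r' [Hr' Hb]]].
    assert (D1 := CPS_cder b (fun h => zeta (s1 + h)%C) r' Hr' Hb).
    cbv beta in D1.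
    assert (D2 := CPS_cder A (fun h => zeta_ext (s1 + h)%C) 1 Rlt_0_1 HA1).
    cbv beta in D2.
    rewrite (C_derive_cder _ _ _ D1).
    replace ((1 - s1) * b 1%nat - zeta s1)%C with (A 1%nat); auto.
    apply (cder_unique _ _ _ _ D2).
    assert (Hs : cder (fun t => 1 - (s1 + RtoC t))%C 0 (- (1))%C).
    { eapply cder_eq; [|apply cder_minus; [apply cder_const|
        apply cder_plus; [apply cder_const|apply cder_id]]].
      ring. }
    eapply cder_ext_loc;
      [|eapply cder_eq; [|apply (cder_mult _ _ _ _ _ Hs D1)]].
    + exists (mkposreal r Hr); intros t Ht.
      change (Rabs (t - 0) < r) in Ht; rewrite Rminus_0_r in Ht.
      apply (proj2 (Ceq_minus _ _)), Hd; now rewrite Cmod_R.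
    + replace (s1 + 0)%C with s1 by ring; ring.
Qed.

Lemma npow_0_r n : npow n 0 = 1.
Proof. unfold npow; rewrite <- Cexp_0; f_equal; ring. Qed.

Lemma npow_m1_r k : npow (S k) (- (1)) = INR (S k).
Proof.
  unfold npow; replace (- - (1) * ln (INR (S k)))%C
    with (RtoC (ln (INR (S k)))) by ring.
  rewrite Cexp_RtoC, exp_ln; auto using INR_S_pos.
Qed.

Lemma Rsum_const_1 N : Rsum (fun _ => 1) N = INR N.
Proof. induction N; [reflexivity|rewrite S_INR, <- IHN; reflexivity]. Qed.

Lemma Rsum_INR_S N : Rsum (fun k => INR (S k)) N = INR N * (INR N + 1) / 2.
Proof.
  induction N as [|N IH]; [simpl; field|].
  change (Rsum ?f (S N)) with (Rsum f N + f N); cbv beta.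
  rewrite IH, S_INR; field.
Qed.

Lemma Ccv_inv_INR : Ccv (fun N => RtoC (/ INR N)) 0.
Proof. apply Ccv_RtoC, is_lim_seq_inv_INR. Qed.

Lemma zeta_derivative_0 (zeta : C -> C) :
  is_riemann_zeta zeta -> C_derive zeta 0 = (- (ln (2 * PI) / 2))%C.
Proof.
  intros Hz.
  destruct (zeta_derivative_limit zeta 0 Hz (or_introl eq_refl)) as [H0 H1].
  set (b := C_derive zeta 0) in *.
  (* At [s = 0] the approximation equals [N - / 2 - N] for every [N >= 1]. *)
  assert (E0 : zeta 0 = (- / 2)%C).
  { replace (zeta 0) with ((1 - 0) * zeta 0)%C by ring.
    apply (Ccv_unique _ _ _ H0).
    apply Ccv_ext_loc with (fun _ => (- / 2)%C) 1%nat; [|apply Ccv_const].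
    intros [|N] HN; [lia|].
    unfold zeta_approx, zeta_trunc.
    rewrite (Csum_ext _ (fun k => RtoC 1)) by (intros; apply npow_0_r).
    rewrite Csum_RtoC, Rsum_const_1, npow_0_r; field.
    apply RtoC_INR_S_neq_0. }
  set (a := fun N => INR N * ln (INR N) - INR N + ln (INR N) / 2 - ln_fact N).
  assert (Ha : Ccv (fun N => RtoC (a N)) b).
  (* The limit of [zeta_approx' N 0] is [b - zeta 0 = b + / 2], and [/ (12 N)] is the derivative of
     the [B_2] term. What remains is the sequence of [stirling_constant], whose convergence is
     thereby obtained from zeta. *)
  { apply Ccv_ext_loc with (fun N => zeta_approx' N 0
       - (/ 12 * RtoC (/ INR N) + / 2))%C 1%nat.
    - intros [|N] HN; [lia|]; assert (HS := INR_S_pos N).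
      unfold zeta_approx', zeta_trunc, zeta_trunc', a, ln_fact.
      rewrite (Csum_ext (fun k => npow (S k) 0) (fun k => RtoC 1))
        by (intros; apply npow_0_r).
      rewrite (Csum_ext (fun k => - _ * _)%C
                 (fun k => - (1) * RtoC (ln (INR (S k))))%C)
        by (intros; rewrite npow_0_r; ring).
      rewrite Csum_scal, !Csum_RtoC, Rsum_const_1, npow_0_r.
      set (L := Rsum _ (S N)).
      rewrite RtoC_minus, RtoC_plus, RtoC_minus, RtoC_mult, RtoC_div,
        RtoC_inv by lra.
      field; apply RtoC_neq_0; lra.
    - eapply Ccv_eq; [|apply Ccv_minus; [exact H1|apply Ccv_plus;
        [apply Ccv_scal, Ccv_inv_INR|apply Ccv_const]]].
      rewrite E0; field. }
  assert (HR := stirling_constant (Re b) (Ccv_Re _ _ Ha)).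
  assert (HI : Im b = 0).
  { assert (H := is_lim_seq_unique _ _ (Ccv_Im _ _ Ha)).
    rewrite (Lim_seq_ext _ (fun _ => 0)), Lim_seq_const in H by reflexivity.
    injection H; auto. }
  rewrite <- RtoC_div, <- RtoC_opp by lra.
  apply C_eq; auto.
Qed.

Lemma zeta_derivative_m1 (zeta : C -> C) :
  is_riemann_zeta zeta ->
  Ccv (fun N => RtoC (sum_k_ln N
         - (INR N ^ 2 / 2 + INR N / 2 + / 12) * ln (INR N) + INR N ^ 2 / 4))
      (/ 12 - C_derive zeta (- (1))).
Proof.
  intros Hz.
  destruct (zeta_derivative_limit zeta (- (1)) Hz (or_intror eq_refl))
    as [H0 H1].
  set (b := C_derive zeta (- (1))) in *.
  assert (E0 : zeta (- (1))%C = (- / 12)%C).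
  (* At [s = -1] the approximations are constant too: [2 * (N * (N + 1) / 2 - N / 2 - / 12) - N ^
     2]. *)
  { assert (E : ((1 - - (1)) * zeta (- (1)))%C = (- / 6)%C).
    { apply (Ccv_unique _ _ _ H0).
      apply Ccv_ext_loc with (fun _ => (- / 6)%C) 1%nat; [|apply Ccv_const].
      intros [|N] HN; [lia|].
      unfold zeta_approx, zeta_trunc.
      rewrite (Csum_ext _ (fun k => RtoC (INR (S k))))
        by (intros; apply npow_m1_r).
      rewrite Csum_RtoC, Rsum_INR_S, npow_m1_r.
      rewrite RtoC_div, RtoC_mult, RtoC_plus by lra; field.
      apply RtoC_INR_S_neq_0. }
    replace (zeta (- (1))%C) with (/ 2 * ((1 - - (1)) * zeta (- (1))))%C
      by field.
    rewrite E; field. }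
  (* The limit of [zeta_approx' N (- (1))] is [2 * b + / 12]; multiplied by [- / 2] and increased by
     [/ 8] it becomes [/ 12 - b]. *)
  apply Ccv_ext_loc with (fun N => - (/ 2) * zeta_approx' N (- (1))
       + / 8)%C 1%nat.
  - intros [|N] HN; [lia|]; assert (HS := INR_S_pos N).
    unfold zeta_approx', zeta_trunc, zeta_trunc', sum_k_ln.
    rewrite (Csum_ext (fun k => npow (S k) (- (1))) (fun k => RtoC (INR (S k))))
      by (intros; apply npow_m1_r).
    rewrite (Csum_ext (fun k => - _ * _)%C
               (fun k => - (1) * RtoC (INR (S k) * ln (INR (S k))))%C)
      by (intros; rewrite npow_m1_r, RtoC_mult; ring).
    rewrite Csum_scal, !Csum_RtoC, Rsum_INR_S, npow_m1_r.
    set (L := Rsum _ (S N)).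
    rewrite !RtoC_plus, !RtoC_minus, !RtoC_mult, !RtoC_plus, !RtoC_div,
      RtoC_pow, RtoC_inv, RtoC_mult, RtoC_plus by lra.
    field; apply RtoC_neq_0; lra.
  - eapply Ccv_eq; [|apply Ccv_plus; [apply Ccv_scal, H1|apply Ccv_const]].
    rewrite E0; field.
Qed.

(** * Comparison with the given branches and conclusion *)

Lemma ccont_analytic (f : C -> C) z : analytic_at f z -> ccont f z.
Proof.
  intros H; apply analytic_at_near in H; destruct H as [a [r [Hr H]]].
  destruct (CPS_remainder a (fun h => f (z + h)%C) r Hr H) as [rho [Hrho HK]].
  destruct (CPS_quadratic a (fun h => f (z + h)%C) r Hr H) as [E0 _].
  destruct (HK 1%nat) as [K [_ B]].
  apply (ccont_lipschitz _ _ K rho); [lra|]; intros w Hw.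
  specialize (B (w - z)%C ltac:(lra)).
  replace (z + (w - z))%C with w in B by ring.
  replace (f w - f z)%C
    with (f w - Csum (fun k => a k * (w - z) ^ k) 1)%C.
  - simpl pow in B; lra.
  - simpl Csum; rewrite E0; replace (z + 0)%C with z by ring.
    simpl (_ ^ 0)%C; ring.
Qed.

(** Lets [clog] and [logG_lim] stand for the arbitrary branches [Log] and [logG]; the normalization
    on the positive axis is used at the point 1. *)
Lemma log_branch_unique (f L g : C -> C) :
  is_log_branch f L ->
  (forall z, 0 < Re z -> ccont g z /\ Cexp (g z) = f z) -> Im (g 1) = 0 ->
  forall z, 0 < Re z -> L z = g z.
Proof.
  intros [HL HL1] Hg Hg1; apply log_unique.
  - intros z Hz; destruct (HL z Hz) as [Ha He]; destruct (Hg z Hz) as [Hc He'].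
    repeat split; auto; [now apply ccont_analytic|congruence].
  - rewrite Hg1; apply HL1; lra.
Qed.

Lemma sum_n_m_Csum (f : nat -> C) n :
  @sum_n_m C_AbelianMonoid f 1 n = Csum (fun k => f (S k)) n.
Proof.
  induction n as [|n IH].
  - rewrite sum_n_m_zero by lia; reflexivity.
  - rewrite sum_n_Sm by lia; rewrite IH; reflexivity.
Qed.

Theorem lemma5p1 :
  forall (zeta Log logG : C -> C),
    is_riemann_zeta zeta ->
    is_log_branch (fun z : C => z) Log ->
    is_log_branch (fun z : C => BarnesG (z + 1)%C) logG ->
  forall n : nat, (1 <= n)%nat ->
  exists K M : R, forall z : C, 0 < Re z -> M < Cmod z ->
    Cmod (logG z
          - (z ^ 2 / 2 * (Log z - (3 / 2)%R)
             - Log z / 12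
             - z * C_derive zeta 0
             + C_derive zeta (- (1))
             + sum_n_m (fun k : nat =>
                 bernoulli (2 * k + 2)
                 / ((4 * INR k * (INR k + 1))%R * z ^ (2 * k))) 1 n))%C
    <= K / Cmod z ^ (2 * n + 2).
Proof.
  intros zeta Log logG Hzeta HLog HlogG n _.
  destruct (logG_lim_asymp (C_derive zeta (- (1))) n euler_gamma_lim
              (zeta_derivative_m1 zeta Hzeta)) as [K HK].
  (* Beyond modulus 2, every [/ (z + k)] with [k >= 1] lies in the disc of radius [/ 2] on which the
     expansions hold. *)
  exists K, 2; intros z Hz Hm.
  apply Rle_trans with (2 := HK z Hz Hm); right; do 2 f_equal.
  - apply (log_branch_unique _ _ _ HlogG); auto using Im_logG_lim_1.
    intros w Hw; split; [now apply ccont_logG_lim|now apply Cexp_logG_lim].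
  - rewrite (log_branch_unique _ _ clog HLog); auto.
    2: intros w Hw; split; [now apply ccont_clog|now apply Cexp_clog].
    2: now rewrite clog_1.
    rewrite zeta_derivative_0 by auto.
    unfold asymp, barnes_main; rewrite sum_n_m_Csum.
    rewrite (Csum_ext _ (fun k => barnes_coef (S k)
                                  * (/ z) ^ S (2 * k + 1))%C).
    + field.
    + intros k _; unfold barnes_coef.
      assert (Hz0 := Cneq_0_Re z Hz).
      assert (HS := INR_S_pos k).
      rewrite RtoC_div by nra.
      replace (S (2 * k + 1)) with (2 * S k)%nat by lia.
      rewrite Cpow_inv by auto; field; split.
      * now apply Cpow_nz.
      * apply RtoC_neq_0; nra.
Qed.
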